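(* Let $L$ be strongly convex in $v$. Then the solution $(f,\rho)$ of the mean field control problem $$\inf_f\int_0^{t_{\mathrm{end}}}\!\!\int_{\mathbb{R}^d}\Big[L\big(t,x,f(t,x)+\gamma\nabla_x\log\rho(t,x)\big)+F(t,x,\rho(t,x))\Big]\rho(t,x)\,dx\,dt+\int_{\mathbb{R}^d}G(x,\rho(t_{\mathrm{end}},x))\,\rho(t_{\mathrm{end}},x)\,dx$$ subject to $$\partial_t\rho(t,x)+\nabla_x\cdot(\rho(t,x)f(t,x))=0,\qquad \rho(0,x)=\rho_0(x),$$ is as follows: there is a function $\psi:[0,t_{\mathrm{end}}]\times\mathbb{R}^d\to\mathbb{R}$ such that $$f(t,x)=\mathrm{D}_pH\big(t,x,\nabla_x\psi(t,x)+\gamma\nabla_x\log\rho(t,x)\big)-\gamma\nabla_x\log\rho(t,x),$$ where $\rho$ and $\psi$ satisfy the system $$\begin{cases} \partial_t\rho(t,x)+\nabla_x\cdot\big(\rho(t,x)\,\mathrm{D}_pH\big)=\gamma\Delta_x\rho(t,x),\\[4pt] \partial_t\psi(t,x)+\nabla_x\psi(t,x)^{\top}\mathrm{D}_pH-\gamma\nabla_x\cdot\mathrm{D}_pH+\gamma\Delta_x\psi(t,x)-L(t,x,\mathrm{D}_pH)\\ \qquad-\widetilde F(t,x,\rho(t,x))+2\gamma^2\Delta_x\log\rho(t,x)+\gamma^2|\nabla_x\log\rho(t,x)|^2=0,\\[4pt] \rho(0,x)=\rho_0(x),\qquad \psi(t_{\mathrm{end}},x)=-\widetilde G(x,\rho(t_{\mathrm{end}},x))-\gamma\log\rho(t_{\mathrm{end}},x).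 \end{cases}$$ Here $\mathrm{D}_pH$ is short for $\mathrm{D}_pH(t,x,\nabla_x\psi(t,x)+\gamma\nabla_x\log\rho(t,x))$, $\widetilde F(t,x,\rho)=\frac{\partial}{\partial\rho}\big(F(t,x,\rho)\rho\big)=\frac{\partial F}{\partial\rho}(t,x,\rho)\,\rho+F(t,x,\rho)$, and $\widetilde G(x,\rho)=\frac{\partial G}{\partial\rho}(x,\rho)\,\rho+G(x,\rho)$.
   Context: Data: $t_{\mathrm{end}}>0$ is the time horizon, $\gamma>0$ is the diffusion coefficient, $\rho_0$ is a given initial probability density on $\mathbb{R}^d$, $L:\mathbb{R}\times\mathbb{R}^d\times\mathbb{R}^d\to\mathbb{R}$, $(t,x,v)\mapsto L(t,x,v)$, is the running cost, $F:\mathbb{R}\times\mathbb{R}^d\times\mathbb{R}\to\mathbb{R}$ is a density-dependent running cost, and $G:\mathbb{R}^d\times\mathbb{R}\to\mathbb{R}$ is the terminal cost. Standing regularity: $L$ and $F$ are $C^{1,2,2}$ Hölder continuous and $G$ is $C^{2,2}$ Hölder continuous. The Hamiltonian is $$H(t,x,p)=\sup_{v\in\mathbb{R}^d}\big(v^{\top}p-L(t,x,v)\big),$$ and $\mathrm{D}_pH$ is its gradient with respect to $p$. The controlled density is assumed regular and positive, so that $\log\rho$ and the derivatives appearing above make sense. The problem is the reformulation, via $f=v-\gamma\nabla_x\log\rho$, of minimizing $\int_0^{t_{\mathrm{end}}}\int[L(t,x,v)+F(t,x,\rho)]\rho\,dx\,dt+\int G(x,\rho(t_{\mathrm{end}},x))\rho(t_{\mathrm{end}},x)\,dx$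 over $v$ subject to $\partial_t\rho+\nabla_x\cdot(\rho v)=\gamma\Delta_x\rho$, $\rho(0,\cdot)=\rho_0$. Gradients are column vectors, $\nabla_x\cdot$ is the divergence, $\Delta_x$ the Laplacian, $|\cdot|$ the Euclidean norm; $\nabla_x\cdot\mathrm{D}_pH$ is the divergence in $x$ of the composed vector field $x\mapsto\mathrm{D}_pH(t,x,\nabla_x\psi(t,x)+\gamma\nabla_x\log\rho(t,x))$. *)

(* Defs.v *)
From HB Require Import structures.
From mathcomp Require Import all_boot all_order all_algebra.
From mathcomp Require Import all_classical all_reals all_analysis.

Set Implicit Arguments.
Unset Strict Implicit.
Unset Printing Implicit Defensive.

Import Order.TTheory GRing.Theory Num.Theory.
Import numFieldNormedType.Exports.

Local Open Scope ring_scope.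
Local Open Scope classical_set_scope.

(* Lebesgue measure on R^n, realised on n.-tuple R, the library's n-fold
   product sigma-algebra: the image of lebesgue_measure \x lebesgue_tuple n
   under (x, y) |-> x :: y is lebesgue_tuple n.+1. *)
Section lebesgue_measure_tuple.
Context {R : realType}.
Local Notation mR := (measurableTypeR R).

Definition tuple_cons n (z : mR * n.-tuple mR) : n.+1.-tuple mR :=
  [the n.+1.-tuple mR of z.1 :: z.2].

Lemma measurable_tuple_cons n : measurable_fun [set: _] (@tuple_cons n).
Proof. exact: measurable_cons. Qed.

Section step.
Variables (n : nat) (mu : {sigma_finite_measure set (n.-tuple mR) -> \bar R}).

Definition lebesgue_cons : set (n.+1.-tuple mR) -> \bar R :=
  pushforward ((@lebesgue_measure R) \x mu)%E (@tuple_cons n).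

Let lebesgue_cons0 : lebesgue_cons set0 = 0%E.
Proof. by rewrite /lebesgue_cons /pushforward preimage_set0 measure0. Qed.

Let lebesgue_cons_ge0 A : (0 <= lebesgue_cons A)%E.
Proof. by rewrite /lebesgue_cons /pushforward measure_ge0. Qed.

Let lebesgue_cons_sigma_additive : semi_sigma_additive lebesgue_cons.
Proof.
move=> F mF tF mUF; rewrite /lebesgue_cons /pushforward preimage_bigcup.
have mP A : measurable A -> measurable (@tuple_cons n @^-1` A).
  by move=> mA; rewrite -[X in measurable X]setTI; exact: measurable_tuple_cons.
apply: measure_semi_sigma_additive.
- by move=> k; exact: mP.
- apply/trivIsetP => /= i j _ _ ij; rewrite -preimage_setI.
  by move/trivIsetP : tF => /(_ _ _ _ _ ij) ->//; rewrite preimage_set0.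
- by rewrite -preimage_bigcup; exact: mP.
Qed.

HB.instance Definition _ := isMeasure.Build _ _ _ lebesgue_cons
  lebesgue_cons0 lebesgue_cons_ge0 lebesgue_cons_sigma_additive.

Let lebesgue_cons_sigma_finite : sigma_finite [set: _] lebesgue_cons.
Proof.
have /sigma_finiteP[F [TF ndF Foo]] := sigma_finiteT (@lebesgue_measure R).
have /sigma_finiteP[G [TG ndG Goo]] := sigma_finiteT mu.
pose hd (x : n.+1.-tuple mR) : mR := thead x.
pose tl (x : n.+1.-tuple mR) : n.-tuple mR := [tuple of behead x].
exists (fun k => (hd @^-1` F k) `&` (tl @^-1` G k)).
  rewrite predeqE => x; split => // _.
  have [i _ Fi] : (\bigcup_i F i) (hd x) by rewrite -TF.
  have [j _ Gj] : (\bigcup_i G i) (tl x) by rewrite -TG.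
  exists (maxn i j) => //; split => /=.
  - by move: (hd x) Fi; exact/subsetPset/ndF/leq_maxl.
  - by move: (tl x) Gj; exact/subsetPset/ndG/leq_maxr.
move=> k; have [mF Fk] := Foo k; have [mG Gk] := Goo k; split.
  apply: measurableI.
  - rewrite -[X in measurable X]setTI.
    exact: (@measurable_tnth _ mR n.+1 ord0).
  - rewrite -[X in measurable X]setTI.
    exact: (@measurable_behead _ mR n).
rewrite /lebesgue_cons /pushforward.
rewrite (_ : _ @^-1` _ = F k `*` G k); last first.
  rewrite predeqE => -[x y] /=; rewrite /hd /tl /tuple_cons /=.
  suff -> : [tuple of behead [the n.+1.-tuple mR of x :: y]] = y by [].
  exact/val_inj.
by rewrite product_measure1E// lte_mul_pinfty// ge0_fin_numE.
Qed.

HB.instance Definition _ := Measure_isSigmaFinite.Build _ _ _ lebesgue_cons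
  lebesgue_cons_sigma_finite.

End step.

Fixpoint lebesgue_tuple n : {sigma_finite_measure set (n.-tuple mR) -> \bar R} :=
  if n is m.+1 then lebesgue_cons (lebesgue_tuple m)
  else \d_([tuple] : 0.-tuple mR).

End lebesgue_measure_tuple.

Section vector_calculus.
Context {R : realType} {d : nat}.
Local Notation rV := 'rV[R]_d.
Implicit Types (g : rV -> R) (u : rV -> rV).

Definition dotp (a b : rV) : R := \sum_(i < d) a ord0 i * b ord0 i.

(* The norm `|_| of the library on 'rV is the sup norm, not the Euclidean one. *)
Definition norm2 (a : rV) : R := Num.sqrt (dotp a a).

Definition grad g x : rV := \row_(i < d) 'D_(delta_mx ord0 i) g x.

Definition divg u x : R :=
  \sum_(i < d) 'D_(delta_mx ord0 i) (fun y => u y ord0 i) x.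

Definition laplacian g x : R := divg (grad g) x.

Definition vec_of (x : d.-tuple (measurableTypeR R)) : rV := \row_i tnth x i.

Definition integral_Rd (g : rV -> R) : \bar R :=
  (\int[lebesgue_tuple d]_x (g (vec_of x))%:E)%E.

Definition integrable_Rd (g : rV -> R) : Prop :=
  (lebesgue_tuple d).-integrable [set: d.-tuple (measurableTypeR R)]
    (fun x => (g (vec_of x))%:E).

Definition prob_density g : Prop :=
  [/\ forall x, 0 <= g x,
      measurable_fun [set: d.-tuple (measurableTypeR R)]
        (fun x => g (vec_of x))
    & integral_Rd g = 1%E].

End vector_calculus.

Section regularity.
Context {R : realType}.

(* Hoelder continuity on every bounded set. A global Hoelder condition would
   exclude every strongly convex running cost, which grows quadratically. *)
Definition loc_holder (V : normedModType R) (u : V -> R) : Prop :=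
  exists2 a : R, 0 < a <= 1 &
    forall r : R, exists C : R, forall y z : V, `|y| <= r -> `|z| <= r ->
      `|u y - u z| <= C * `|y - z| `^ a.

(* Second-order directional derivatives in all directions w, w' of a product
   W = X * Y cover the second derivatives in X, in Y, and the mixed ones. *)
Definition holder_C2 (W : normedModType R) (u : W -> R) : Prop :=
  loc_holder u /\
  forall w w' : W,
    [/\ forall y, derivable u y w, loc_holder ('D_w u),
        forall y, derivable ('D_w u) y w' & loc_holder ('D_w' ('D_w u))].

Definition holder_C12 (W : normedModType R) (u : R -> W -> R) : Prop :=
  [/\ loc_holder (fun z : R * W => u z.1 z.2),
      forall t y, derivable (u ^~ y) t 1,
      loc_holder (fun z : R * W => derive1 (u ^~ z.2) z.1)
    & forall w w' : W,
      [/\ forall t y, derivable (u t) y w,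
          loc_holder (fun z : R * W => 'D_w (u z.1) z.2),
          forall t y, derivable ('D_w (u t)) y w'
        & loc_holder (fun z : R * W => 'D_w' ('D_w (u z.1)) z.2)]].

Context {d : nat}.
Local Notation rV := 'rV[R]_d.

Definition regular_running_cost (L : R -> rV -> rV -> R) : Prop :=
  @holder_C12 (rV * rV)%type (fun t z => L t z.1 z.2).

Definition regular_density_cost (F : R -> rV -> R -> R) : Prop :=
  @holder_C12 (rV * R)%type (fun t z => F t z.1 z.2).

Definition regular_terminal_cost (G : rV -> R -> R) : Prop :=
  @holder_C2 (rV * R)%type (fun z => G z.1 z.2).

(* Regularity on [0, T] x R^d of functions of which only the values at times
   in [0, T] matter. Space derivatives exist and are continuous up to t = 0 and
   t = T; time derivatives are taken in the open interval only, since a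
   two-sided derivative at 0 or T would involve values outside [0, T]. *)
Definition C00 (V : normedModType R) (T : R) (u : R -> rV -> V) : Prop :=
  {within `[0, T] `*` [set: rV], continuous (fun z : R * rV => u z.1 z.2)}.

Definition C01 (V : normedModType R) (T : R) (u : R -> rV -> V) : Prop :=
  C00 T u /\ forall w : rV,
    (forall t x, 0 <= t <= T -> derivable (u t) x w) /\
    C00 T (fun t => 'D_w (u t)).

Definition C12 (T : R) (u : R -> rV -> R) : Prop :=
  [/\ C01 T u,
      forall w : rV, C01 T (fun t => 'D_w (u t)),
      forall t x, 0 < t < T -> derivable (u ^~ x) t 1
    & {within `]0, T[ `*` [set: rV],
        continuous (fun z : R * rV => derive1 (u ^~ z.2) z.1)}].

End regularity.

Section mean_field_control.
Context {R : realType} {d : nat}.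
Local Notation rV := 'rV[R]_d.
Implicit Types (L : R -> rV -> rV -> R) (F : R -> rV -> R -> R)
  (G : rV -> R -> R) (f : R -> rV -> rV) (rho psi : R -> rV -> R).

(* The modulus of strong convexity may depend on (t, x). *)
Definition strongly_convex_in_v L : Prop :=
  forall t x, exists2 m : R, 0 < m &
    forall (v w : rV) (s : R), 0 <= s <= 1 ->
      L t x (s *: v + (1 - s) *: w) <=
        s * L t x v + (1 - s) * L t x w
        - m / 2 * s * (1 - s) * norm2 (v - w) ^+ 2.

Definition hamiltonian L (t : R) (x p : rV) : R :=
  sup [set dotp v p - L t x v | v in [set: rV]].

Definition DpH L (t : R) (x p : rV) : rV := grad (hamiltonian L t x) p.

Definition score rho (t : R) (x : rV) : rV := grad (fun y => ln (rho t y)) x.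

Definition running L F (gamma : R) f rho (t : R) (x : rV) : R :=
  (L t x (f t x + gamma *: score rho t x) + F t x (rho t x)) * rho t x.

Definition terminal G (T : R) rho (x : rV) : R := G x (rho T x) * rho T x.

Definition cost L F G (gamma T : R) f rho : \bar R :=
  (\int[lebesgue_measure]_(t in `[0%R, T])
      integral_Rd (running L F gamma f rho t)
   + integral_Rd (terminal G T rho))%E.

(* rho t is a probability density at each time; without decay assumptions the
   continuity equation alone does not imply it. The integrability clauses make
   the cost well defined and finite. *)
Definition admissible L F G (gamma T : R) (rho0 : rV -> R) f rho : Prop :=
  [/\ C12 T rho /\ C01 T f,
      (forall t x, 0 <= t <= T -> 0 < rho t x) /\
      (forall t, 0 <= t <= T -> prob_density (rho t)),
      (forall t x, 0 < t < T ->
        derive1 (rho ^~ x) t + divg (fun y => rho t y *: f t y) x = 0) /\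
      (forall x, rho 0 x = rho0 x),
      (lebesgue_measure \x lebesgue_tuple d)%E.-integrable
        (`[0, T] `*` [set: _])
        (fun z => (running L F gamma f rho z.1 (vec_of z.2))%:E)
    & integrable_Rd (terminal G T rho)].

Definition mfc_solution L F G (gamma T : R) (rho0 : rV -> R) f rho : Prop :=
  admissible L F G gamma T rho0 f rho /\
  forall f' rho', admissible L F G gamma T rho0 f' rho' ->
    (cost L F G gamma T f rho <= cost L F G gamma T f' rho')%E.

Definition Ftilde F (t : R) (x : rV) (r : R) : R :=
  derive1 (fun s => F t x s * s) r.

Definition Gtilde G (x : rV) (r : R) : R := derive1 (G x) r * r + G x r.

(* The momentum at which D_pH is evaluated, and the composed vector field
   D_pH(t, x, grad psi + gamma grad log rho), the divergence of which is the
   divergence in x of the composition. *)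
Definition momentum (gamma : R) rho psi (t : R) (x : rV) : rV :=
  grad (psi t) x + gamma *: score rho t x.

Definition DpH_field L (gamma : R) rho psi (t : R) (x : rV) : rV :=
  DpH L t x (momentum gamma rho psi t x).

Definition fokker_planck L (gamma : R) rho psi (t : R) (x : rV) : Prop :=
  derive1 (rho ^~ x) t
  + divg (fun y => rho t y *: DpH_field L gamma rho psi t y) x
  = gamma * laplacian (rho t) x.

Definition hamilton_jacobi L F (gamma : R) rho psi (t : R) (x : rV) : Prop :=
  derive1 (psi ^~ x) t
  + dotp (grad (psi t) x) (DpH_field L gamma rho psi t x)
  - gamma * divg (DpH_field L gamma rho psi t) x
  + gamma * laplacian (psi t) x
  - L t x (DpH_field L gamma rho psi t x)
  - Ftilde F t x (rho t x)
  + 2 * gamma ^+ 2 * laplacian (fun y => ln (rho t y)) x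
  + gamma ^+ 2 * norm2 (score rho t x) ^+ 2 = 0.

End mean_field_control.

(* Main.v *)
(* Write v = f + gamma grad (ln rho) and P = D_v L(t, x, v). The constraint
   allows the variations (rho - e th sg, rho f + e th' chi e_i) of density and
   flux, where sg = D_i chi has compact support and th(0) = 0. Optimality makes
   the derivative of the cost at e = 0 vanish, which after an integration by
   parts reads
     int_0^T (th' <chi, P_i> - th <sg, B>) dt = th(T) <sg, Gtilde>,
     B = L + Ftilde - P . v - gamma div P.
   As th' is arbitrary, <chi, P_i(t)> = <sg, S(t)> on [0, T] for
   S(t) = Gtilde + int_t^T B ds. Taking for sg a difference of two narrow bumps
   centred on a common line parallel to e_i gives D_i S = - P_i. Hence
   psi = - S - gamma ln rho has momentum P, and strong convexity of L in v makes
   the Hamiltonian differentiable at P with gradient v. The Fokker-Planck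
   equation is then the continuity equation, and the Hamilton-Jacobi equation is
   dS/dt = - B combined with the continuity equation divided by rho. *)
From HB Require Import structures.
Require Import Defs.
From mathcomp Require Import all_boot all_order all_algebra.
From mathcomp Require Import all_classical all_reals all_analysis.
From mathcomp Require Import measurable_realfun ring lra.

Set Implicit Arguments.
Unset Strict Implicit.
Unset Printing Implicit Defensive.

Import Order.TTheory GRing.Theory Num.Theory.
Import numFieldNormedType.Exports.
Local Open Scope ring_scope.
Local Open Scope classical_set_scope.

(** * Directional derivatives and integrals *)

(** The hypotheses give derivatives one direction at a time, so the chain rules are built from
    continuous directional derivatives, and differentiation under the integral sign rests on
    compactness instead of dominated convergence. This is why the variations have compact support:
    the cost is an integral over all of R^d, but its change is an integral over a cube, and the
    perturbed density stays positive for small e even though rho may come arbitrarily close to 0 far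
    away. The form sg = D_i chi is dictated by the constraint: the time derivative of - th sg
    cancels the divergence of th' chi e_i, the total mass is kept, and th(0) = 0 keeps rho0.

    The obstacle is that the formula for S shows no more than continuity in x, because div P is only
    continuous. Hence D_i S = - P_i cannot be read off by differentiating that formula. It comes
    from a du Bois-Reymond argument on lines parallel to e_i, and the two space derivatives of psi
    are then obtained from those of P and ln rho. *)

Section calculus.
Context {R : realType}.

Lemma dist_quotient (h l a e : R) : h != 0 ->
  (`|l - h^-1 *: a| <= e) = (`|a - h * l| <= e * `|h|).
Proof.
move=> h0; rewrite -(ler_pM2r (_ : 0 < `|h|)) ?normr_gt0// -normrM distrC.
by congr (`|_| <= _); rewrite /GRing.scale/=; field.
Qed.

(** Clearing the denominator gives a bound that also holds at [h = 0], so later proofs need neither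
    punctured neighbourhoods nor division by [h]. *)
Lemma is_deriveP (V : normedModType R) (f : V -> R) (x v : V) (l : R) :
  is_derive x v f l <->
  forall e, 0 < e ->
    \forall h \near (0 : R), `|f (h *: v + x) - f x - h * l| <= e * `|h|.
Proof.
split=> [fl e e0|H].
  have [+ fE] := fl; rewrite /derivable => /cvgP/=.
  rewrite -/('D_v f x) fE => /cvgrPdist_le/= /(_ _ e0).
  rewrite near_withinE => H; near=> h.
  have [->|h0] := eqVneq h 0.
    by rewrite scale0r add0r subrr mul0r subr0 normr0 mulr0.
  by rewrite -dist_quotient//; move: h0; near: h; exact: H.
have K : h^-1 *: (f (h *: v + x) - f x) @[h --> 0^'] --> l.
  apply/cvgrPdist_le => /= e e0; have {}H := H _ e0.
  rewrite near_withinE; near=> h => h0.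
  by rewrite dist_quotient//; near: h.
split; first by apply/cvg_ex; exists l.
exact/cvg_lim.
Unshelve. all: by end_near. Qed.

Lemma is_derive1P (f : R -> R) (x l : R) :
  is_derive x 1 f l <->
  forall e, 0 < e ->
    \forall h \near (0 : R), `|f (h + x) - f x - h * l| <= e * `|h|.
Proof.
split=> [/is_deriveP H e /H|H]; last apply/is_deriveP => e /H.
  by apply: filterS => h; rewrite [_ *: 1]mulr1.
by apply: filterS => h; rewrite [_ *: 1]mulr1.
Qed.

Lemma is_derive_line (V : normedModType R) (f : V -> R) (x v : V) (s : R) :
  derivable f (s *: v + x) v ->
  is_derive s 1 (fun h => f (h *: v + x)) ('D_v f (s *: v + x)).
Proof.
move=> /derivableP/is_deriveP H; apply/is_deriveP => e /H.
by apply: filterS => h; rewrite [_ *: 1]mulr1 scalerDl addrA.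
Qed.

Lemma is_derive_continuous (f : R -> R) (x l : R) :
  is_derive x 1 f l -> {for x, continuous f}.
Proof. by move=> [df _]; exact/differentiable_continuous/derivable1_diffP. Qed.

(** Increments of either sign occur later, hence [min] and [max]. The mean value theorem yields a
    slope [g s], which lies within [e] of [c]. *)
Lemma mvt_le (f g : R -> R) (c e a b : R) :
  (forall s, Num.min a b <= s <= Num.max a b -> is_derive s 1 f (g s)) ->
  (forall s, Num.min a b <= s <= Num.max a b -> `|g s - c| <= e) ->
  `|f b - f a - (b - a) * c| <= e * `|b - a|.
Proof.
wlog ab : a b / a <= b => [W dfg gc|].
  have [/W|/ltW ba] := leP a b; first exact.
  have -> : f b - f a - (b - a) * c = - (f a - f b - (a - b) * c) by ring.
  rewrite normrN (distrC b); rewrite minC maxC in dfg gc; exact: W.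
rewrite (min_idPl ab) (max_idPr ab) => dfg gc.
have [||s sab ->] := @MVT_segment R f g a b ab.
- by move=> s /[!in_itv]/= /andP[/ltW ? /ltW ?]; apply: dfg; apply/andP.
- apply: continuous_in_subspaceT => s /[!inE]/= /[!in_itv]/= sab.
  exact: is_derive_continuous (dfg _ sab).
rewrite (mulrC (g s)) -mulrBr normrM mulrC ler_wpM2r// gc//.
Qed.

Lemma norm_between (h s : R) :
  Num.min 0 h <= s <= Num.max 0 h -> `|s| <= `|h|.
Proof.
by have [h0|h0] := leP 0 h => /andP[s1 s2];
  [rewrite !ger0_norm | rewrite ler0_norm// ltr0_norm// lerN2].
Qed.

(** Uniformity in the base point [y] is the gain over [is_deriveP]: in a chain rule with several
    directions the base point has already moved when the last direction is treated. *)
Lemma strict_dir_derive (V : normedModType R) (u : V -> R) (v y0 : V) :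
  (forall y, derivable u y v) -> {for y0, continuous ('D_v u)} ->
  forall e, 0 < e -> exists2 d : R, 0 < d &
    forall y h, `|y - y0| < d -> `|h| < d ->
      `|u (h *: v + y) - u y - h * 'D_v u y0| <= e * `|h|.
Proof.
move=> du /cvgrPdist_le /= cu e /cu /nbhs_normP[/= r r0 ru].
have c0 : 0 < `|v| + 1 by rewrite ltr_wpDl.
(* One half of the radius is for [y - y0], the other for [h *: v]; the [+ 1] covers [v = 0]. *)
exists (Num.min (r / 2) (r / 2 / (`|v| + 1))).
  by rewrite lt_min !divr_gt0.
move=> y h; rewrite !lt_min => /andP[yr _] /andP[_ hr].
have := @mvt_le (fun s => u (s *: v + y)) (fun s => 'D_v u (s *: v + y))
  ('D_v u y0) e 0 h.
rewrite scale0r add0r subr0; apply => s sh.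
  exact: is_derive_line.
rewrite distrC ru//= distrC -addrA.
rewrite (le_lt_trans (ler_normD _ _))// [ltRHS]splitr ler_ltD// normrZ.
rewrite ltW// (le_lt_trans _ (_ : `|h| * (`|v| + 1) < _))//.
  by rewrite ler_pM// ?lerDl// ?norm_between.
by rewrite -ltr_pdivlMr.
Qed.

(** Continuity of the directional derivatives at [y0] stands in for differentiability of [u]. By
    induction on the number of directions: the last one is expanded by [strict_dir_derive] at the
    point [y h] that the others have reached. *)
Lemma is_derive_dir_comp (V : normedModType R) (u : V -> R) (y0 : V) n
    (e : 'I_n -> V) (c : 'I_n -> R -> R) (c' : 'I_n -> R) :
  (forall i y, derivable u y (e i)) ->
  (forall i, {for y0, continuous ('D_(e i) u)}) ->
  (forall i, c i 0 = 0) -> (forall i, is_derive (0 : R) 1 (c i) (c' i)) ->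
  is_derive (0 : R) 1 (fun s => u (y0 + \sum_(i < n) c i s *: e i))
    (\sum_(i < n) c' i * 'D_(e i) u y0).
Proof.
elim: n e c c' => [|n IH] e c c' du cu c0 dc.
  rewrite big_ord0; under eq_fun do rewrite big_ord0.
  exact: is_derive_cst.
pose w (i : 'I_n) := widen_ord (leqnSn n) i.
have IHn := IH (e \o w) (fun i => c (w i)) (fun i => c' (w i))
  (fun i => du (w i)) (fun i => cu (w i)) (fun i => c0 (w i)) (fun i => dc (w i)).
rewrite big_ord_recr /=; under eq_fun do rewrite big_ord_recr /=.
pose y s := y0 + \sum_(i < n) c (w i) s *: (e \o w) i.
rewrite -/(y _) in IHn.
set l := \sum_(i < n) _ in IHn *.
set D := 'D_(e ord_max) u y0.
have y0E : y 0 = y0.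
  by rewrite /y big1 ?addr0// => i _; rewrite c0 scale0r.
have cy : {for 0, continuous y}.
  apply: cvgD; first exact: cvg_cst.
  apply: cvg_big => [|i _]; first exact: add_continuous.
  apply: cvgZr_tmp; exact: is_derive_continuous (dc _).
under eq_fun do rewrite addrA -/(y _).
apply/is_derive1P => eps eps0.
have cc : {for 0, continuous (c ord_max)} by exact: is_derive_continuous (dc _).
have C0 : 0 < `|c' ord_max| + 1 + `|D| + 1 by rewrite !ltr_wpDl.
(* As k <= 1, the last coefficient moves by at most (|c'| + 1)|h|. The two errors of the last
   direction then add up to at most k(|c'| + 1 + |D|)|h|, and the second bound on [k] makes this at
   most (eps / 3)|h|. *)
pose k := Num.min 1 (eps / (3 * (`|c' ord_max| + 1 + `|D| + 1))).
have k0 : 0 < k by rewrite lt_min ltr01 divr_gt0// mulr_gt0.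
have [d d0 Hd] := strict_dir_derive (du ord_max) (cu ord_max) k0.
have {}IHn := (is_derive1P _ _ _).1 IHn _ (divr_gt0 eps0 (ltr0Sn _ 2)).
have {}IHn : \forall h \near (0 : R), `|u (y h) - u (y 0) - h * l| <= eps / 3 * `|h|.
  by move: IHn; apply: filterS => h; rewrite addr0.
have Hc : \forall h \near (0 : R), `|c ord_max h - h * c' ord_max| <= k * `|h|.
  move: ((is_derive1P _ _ _).1 (dc ord_max) _ k0); apply: filterS => h.
  by rewrite addr0 c0 subr0.
near=> h.
have E1 : `|y h - y0| < d.
  rewrite distrC -y0E; near: h.
  by move/cvgrPdist_lt: cy => /(_ _ d0).
have E2 : `|c ord_max h| < d.
  rewrite -[X in `|X|]opprK normrN -[- _]add0r -(c0 ord_max); near: h.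
  by move/cvgrPdist_lt: cc => /(_ _ d0).
have {}Hd := Hd _ _ E1 E2.
have Hc2 : `|c ord_max h - h * c' ord_max| <= k * `|h|.
  by near: h.
have IHn2 : `|u (y h) - u (y 0) - h * l| <= eps / 3 * `|h|.
  by near: h.
rewrite addr0 c0 scale0r addr0 (addrC (y h)).
rewrite -/D in Hd.
have -> : u (c ord_max h *: e ord_max + y h) - u (y 0) - h * (l + c' ord_max * D) =
  (u (y h) - u (y 0) - h * l) + ((u (c ord_max h *: e ord_max + y h) - u (y h) - c ord_max h * D) +
   (c ord_max h - h * c' ord_max) * D) by ring.
rewrite (le_trans (ler_normD _ _))//.
rewrite (_ : eps * `|h| = eps / 3 * `|h| + (2 * eps / 3) * `|h|); last by field.
rewrite lerD// (le_trans (ler_normD _ _))//.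
have k1 : k <= 1 by rewrite ge_min lexx.
have kC : k * (`|c' ord_max| + 1 + `|D| + 1) <= eps / 3.
  rewrite -ler_pdivlMr// ge_min; apply/orP; right.
  by rewrite invfM mulrA.
have cb : `|c ord_max h| <= (`|c' ord_max| + 1) * `|h|.
  rewrite -(subrK (h * c' ord_max) (c ord_max h)) (le_trans (ler_normD _ _))//.
  rewrite normrM mulrDl addrC (mulrC `|h|) lerD2l mul1r (le_trans Hc2)//.
  by rewrite ler_piMl.
rewrite normrM (le_trans (lerD Hd (ler_wpM2r (normr_ge0 D) Hc2)))//.
rewrite (le_trans (lerD (ler_wpM2l (ltW k0) cb) (lexx _)))//.
have -> : k * ((`|c' ord_max| + 1) * `|h|) + k * `|h| * `|D| =
  (k * (`|c' ord_max| + 1 + `|D|)) * `|h| by ring.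
rewrite ler_wpM2r// (le_trans (_ : _ <= eps / 3))//.
  by rewrite (le_trans _ kC)// ler_wpM2l ?ltW// ltrDl.
lra.
Unshelve. all: by end_near. Qed.

(** * Primitives and the fundamental theorem of calculus *)

Local Notation leb := (@lebesgue_measure R).

Lemma integrable_continuous_itv (h : R -> R) (a b : R) :
  continuous h -> leb.-integrable `[a, b] (EFin \o h).
Proof.
move=> ch; apply: continuous_compact_integrable; first exact: segment_compact.
exact: continuous_subspaceT.
Qed.

Lemma is_derive_int (h : R -> R) (a t : R) : continuous h -> a < t ->
  is_derive t 1 (fun x => \int[leb]_(s in `[a, x]) h s)%R (h t).
Proof.
move=> ch at_; have [||||dF Fh] := @continuous_FTC1_closed R h a t (t + 1).
- by rewrite ltrDl.
- exact: integrable_continuous_itv.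
- by [].
- exact: ch.
by split; [exact: dF|rewrite -Fh derive1E].
Qed.

Lemma eq_derive_diff (f g d : R -> R) (a b : R) :
  (forall s, Num.min a b <= s <= Num.max a b ->
     is_derive s 1 f (d s) /\ is_derive s 1 g (d s)) ->
  f b - f a = g b - g a.
Proof.
move=> fg; have := @mvt_le (fun s => f s - g s) (fun=> 0) 0 0 a b.
rewrite mulr0 mul0r subrr => H.
apply/eqP; rewrite -subr_eq0 -normr_le0.
have -> : f b - f a - (g b - g a) = f b - g b - (f a - g a) by ring.
rewrite -[_ - (f a - g a)]subr0; apply: H => s sab; last by rewrite normr0.
have [? ?] := fg _ sab; rewrite -(subrr (d s)).
exact: is_deriveB.
Qed.

(* The integral from 0 to t. Integrals over intervals carry no sign, so the base
   point is moved below both 0 and t. *)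
Definition primitive (h : R -> R) (t : R) : R :=
  (\int[leb]_(s in `[- (`|t| + 1), t]) h s
   - \int[leb]_(s in `[- (`|t| + 1), 0%R]) h s)%R.

(** The base point in [primitive] moves with [t]. Replacing it by a fixed one, valid for all nearby
    times, is what makes [primitive] differentiable. *)
Lemma primitiveE (h : R -> R) (a t : R) : continuous h -> a < 0 -> a < t ->
  primitive h t = (\int[leb]_(s in `[a, t]) h s - \int[leb]_(s in `[a, 0%R]) h s)%R.
Proof.
move=> ch a0 at_; apply: (@eq_derive_diff
  (fun x => \int[leb]_(s in `[- (`|t| + 1), x]) h s)%R
  (fun x => \int[leb]_(s in `[a, x]) h s)%R h 0 t).
move=> s /andP[s0t _].
have lt_s b : b < 0 -> b < t -> b < s.
  by move=> b0 bt; rewrite (lt_le_trans _ s0t)// lt_min b0.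
have tn : - `|t| <= t by rewrite lerNl (le_trans (ler_norm (- t)))// normrN.
split; apply: is_derive_int => //; apply: lt_s => //.
by rewrite (lt_le_trans _ tn)// ltrN2 ltrDl.
Qed.

Lemma primitive0 (h : R -> R) : primitive h 0 = 0.
Proof. by rewrite /primitive subrr. Qed.

Lemma is_derive_primitive (h : R -> R) (t : R) : continuous h ->
  is_derive t 1 (primitive h) (h t).
Proof.
move=> ch; pose a : R := - (`|t| + 1).
have a0 : a < 0 by rewrite oppr_lt0 ltr_wpDl.
have at_ : a < t.
  by rewrite ltrNl (le_lt_trans (ler_norm (- t)))// normrN ltrDl.
apply: (@near_eq_is_derive _ _ _
  (fun x => \int[leb]_(s in `[a, x]) h s - \int[leb]_(s in `[a, 0%R]) h s)%R).
- near=> x; apply/esym/primitiveE => //.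
  by near: x; apply: lt_nbhsr.
- rewrite -[h t]subr0; apply: is_deriveB.
  exact: is_derive_int.
Unshelve. all: by end_near. Qed.

Lemma Rintegral_derive (f g : R -> R) (a b : R) : a <= b -> continuous g ->
  (forall t, a <= t <= b -> is_derive t 1 f (g t)) ->
  (\int[leb]_(t in `[a, b]) g t = f b - f a)%R.
Proof.
move=> ab cg fg; have := @primitiveE g (Num.min a 0 - 1) b cg.
have := @primitiveE g (Num.min a 0 - 1) a cg.
have m0 : Num.min a 0 - 1 < 0 by rewrite subr_lt0 gt_min ltr01 orbT.
have ma : Num.min a 0 - 1 < a by rewrite ltrBlDr gt_min ltrDl ltr01.
move=> /(_ m0 ma) pa /(_ m0 (lt_le_trans ma ab)) pb.
have -> : f b - f a = primitive g b - primitive g a.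
  apply: (@eq_derive_diff _ _ g) => s; rewrite (min_idPl ab) (max_idPr ab) => sab.
  by split; [exact: fg|exact: is_derive_primitive].
rewrite pa pb opprB addrA subrK.
rewrite Rintegral_itvB//; last 2 first.
- exact: integrable_continuous_itv.
- by rewrite bnd_simp ltW.
rewrite Rintegral_itv_obnd_cbnd//.
apply: integrableS (integrable_continuous_itv a b cg) => //.
exact: subset_itv_oc_cc.
Qed.

Lemma norm_between_sub (a b t : R) :
  Num.min a b <= t <= Num.max a b -> `|t - a| <= `|b - a|.
Proof.
move=> tab; apply: norm_between.
by rewrite -(subrr a) -addr_minl -addr_maxl !lerD2r.
Qed.

(* Integrals over a compact set of functions on V against a measure on another
   type X: Lebesgue measure lives on tuples, calculus on row vectors. *)
Section compact_integral.
Context d (X : measurableType d) (mu : {measure set X -> \bar R}).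
Context (V : topologicalType) (iota : X -> V) (K : set V).

(** The last clause is the only link between the topology of [V] and the sigma-algebra of [X]. *)
Definition compact_domain : Prop :=
  [/\ compact K, measurable (iota @^-1` K), (mu (iota @^-1` K) < +oo)%E &
      forall h : V -> R, continuous h -> measurable_fun setT (h \o iota)].

Hypothesis dom : compact_domain.

Definition Kint (h : V -> R) : R :=
  (\int[mu]_(x in iota @^-1` K) h (iota x))%R.

Lemma continuous_compact_bounded (h : V -> R) : continuous h ->
  exists c : R, forall x, K x -> `|h x| <= c.
Proof.
have [cK _ _ _] := dom; move=> ch.
have : compact (h @` K).
  by apply: continuous_compact => //; exact: continuous_subspaceT.
move=> /compact_bounded[M [Mr HM]]; exists (M + 1) => x Kx.
by apply: HM; [rewrite ltrDl|exists x].
Qed.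

Lemma Kint_integrable (h : V -> R) : continuous h ->
  mu.-integrable (iota @^-1` K) (EFin \o (h \o iota)).
Proof.
have [_ mK fK mi] := dom; move=> ch.
apply: measurable_bounded_integrable => //.
  by apply: measurable_funS (mi _ ch).
have [c Hc] := continuous_compact_bounded ch.
exists c; split; first exact: num_real.
by move=> M /ltW cM x Kx; rewrite /= (le_trans _ cM)//= Hc.
Qed.

Lemma eq_Kint (f g : V -> R) : (forall x, K x -> f x = g x) -> Kint f = Kint g.
Proof. by move=> fg; apply: eq_Rintegral => x /[!inE] Kx; exact: fg. Qed.

Lemma KintD (f g : V -> R) : continuous f -> continuous g ->
  Kint (fun x => f x + g x) = Kint f + Kint g.
Proof.
have [_ mK _ _] := dom; move=> cf cg.
exact: RintegralD (Kint_integrable cf) (Kint_integrable cg).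
Qed.

Lemma KintB (f g : V -> R) : continuous f -> continuous g ->
  Kint (fun x => f x - g x) = Kint f - Kint g.
Proof.
have [_ mK _ _] := dom; move=> cf cg.
exact: RintegralB (Kint_integrable cf) (Kint_integrable cg).
Qed.

Lemma KintZ c (f : V -> R) : continuous f -> Kint (fun x => c * f x) = c * Kint f.
Proof.
have [_ mK _ _] := dom; move=> cf; exact: RintegralZl (Kint_integrable cf).
Qed.

Lemma Kint_bound c (h : V -> R) : continuous h -> (forall x, K x -> `|h x| <= c) ->
  `|Kint h| <= c * fine (mu (iota @^-1` K)).
Proof.
have [_ mK fK mi] := dom; move=> ch hc.
rewrite (le_trans (le_normr_Rintegral mK (Kint_integrable ch)))//.
rewrite -Rintegral_cst//; apply: le_Rintegral => //.
- have := Kint_integrable (h := fun x => `|h x|); apply.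
  by move=> x; apply: continuous_comp; [exact: ch|exact: norm_continuous].
- have := Kint_integrable (h := fun x => c); apply.
  exact: cst_continuous.
- by move=> x Kx; exact: hc.
Qed.

(** A tube lemma: compactness turns continuity at the points of {p0} x K into a bound uniform in
    [x]. This uniformity does the work of dominated convergence below. *)
Lemma compact_tube (P : topologicalType) (p0 : P) (h : P -> V -> R) :
  (forall x, K x -> {for (p0, x), continuous (fun z => h z.1 z.2)}) ->
  forall e : R, 0 < e -> \forall p \near p0, forall x, K x -> `|h p x - h p0 x| <= e.
Proof.
have [cK _ _ _] := dom; move=> ch e e0.
have /compact_near_coveringP := cK.
move=> /(_ P (nbhs p0) (fun p x => `|h p x - h p0 x| <= e)); apply => x Kx.
have /cvgrPdist_le/= /(_ (e / 2)) := ch _ Kx; rewrite divr_gt0// => /(_ isT) H.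
have [[A B] [/= pA xB] AB] := H.
exists (B, A) => //= -[y p] [/= By Ap].
have H1 := AB (p, y) (conj Ap By); have H2 := AB (p0, y) (conj (nbhs_singleton pA) By).
rewrite /= in H1 H2; rewrite (splitr e) (le_trans _ (lerD H1 H2))//.
by rewrite (distrC _ (h p y)) ler_distD.
Qed.

Lemma Kint_continuous (P : topologicalType) (p0 : P) (h : P -> V -> R) :
  (\forall p \near p0, continuous (h p)) ->
  (forall x, K x -> {for (p0, x), continuous (fun z => h z.1 z.2)}) ->
  {for p0, continuous (fun p => Kint (h p))}.
Proof.
move=> nch ch; apply/cvgrPdist_le => /= e e0.
pose m := fine (mu (iota @^-1` K)).
have m0 : 0 <= m by rewrite fine_ge0.
have e1 : 0 < e / (m + 1) by rewrite divr_gt0// ltr_wpDl.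
have ch0 := nbhs_singleton nch.
near=> p.
have cp : continuous (h p) by near: p.
rewrite distrC -KintB// (le_trans (_ : _ <= (e / (m + 1)) * m))//.
  apply: Kint_bound; first by move=> x; apply: cvgB; [exact: cp|exact: ch0].
  by near: p; exact: compact_tube.
by rewrite mulrAC ler_pdivrMr ?ltr_wpDl// ler_pM2l// lerDl.
Unshelve. all: by end_near. Qed.

(** By the mean value inequality the increment of [q] differs from [s * h p0 x] by an error that
    [compact_tube] makes uniform over [K]. Integrating it costs a factor [m], the measure of [K],
    which the tolerance [e / (m + 1)] absorbs. *)
Lemma Kint_derive (p0 : R) (q h : R -> V -> R) :
  (\forall p \near p0, continuous (q p) /\
     forall x, K x -> is_derive p 1 (q ^~ x) (h p x)) ->
  continuous (h p0) ->
  (forall x, K x -> {for (p0, x), continuous (fun z => h z.1 z.2)}) ->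
  is_derive p0 1 (fun p => Kint (q p)) (Kint (h p0)).
Proof.
move=> nq ch0 ch; apply/is_derive1P => e e0.
pose m := fine (mu (iota @^-1` K)).
have m0 : 0 <= m by rewrite fine_ge0.
have e1 : 0 < e / (m + 1) by rewrite divr_gt0// ltr_wpDl.
have [r /= r0 Hr] := (nbhs_normP _ _).1 (filterI nq (compact_tube ch e1)).
have cq0 := (nbhs_singleton nq).1.
apply/nbhs_normP; exists r => //= s /=; rewrite sub0r normrN => sr.
have rs : ball_ Num.Def.normr p0 r (s + p0).
  by rewrite /= opprD addrC subrK normrN.
have [[cqs _] _] := Hr _ rs.
rewrite -KintB// -KintZ// -KintB; last 2 first.
- by move=> x; apply: cvgB; [exact: cqs|exact: cq0].
- by move=> x; apply: cvgMl_tmp; exact: ch0.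
rewrite (le_trans (_ : _ <= (e / (m + 1) * `|s|) * m))//.
  apply: Kint_bound.
    move=> x; apply: cvgB; first by apply: cvgB; [exact: cqs|exact: cq0].
    by apply: cvgMl_tmp; exact: ch0.
  move=> x Kx; have := @mvt_le (q ^~ x) (h ^~ x) (h p0 x) (e / (m + 1)) p0 (s + p0).
  rewrite addrK; apply => t tb.
    have [|[_ /(_ _ Kx)]//] := Hr t.
    by rewrite /= distrC (le_lt_trans (norm_between_sub tb))// addrK.
  have [|_ /(_ _ Kx)//] := Hr t.
  by rewrite /= distrC (le_lt_trans (norm_between_sub tb))// addrK.
by rewrite mulrAC [_ * m]mulrAC ler_wpM2r// ler_pdivrMr ?ltr_wpDl// ler_pM2l// lerDl.
Qed.

End compact_integral.

(** * Row vectors, cubes and Lebesgue measure *)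

Lemma rV_norm_le n (x : 'rV[R]_n) (r : R) : 0 <= r ->
  (`|x| <= r) <-> (forall i, `|x ord0 i| <= r).
Proof.
move=> r0; split=> [xr i|xr].
  apply: le_trans xr; rewrite [leRHS]/Num.Def.normr/= mx_normrE.
  exact: (le_bigmax _ _ (ord0, i)).
rewrite [leLHS]/Num.Def.normr/= mx_normrE; apply: bigmax_le => //= -[i j] _.
by rewrite (ord1 i).
Qed.

Lemma rV_norm_lt n (x : 'rV[R]_n) (r : R) : 0 < r ->
  (`|x| < r) <-> (forall i, `|x ord0 i| < r).
Proof.
move=> r0; split=> [xr i|xr].
  by apply: le_lt_trans xr; exact: ((rV_norm_le x (normr_ge0 x)).1 (lexx _)).
rewrite [ltLHS]/Num.Def.normr/= mx_normrE; apply: bigmax_lt => //= -[i j] _.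
by rewrite (ord1 i).
Qed.

Lemma rV_continuousP (T : topologicalType) n (f : T -> 'rV[R]_n) (x : T) :
  {for x, continuous f} <-> forall i, {for x, continuous (fun y => f y ord0 i)}.
Proof.
split=> [cf i|cf].
  by apply: (@continuous_comp _ _ _ f (fun v : 'rV[R]_n => v ord0 i)) => //;
    exact: coord_continuous.
apply/cvgrPdist_lt => e e0; near=> y; apply/rV_norm_lt => // i; rewrite !mxE.
by move: i; near: y; apply: filter_forall => i; exact: (cvgrPdist_lt _ _).1 (cf i) _ e0.
Unshelve. all: by end_near. Qed.

Definition cube n (a : 'rV[R]_n) (r : R) : set 'rV[R]_n :=
  [set x | forall i, `|x ord0 i - a ord0 i| <= r].

Lemma measurable_vec_of_coord n (i : 'I_n) (A : set R) : measurable A ->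
  measurable [set x : n.-tuple (measurableTypeR R) | A (vec_of x ord0 i)].
Proof.
move=> mA; rewrite [X in measurable X](_ : _ = (fun x => tnth x i) @^-1` A); last first.
  by apply/seteqP; split=> x /=; rewrite mxE.
by rewrite -[X in measurable X]setTI; exact: (@measurable_tnth _ (measurableTypeR R) n i).
Qed.

Lemma measurable_vec_of_forall n (A : 'I_n -> set R) : (forall i, measurable (A i)) ->
  measurable [set x : n.-tuple (measurableTypeR R) | forall i, A i (vec_of x ord0 i)].
Proof.
move=> mA; rewrite [X in measurable X](_ : _ = \bigcap_(i in [set: 'I_n])
  [set x : n.-tuple (measurableTypeR R) | A i (vec_of x ord0 i)]); last first.
  by apply/seteqP; split=> [x H i _|x H i]; [exact: H|exact: (H i I)].
by apply: fin_bigcap_measurable => // i _; exact: measurable_vec_of_coord.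
Qed.

Lemma measurable_cube n (a : 'rV[R]_n) r : measurable (vec_of @^-1` cube a r).
Proof.
apply: (measurable_vec_of_forall (A := fun i => [set y | `|y - a ord0 i| <= r])) => i.
rewrite [X in measurable X](_ : _ = `[a ord0 i - r, a ord0 i + r]%classic) //.
by apply/seteqP; split=> y /=; rewrite in_itv/= ler_distl.
Qed.

(** The sigma-algebra on tuples is generated by the coordinates, so an open set has to be exhibited
    as a countable union of boxes [b q] with rational centre and half-width. *)
Lemma measurable_vec_of_open n (U : set 'rV[R]_n) : open U ->
  measurable (vec_of @^-1` U).
Proof.
move=> oU.
pose b (q : n.-tuple rat * rat) : set 'rV[R]_n :=
  [set x | forall i, `](ratr (tnth q.1 i) - ratr q.2 : R), ratr (tnth q.1 i) + ratr q.2[%classic (x ord0 i)].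
rewrite [X in measurable X](_ : _ =
    \bigcup_q (if `[< b q `<=` U >] then vec_of @^-1` b q else set0)); last first.
  apply/seteqP; split=> x /=; last first.
    by move=> [q _]; case: ifPn => // /asboolP; exact.
  move=> /= Ux; have /nbhs_normP[r /= r0 rU] : nbhs (vec_of x) U by exact: open_nbhs_nbhs.
  (* The box has half-width [s] below [r / 2] and its centre is within [s] of the point in each
     coordinate, so it contains the point and stays inside the ball of radius [r]. *)
  have /rat_in_itvoo[s /[!in_itv]/= /andP[s0 sr]] : 0 < r / 2 by rewrite divr_gt0.
  have H i : exists q : rat, `|ratr q - vec_of x ord0 i| < ratr s.
    have /rat_in_itvoo[q] : vec_of x ord0 i - ratr s < vec_of x ord0 i + ratr s.
      by rewrite ltrD2l gtrN.
    by rewrite in_itv/= -ltr_distl => ?; exists q.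
  pose q := [tuple sval (cid (H i)) | i < n].
  exists (q, s) => //; rewrite ifT.
    by move=> i /=; rewrite tnth_mktuple in_itv/= -ltr_distl distrC; exact: svalP (cid (H i)).
  apply/asboolP => y /= yq; apply: rU => /=; apply/rV_norm_lt => // i.
  have := yq i; rewrite /= tnth_mktuple in_itv/= -ltr_distl => h1.
  have h2 := svalP (cid (H i)).
  have -> : (vec_of x - y) ord0 i = - (y ord0 i - vec_of x ord0 i).
    by rewrite [LHS]mxE [(- y) _ _]mxE opprB.
  rewrite normrN (le_lt_trans (ler_distD (ratr (sval (cid (H i)))) _ _))//.
  by rewrite (splitr r) ltrD// (lt_trans _ sr).
apply: countable_bigcupT_measurable; first exact: countableP.
move=> q; case: ifPn => // _.
by apply: (measurable_vec_of_forall (A := fun i =>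
  `](ratr (tnth q.1 i) - ratr q.2 : R), ratr (tnth q.1 i) + ratr q.2[%classic)) => i;
  exact: measurable_itv.
Qed.

Lemma measurable_fun_vec_of n (h : 'rV[R]_n -> R) : continuous h ->
  measurable_fun setT (h \o vec_of).
Proof.
move=> /continuousP ch; apply: (measurability _ (RGenOpens.measurableE R)) => //.
move=> _ [_ [a [b ->] <-]]; rewrite setTI comp_preimage.
by apply: measurable_vec_of_open; apply: ch; exact: interval_open.
Qed.

Lemma vec_of_cons0 n (z : measurableTypeR R * n.-tuple (measurableTypeR R)) :
  vec_of (tuple_cons z) ord0 ord0 = z.1.
Proof. by rewrite mxE. Qed.

Lemma vec_of_cons_lift n (z : measurableTypeR R * n.-tuple (measurableTypeR R)) i :
  vec_of (tuple_cons z) ord0 (lift ord0 i) = vec_of z.2 ord0 i.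
Proof. by rewrite !mxE tnthS. Qed.

Lemma lebesgue_cube n (a : 'rV[R]_n) (r : R) : 0 <= r ->
  lebesgue_tuple n (vec_of @^-1` cube a r) = ((r *+ 2) ^+ n)%:E.
Proof.
move=> r0; elim: n a => [|n IH] a.
  (* In dimension 0 the measure is a Dirac mass and the cube is the whole space, which gives 1, the
     empty power. *)
  rewrite /lebesgue_tuple/= diracE mem_set ?expr0//.
  by move=> -[].
rewrite /= /lebesgue_cons /pushforward.
rewrite (_ : _ @^-1` _ = `[a ord0 ord0 - r, a ord0 ord0 + r] `*`
   (vec_of @^-1` cube (\row_i a ord0 (lift ord0 i)) r)); last first.
  apply/seteqP; split=> z /= H; [split|case: H => H1 H2 i].
  - by have := H ord0; rewrite vec_of_cons0 ler_distl in_itv.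
  - by move=> i; have := H (lift ord0 i); rewrite vec_of_cons_lift [(\row_ _ _) _ _]mxE.
  - case: (unliftP ord0 i) => [j ->|->].
      by rewrite vec_of_cons_lift; have := H2 j; rewrite [(\row_ _ _) _ _]mxE.
    by rewrite vec_of_cons0 ler_distl; move: H1; rewrite in_itv.
rewrite product_measure1E//; last exact: measurable_cube.
have E : (@lebesgue_measure R) `[(a ord0 ord0 - r)%R, (a ord0 ord0 + r)%R]%classic = (r *+ 2)%:E.
  have e2 : r + r = r *+ 2 by [].
  rewrite lebesgue_measure_itv/= lte_fin; case: ltP => [_|].
    by rewrite -EFinB; congr EFin; ring.
  by move=> h; congr EFin; lra.
by rewrite IH; etransitivity; [apply: (congr2 mule E erefl)|rewrite -EFinM -exprS].
Qed.

(** The bridge between the extended real integrals over a full domain, in which the cost is stated,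
    and the real integrals over a compact set, on which all estimates are made. *)
Lemma Kint_supp d (X : measurableType d) (mu : {measure set X -> \bar R})
    (V : topologicalType) (iota : X -> V) (K : set V) (D : set X) (h : V -> R) :
  compact_domain mu iota K -> measurable D -> iota @^-1` K `<=` D ->
  continuous h -> (forall x, D x -> ~ K (iota x) -> h (iota x) = 0) ->
  mu.-integrable D (EFin \o (h \o iota)) /\
  (\int[mu]_(x in D) (h (iota x))%:E = (Kint mu iota K h)%:E)%E.
Proof.
move=> dom mD KD ch h0; have [_ mK _ _] := dom.
have hE : {in D, EFin \o (h \o iota) =1 (EFin \o (h \o iota)) \_ (iota @^-1` K)}.
  move=> x /[!inE] Dx; rewrite patchE; case: ifPn => // /negP xK.
  by rewrite /= h0// => Kx; apply: xK; rewrite inE.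
have iK := Kint_integrable dom ch.
have DK : D `&` (iota @^-1` K) = iota @^-1` K by apply/setIidr.
split.
  apply/(eq_integrable mD _ _ (fun x xD => esym (hE x xD))).
  by apply/integrable_restrict => //; rewrite DK.
rewrite (eq_integral _ _ hE) -integral_mkcondr DK.
by rewrite /Kint fineK//; apply: integrable_fin_num.
Qed.

Lemma compact_cube n (a : 'rV[R]_n) (r : R) : compact (cube a r).
Proof.
rewrite (_ : cube a r = [set v : 'rV[R]_n | forall i, `[a ord0 i - r, a ord0 i + r]%classic (v ord0 i)]).
  by apply: (rV_compact (A := fun i => `[a ord0 i - r, a ord0 i + r]%classic)) => i; exact: segment_compact.
by apply/seteqP; split=> x /= H i; have := H i; rewrite in_itv/= ler_distl.
Qed.

Lemma domain_cube n (a : 'rV[R]_n) (r : R) : 0 <= r ->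
  compact_domain (lebesgue_tuple n) vec_of (cube a r).
Proof.
move=> r0; split.
- exact: compact_cube.
- exact: measurable_cube.
- by rewrite [ltLHS](lebesgue_cube a r0) ltry.
- by move=> h; exact: measurable_fun_vec_of.
Qed.

Lemma domain_itv (a b : R) : compact_domain leb id `[a, b].
Proof.
split.
- exact: segment_compact.
- by rewrite preimage_id.
- rewrite preimage_id [ltLHS](lebesgue_measure_itv `[a, b]%R)/=.
  by case: ifP => _; rewrite ?ltry// -EFinB ltry.
- by move=> h; exact: continuous_measurable_fun.
Qed.

Lemma continuous_pair (T U W : topologicalType) (f : T -> U) (g : T -> W) (x : T) :
  {for x, continuous f} -> {for x, continuous g} ->
  {for x, continuous (fun y => (f y, g y))}.
Proof. by move=> cf cg; exact: cvg_pair. Qed.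

Definition row_cons n (t : R) (y : 'rV[R]_n) : 'rV[R]_n.+1 :=
  \row_i (if unlift ord0 i is Some j then y ord0 j else t).

Lemma row_cons0 n t (y : 'rV[R]_n) : row_cons t y ord0 ord0 = t.
Proof. by rewrite mxE unlift_none. Qed.

Lemma row_cons_lift n t (y : 'rV[R]_n) i : row_cons t y ord0 (lift ord0 i) = y ord0 i.
Proof. by rewrite mxE liftK. Qed.

Lemma vec_of_cons n (z : measurableTypeR R * n.-tuple (measurableTypeR R)) :
  vec_of (tuple_cons z) = row_cons z.1 (vec_of z.2).
Proof.
apply/rowP => i; case: (unliftP ord0 i) => [j ->|->].
  by rewrite vec_of_cons_lift row_cons_lift.
by rewrite vec_of_cons0 row_cons0.
Qed.

Lemma row_cons_continuous n :
  continuous (fun z : R * 'rV[R]_n => row_cons z.1 z.2).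
Proof.
move=> z; apply/rV_continuousP => i; case: (unliftP ord0 i) => [j ->|->].
  have -> : (fun y : R * 'rV[R]_n => row_cons y.1 y.2 ord0 (lift ord0 j)) =
      (fun v : 'rV[R]_n => v ord0 j) \o snd.
    by apply/funext => y; exact: row_cons_lift.
  by apply: continuous_comp; [exact: cvg_snd|exact: coord_continuous].
have -> : (fun y : R * 'rV[R]_n => row_cons y.1 y.2 ord0 ord0) = fst.
  by apply/funext => y; exact: row_cons0.
exact: cvg_fst.
Qed.

Definition row_split n (v : 'rV[R]_n.+1) : R * 'rV[R]_n :=
  (v ord0 ord0, \row_i v ord0 (lift ord0 i)).

Lemma row_split_continuous n : continuous (@row_split n).
Proof.
move=> v; apply: continuous_pair; first exact: coord_continuous.
apply/rV_continuousP => i.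
have -> : (fun y : 'rV[R]_n.+1 => (\row_i y ord0 (lift ord0 i)) ord0 i) =
    (fun y => y ord0 (lift ord0 i)) by apply/funext => y; rewrite mxE.
exact: coord_continuous.
Qed.

Lemma row_splitK n t (y : 'rV[R]_n) : row_split (row_cons t y) = (t, y).
Proof.
rewrite /row_split row_cons0; congr pair.
by apply/rowP => i; rewrite mxE row_cons_lift.
Qed.

(** Measurability of a continuous function of time and space is inherited from dimension n + 1:
    [tuple_cons] followed by [vec_of] glues the coordinates, and the continuous [row_split]
    separates them again. *)
Lemma domain_spacetime n (a b : R) (c : 'rV[R]_n) (r : R) : 0 <= r ->
  compact_domain (leb \x lebesgue_tuple n)%E (fun z => (z.1, vec_of z.2))
    (`[a, b] `*` cube c r).
Proof.
move=> r0.
have E : (fun z : measurableTypeR R * n.-tuple (measurableTypeR R) => (z.1, vec_of z.2))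
   @^-1` (`[a, b] `*` cube c r) = `[a, b] `*` (vec_of @^-1` cube c r) by [].
have [_ m1 f1 _] := domain_itv a b; have [_ m2 f2 _] := domain_cube c r0.
split.
- by apply: compact_setX; [exact: segment_compact|exact: compact_cube].
- by rewrite E; apply: measurableX => //; exact: measurable_itv.
- rewrite E [ltLHS](product_measure1E leb (lebesgue_tuple n) (measurable_itv _) m2).
  by rewrite lte_mul_pinfty// ge0_fin_numE.
- move=> h ch.
  rewrite (_ : _ \o _ = (h \o @row_split n \o vec_of) \o @tuple_cons R n); last first.
    by apply/funext => z /=; rewrite vec_of_cons row_splitK.
  apply: measurableT_comp; last exact: measurable_tuple_cons.
  apply: measurable_fun_vec_of => v; apply: continuous_comp; last exact: ch.
  exact: row_split_continuous.
Qed.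

(** By continuity [h] exceeds [h a / 2] on a small cube around [a], which has positive measure. That
    cube may stick out of [cube c r], so the comparison is made with the integral over the whole
    space. *)
Lemma Kint_gt0 n (c a : 'rV[R]_n) (r : R) (h : 'rV[R]_n -> R) : 0 <= r ->
  continuous h -> (forall x, 0 <= h x) -> (forall x, ~ cube c r x -> h x = 0) ->
  0 < h a -> 0 < Kint (lebesgue_tuple n) vec_of (cube c r) h.
Proof.
move=> r0 ch h0 hs ha.
have [_ hE] := Kint_supp (domain_cube c r0) measurableT (@subsetT _ _) ch
  (fun x _ => hs (vec_of x)).
rewrite -lte_fin -hE.
have /cvgrPdist_lt/(_ _ (divr_gt0 ha (ltr0Sn _ 1)))/nbhs_normP[s /= s0 hs2] := ch a.
have s20 : 0 <= s / 2 by rewrite divr_ge0// ltW.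
apply: (@lt_le_trans _ _ (\int[lebesgue_tuple n]_(x in vec_of @^-1` cube a (s / 2)) (h (vec_of x))%:E)%E); last first.
  apply: ge0_subset_integral => //; [exact: measurable_cube| |by move=> x _; rewrite lee_fin].
  by apply/measurable_EFinP; exact: measurable_fun_vec_of.
apply: (@lt_le_trans _ _ (\int[lebesgue_tuple n]_(x in vec_of @^-1` cube a (s / 2)) (cst (h a / 2)%:E x))%E).
  rewrite integral_cst; last exact: measurable_cube.
  rewrite [X in (_ * X)%E](lebesgue_cube a s20).
  by rewrite -EFinM lte_fin mulr_gt0 ?divr_gt0// exprn_gt0// pmulrn_lgt0// divr_gt0.
apply: ge0_le_integral => //.
- exact: measurable_cube.
- by move=> x _; rewrite lee_fin divr_ge0// ltW.
- by apply/measurable_funTS/measurable_EFinP; exact: measurable_fun_vec_of.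
- move=> x xs; rewrite lee_fin.
  have : `|h a - h (vec_of x)| < h a / 2.
    apply: hs2; rewrite /= distrC (@le_lt_trans _ _ (s / 2))//; last lra.
    by apply/rV_norm_le => // i; have := xs i; rewrite [(_ - a) _ _]mxE [(- a) _ _]mxE.
  by rewrite ltr_norml => /andP[_]; lra.
Qed.

Lemma is_derive_row_cons0 n (h : 'rV[R]_n.+1 -> R) (t : R) (y : 'rV[R]_n) l :
  is_derive (row_cons t y) (delta_mx ord0 ord0 : 'rV[R]_n.+1) h l ->
  is_derive t 1 (fun s => h (row_cons s y)) l.
Proof.
move=> /is_deriveP H; apply/is_derive1P => e /H; apply: filterS => s.
suff -> : s *: (delta_mx ord0 ord0 : 'rV[R]_n.+1) + row_cons t y = row_cons (s + t) y by [].
apply/rowP => i; case: (unliftP ord0 i) => [j ->|->].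
  by rewrite [LHS]mxE !row_cons_lift !mxE/= mulr0 add0r.
by rewrite [LHS]mxE !row_cons0 !mxE/= mulr1.
Qed.

Lemma is_derive_row_cons_lift n (h : 'rV[R]_n.+1 -> R) (t : R) (y : 'rV[R]_n) j l :
  is_derive (row_cons t y) (delta_mx ord0 (lift ord0 j) : 'rV[R]_n.+1) h l ->
  is_derive y (delta_mx ord0 j : 'rV[R]_n) (fun z => h (row_cons t z)) l.
Proof.
move=> /is_deriveP H; apply/is_deriveP => e /H; apply: filterS => s.
suff -> : s *: (delta_mx ord0 (lift ord0 j) : 'rV[R]_n.+1) + row_cons t y =
  row_cons t (s *: delta_mx ord0 j + y) by [].
apply/rowP => i; case: (unliftP ord0 i) => [k ->|->].
  by rewrite [LHS]mxE !row_cons_lift !mxE/= (inj_eq lift_inj).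
by rewrite [LHS]mxE !row_cons0 !mxE/= mulr0 add0r.
Qed.

Lemma cube_row_cons n (t : R) (y : 'rV[R]_n) (r : R) :
  cube 0 r (row_cons t y) <-> `|t| <= r /\ cube 0 r y.
Proof.
split=> [H|[H1 H2] i].
  split; first by have := H ord0; rewrite row_cons0 mxE subr0.
  by move=> i; have := H (lift ord0 i); rewrite row_cons_lift !mxE.
case: (unliftP ord0 i) => [j ->|->].
  by rewrite row_cons_lift; have := H2 j; rewrite !mxE.
by rewrite row_cons0 mxE subr0.
Qed.

(** Integration by parts without boundary term, by induction on the dimension. If [j] is the first
    coordinate, it is integrated first, by the fundamental theorem of calculus; otherwise the first
    coordinate is frozen and the induction hypothesis applies to the slice. *)
Lemma integral_partial_eq0 n (j : 'I_n) (h g : 'rV[R]_n -> R) (r : R) : 0 <= r ->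
  continuous g -> (forall x, is_derive x (delta_mx ord0 j : 'rV[R]_n) h (g x)) ->
  (forall x, ~ cube 0 r x -> h x = 0) -> (forall x, ~ cube 0 r x -> g x = 0) ->
  integral_Rd g = 0%E.
Proof.
move=> r0; elim: n j h g => [[]//|n IH] j h g cg dh h0 g0.
pose k (z : R * 'rV[R]_n) := g (row_cons z.1 z.2).
have ck : continuous k.
  by move=> z; apply: continuous_comp; [exact: row_cons_continuous|exact: cg].
have k0 z : ~ (`[- r, r]%classic `*` cube 0 r) z -> k z = 0.
  move=> zK; apply: g0 => /cube_row_cons[z1 z2]; apply: zK; split => //=.
  by rewrite in_itv/= -ler_norml.
have [ik _] := Kint_supp (domain_spacetime (-r) r 0 r0) measurableT (@subsetT _ _) ck
  (fun z _ => k0 (z.1, vec_of z.2)).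
have kE : (fun x => (g (vec_of x))%:E) \o @tuple_cons R n =
    (fun z => (k (z.1, vec_of z.2))%:E).
  by apply/funext => z /=; rewrite vec_of_cons.
have -> : integral_Rd g = (\int[leb \x lebesgue_tuple n]_z (k (z.1, vec_of z.2))%:E)%E.
  rewrite /integral_Rd [LHS]integral_pushforward ?kE//.
  - exact: measurable_tuple_cons.
  - by apply/measurable_EFinP; exact: measurable_fun_vec_of.
case: (unliftP ord0 j) dh => [i ->|->] dh.
- rewrite -integral12_prod_meas1//; apply: integral0_eq => x _.
  apply: (IH i (fun y => h (row_cons x y)) (fun y => g (row_cons x y))).
  + move=> y; apply: (@continuous_comp _ _ _ (row_cons x) g); last exact: cg.
    apply: (@continuous_comp _ _ _ (fun y => (x, y)) (fun z => row_cons z.1 z.2)).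
      by apply: continuous_pair; [exact: cst_continuous|exact: cvg_id].
    exact: row_cons_continuous.
  + by move=> y; exact: is_derive_row_cons_lift.
  + by move=> y yr; apply: h0 => /cube_row_cons[].
  + by move=> y yr; apply: g0 => /cube_row_cons[].
- rewrite -integral21_prod_meas1//; apply: integral0_eq => y _.
  pose gy t := g (row_cons t (vec_of y)).
  have cgy : continuous gy.
    pose v : 'rV[R]_n := vec_of y.
    move=> t; apply: (@continuous_comp R _ _ (fun s => row_cons s v) g); last exact: cg.
    apply: (@continuous_comp _ _ _ (fun s : R => (s, v)) (fun z => row_cons z.1 z.2)).
      by apply: continuous_pair; [exact: cvg_id|exact: cst_continuous].
    exact: row_cons_continuous.
  (* With [r + 1] in place of [r] the endpoints lie strictly outside the cube, where [h] is known to
     vanish. *)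
  have gy0 t : ~ `[- (r + 1), r + 1]%classic t -> gy t = 0.
    move=> tr; apply: g0 => /cube_row_cons[tr' _]; apply: tr.
    by rewrite /= in_itv/= -ler_norml (le_trans tr')// lerDl.
  have [_ E] := Kint_supp (domain_itv (- (r + 1)) (r + 1)) measurableT (@subsetT _ _) cgy
    (fun t _ => @gy0 t).
  rewrite [LHS]E; congr EFin.
  have r1 : - (r + 1) <= r + 1 by lra.
  have out s : r < `|s| -> h (row_cons s (vec_of y)) = 0.
    by move=> rs; apply: h0 => /cube_row_cons[]; rewrite leNgt rs.
  rewrite /Kint [LHS](Rintegral_derive (f := fun s => h (row_cons s (vec_of y))))//.
    by rewrite !out ?subrr// ?normrN ger0_norm; lra.
  by move=> t _; exact: is_derive_row_cons0.
Qed.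

(** * Functions of time and space *)

(* Precomposition with [clamp T] turns continuity within [0, T] into continuity. *)
Definition clamp (T t : R) : R := Num.max 0 (Num.min t T).

Lemma clamp_itv T t : 0 <= T -> 0 <= clamp T t <= T.
Proof. by move=> T0; rewrite /clamp le_max lexx/= ge_max T0 ge_min lexx orbT. Qed.

Lemma clamp_id T t : 0 <= t <= T -> clamp T t = t.
Proof. by move=> /andP[t0 tT]; rewrite /clamp (min_idPl tT) (max_idPr t0). Qed.

Lemma clamp_continuous T : continuous (clamp T).
Proof.
move=> t; apply: (@continuous_max _ _ (cst 0) (fun s => Num.min s T)).
  exact: cst_continuous.
by apply: continuous_min; [exact: cvg_id|exact: cst_continuous].
Qed.

Section spacetime_regularity.
Context {d : nat} (T : R) (T0 : 0 <= T).
Local Notation rV := 'rV[R]_d.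

Lemma C00P (V : normedModType R) (u : R -> rV -> V) :
  C00 T u <-> continuous (fun z : R * rV => u (clamp T z.1) z.2).
Proof.
have cl : continuous (fun z : R * rV => (clamp T z.1, z.2)).
  move=> z; apply: (@continuous_pair _ _ _ (fun z : R * rV => clamp T z.1) snd); last exact: cvg_snd.
  by apply: continuous_comp; [exact: cvg_fst|exact: clamp_continuous].
have clK z : (`[0, T]%classic `*` [set: rV]) (clamp T z.1, z.2).
  by split => //=; rewrite in_itv/= clamp_itv.
rewrite /C00; split=> [/subspace_continuousP cu z|cu].
  have {}cu := cu _ (clK z).
  move=> A /cu H; have {H} := cl z _ H; rewrite /nbhs/=.
  by apply: (@filterS _ (nbhs z)) => w /(_ (clK w)).
have E : {in `[0, T] `*` [set: rV],
    (fun z : R * rV => u (clamp T z.1) z.2) =1 (fun z => u z.1 z.2)}.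
  by move=> z /[!inE] -[/= + _]; rewrite in_itv/= => zT; rewrite clamp_id.
apply: (subspace_eq_continuous E).
exact: continuous_subspaceT.
Qed.

Lemma eq_C00 (V : normedModType R) (u v : R -> rV -> V) :
  (forall t, 0 <= t <= T -> forall x, u t x = v t x) -> C00 T u -> C00 T v.
Proof.
move=> uv /C00P cu; apply/C00P.
by under [X in continuous X]eq_fun do rewrite -uv ?clamp_itv//.
Qed.

Lemma eq_C01 (V : normedModType R) (u v : R -> rV -> V) :
  (forall t, 0 <= t <= T -> forall x, u t x = v t x) -> C01 T u -> C01 T v.
Proof.
move=> uv [cu du]; have {}uv' t : 0 <= t <= T -> u t = v t.
  by move=> tT; apply/funext => x; exact: uv.
split; first exact: eq_C00 uv cu.
move=> w; have [dw cw] := du w; split.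
  by move=> t x tT; rewrite -uv'//; exact: dw.
by apply: eq_C00 cw => t tT x; rewrite uv'.
Qed.

Lemma C01_intro (u : R -> rV -> R) (du : rV -> R -> rV -> R) :
  C00 T u ->
  (forall w t x, 0 <= t <= T -> is_derive x w (u t) (du w t x)) ->
  (forall w, C00 T (du w)) -> C01 T u.
Proof.
move=> cu Du cdu; split => // w; split.
  by move=> t x tT; have [] := Du w t x tT.
by apply: eq_C00 (cdu w) => t tT x; have [_ ->] := Du w t x tT.
Qed.

Lemma C01_derive (u : R -> rV -> R) : C01 T u ->
  forall w t x, 0 <= t <= T -> is_derive x w (u t) ('D_w (u t) x).
Proof. by move=> [_ du] w t x tT; apply/derivableP; exact: (du w).1. Qed.

Lemma C01_C00 (u : R -> rV -> R) : C01 T u -> C00 T u.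
Proof. by case. Qed.

Lemma C01_C00D (u : R -> rV -> R) w : C01 T u -> C00 T (fun t => 'D_w (u t)).
Proof. by case=> _ /(_ w)[]. Qed.

Lemma C00_cst (V : normedModType R) (a : V) : C00 T (fun (_ : R) (_ : rV) => a).
Proof. by apply/C00P => z; exact: cvg_cst. Qed.

Lemma C00D (u v : R -> rV -> R) : C00 T u -> C00 T v ->
  C00 T (fun t x => u t x + v t x).
Proof. by move=> /C00P cu /C00P cv; apply/C00P => z; apply: cvgD; [exact: cu|exact: cv]. Qed.

Lemma C00M (u v : R -> rV -> R) : C00 T u -> C00 T v ->
  C00 T (fun t x => u t x * v t x).
Proof. by move=> /C00P cu /C00P cv; apply/C00P => z; apply: cvgM; [exact: cu|exact: cv]. Qed.

Lemma C00_sum n (u : 'I_n -> R -> rV -> R) : (forall i, C00 T (u i)) ->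
  C00 T (fun t x => \sum_i u i t x).
Proof.
move=> cu; apply/C00P => z; apply: cvg_big => [|i _]; first exact: add_continuous.
by have /C00P := cu i; exact.
Qed.

Lemma C00_comp (u : R -> rV -> R) (phi : R -> R) : C00 T u ->
  (forall t x, 0 <= t <= T -> {for u t x, continuous phi}) ->
  C00 T (fun t x => phi (u t x)).
Proof.
move=> /C00P cu cphi; apply/C00P => z.
apply: (@continuous_comp _ _ _ (fun z : R * rV => u (clamp T z.1) z.2) phi).
  exact: cu.
by apply: cphi; exact: clamp_itv.
Qed.

Lemma C00_time (th : R -> R) : continuous th -> C00 T (fun t (_ : rV) => th t).
Proof.
move=> cth; apply/C00P => z.
apply: (@continuous_comp _ _ _ (fun z : R * rV => clamp T z.1) th); last exact: cth.
by apply: continuous_comp; [exact: cvg_fst|exact: clamp_continuous].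
Qed.

Lemma C00_space (s : rV -> R) : continuous s -> C00 T (fun _ : R => s).
Proof. by move=> cs; apply/C00P => z; apply: continuous_comp; [exact: cvg_snd|exact: cs]. Qed.

Lemma C01_cst (a : R) : C01 T (fun (_ : R) (_ : rV) => a).
Proof.
apply: (C01_intro (du := fun _ _ _ => 0)).
- exact: C00_cst.
- by move=> _; exact: C00_cst.
Qed.

Lemma C01D (u v : R -> rV -> R) : C01 T u -> C01 T v ->
  C01 T (fun t x => u t x + v t x).
Proof.
move=> cu cv.
apply: (C01_intro (du := fun w t x => 'D_w (u t) x + 'D_w (v t) x)).
- by apply: C00D; exact: C01_C00.
- by move=> w t x tT; apply: is_deriveD; exact: C01_derive.
- by move=> w; apply: C00D; exact: C01_C00D.
Qed.

Lemma is_deriveMx (V : normedModType R) (u v : V -> R) x w a b : is_derive x w u a -> is_derive x w v b ->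
  is_derive x w (fun y => u y * v y) (u x * b + v x * a).
Proof. by move=> du dv; exact: is_deriveM. Qed.

Lemma C01M (u v : R -> rV -> R) : C01 T u -> C01 T v ->
  C01 T (fun t x => u t x * v t x).
Proof.
move=> cu cv.
apply: (C01_intro (du := fun w t x => u t x * 'D_w (v t) x + v t x * 'D_w (u t) x)).
- by apply: C00M; exact: C01_C00.
- by move=> w t x tT; exact: (is_deriveMx (C01_derive cu w x tT) (C01_derive cv w x tT)).
- move=> w; apply: C00D.
    by apply: C00M; [exact: C01_C00|exact: (C01_C00D cv)].
  by apply: C00M; [exact: C01_C00|exact: (C01_C00D cu)].
Qed.

Lemma C01_sum n (u : 'I_n -> R -> rV -> R) : (forall i, C01 T (u i)) ->
  C01 T (fun t x => \sum_i u i t x).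
Proof.
elim: n u => [|n IH] u cu.
  by under eq_fun do under eq_fun do rewrite big_ord0; exact: C01_cst.
under eq_fun do under eq_fun do rewrite big_ord_recl.
by apply: C01D => //; apply: (IH (fun i => u (lift ord0 i))).
Qed.

(** Restricting [u] to the line through [x] in direction [w] reduces this to the chain rule for
    functions of one real variable. *)
Lemma is_derive_comp1 (V : normedModType R) (u : V -> R) (phi : R -> R) (x w : V) a b :
  is_derive x w u a -> is_derive (u x) 1 phi b ->
  is_derive x w (fun y => phi (u y)) (b * a).
Proof.
move=> du dphi; have [derx Dx] := du.
have H : is_derive (0 : R) 1 (phi \o (fun h => u (h *: w + x))) (a * b).
  have -> : a * b = b * a by rewrite mulrC.
  apply: is_derive1_comp; first by rewrite scale0r add0r.
  rewrite -Dx -[in 'D_w u x](add0r x) -(scale0r w); apply: is_derive_line.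
  by rewrite scale0r add0r.
apply/is_deriveP => e e0; have := (is_derive1P _ _ _).1 H _ e0.
by apply: filterS => h; rewrite /= addr0 scale0r add0r (mulrC b).
Qed.

Lemma C01_comp (u : R -> rV -> R) (phi phi' : R -> R) : C01 T u ->
  (forall t x, 0 <= t <= T -> is_derive (u t x) 1 phi (phi' (u t x))) ->
  (forall t x, 0 <= t <= T -> {for u t x, continuous phi'}) ->
  C01 T (fun t x => phi (u t x)).
Proof.
move=> cu dphi cphi'.
apply: (C01_intro (du := fun w t x => phi' (u t x) * 'D_w (u t) x)).
- apply: C00_comp; first exact: C01_C00.
  by move=> t x tT; exact: is_derive_continuous (dphi t x tT).
- by move=> w t x tT; exact: (is_derive_comp1 (C01_derive cu w x tT) (dphi t x tT)).
- by move=> w; apply: C00M; [apply: C00_comp => //; exact: C01_C00|exact: C01_C00D].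
Qed.

End spacetime_regularity.

Section spacetime_regularity_closure.
Context {d : nat} (T : R) (T0 : 0 <= T).
Local Notation rV := 'rV[R]_d.

Lemma near_interior (t : R) (x : rV) : 0 < t < T ->
  \forall z \near (t, x), 0 < z.1 < T.
Proof.
move=> tT; have : \forall s \near t, 0 < s < T.
  have /open_nbhs_nbhs : open_nbhs t `]0, T[%classic.
    by split; [exact: interval_open|rewrite /= in_itv].
  by apply: filterS => s; rewrite /= in_itv.
by move=> H; exact: (@cvg_fst _ _ (nbhs t) (nbhs x) _ _ H).
Qed.

Lemma within_interiorP (g : R * rV -> R) :
  {within `]0, T[ `*` [set: rV], continuous g} <->
  (forall t x, 0 < t < T -> {for (t, x), continuous g}).
Proof.
have oA : open (`]0, T[ `*` [set: rV]).
  rewrite openE => -[t x] [/= + _]; rewrite in_itv/= => tT.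
  by apply: filterS (near_interior x tT) => z zT; split; rewrite //= in_itv.
rewrite (continuous_open_subspace g oA); split=> [H t x tT|H z /[!inE] -[zT _]].
  by apply: H; rewrite inE; split => //=; rewrite in_itv.
by case: z zT => t x /= zT; apply: H; move: zT; rewrite in_itv.
Qed.

Lemma C12_intro (u : R -> rV -> R) (du : rV -> R -> rV -> R) (dtu : R -> rV -> R) :
  C00 T u ->
  (forall w t x, 0 <= t <= T -> is_derive x w (u t) (du w t x)) ->
  (forall w, C01 T (du w)) ->
  (forall t x, 0 < t < T -> is_derive t 1 (u ^~ x) (dtu t x)) ->
  (forall t x, 0 < t < T -> {for (t, x), continuous (fun z => dtu z.1 z.2)}) ->
  C12 T u.
Proof.
move=> cu Du cdu Dtu cdtu; split.
- by apply: (C01_intro T0 cu Du) => w; exact: C01_C00.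
- move=> w; apply: (eq_C01 T0 _ (cdu w)) => t tT x.
  by have [_ ->] := Du w t x tT.
- by move=> t x tT; have [] := Dtu t x tT.
- apply/within_interiorP => t x tT.
  have E : \forall z \near (t, x), dtu z.1 z.2 = derive1 (u ^~ z.2) z.1.
    move: (near_interior x tT); apply: filterS => z zT.
    by rewrite derive1E; have [_ ->] := Dtu z.1 z.2 zT.
  rewrite /prop_for /continuous_at -(nbhs_singleton E).
  by apply: (cvg_trans (near_eq_cvg E)); exact: cdtu.
Qed.

Lemma C12_time (u : R -> rV -> R) t x : C12 T u -> 0 < t < T ->
  is_derive t 1 (u ^~ x) (derive1 (u ^~ x) t).
Proof. by move=> [_ _ du _] tT; rewrite derive1E; apply/derivableP; exact: du. Qed.

Lemma C12_time_continuous (u : R -> rV -> R) t x : C12 T u -> 0 < t < T ->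
  {for (t, x), continuous (fun z => derive1 (u ^~ z.2) z.1)}.
Proof. by move=> [_ _ _ /within_interiorP cu] tT; exact: cu. Qed.

Lemma C12_C01 (u : R -> rV -> R) : C12 T u -> C01 T u.
Proof. by case. Qed.

Lemma C12_C01D (u : R -> rV -> R) w : C12 T u -> C01 T (fun t => 'D_w (u t)).
Proof. by case=> _ /(_ w). Qed.

Lemma C12D (u v : R -> rV -> R) : C12 T u -> C12 T v ->
  C12 T (fun t x => u t x + v t x).
Proof.
move=> cu cv; apply: (C12_intro (du := fun w t x => 'D_w (u t) x + 'D_w (v t) x)
  (dtu := fun t x => derive1 (u ^~ x) t + derive1 (v ^~ x) t)).
- exact: (C00D T0 (C01_C00 (C12_C01 cu)) (C01_C00 (C12_C01 cv))).
- move=> w t x tT.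
  exact: (is_deriveD (C01_derive (C12_C01 cu) w x tT) (C01_derive (C12_C01 cv) w x tT)).
- by move=> w; exact: (C01D T0 (C12_C01D w cu) (C12_C01D w cv)).
- by move=> t x tT; exact: (is_deriveD (C12_time x cu tT) (C12_time x cv tT)).
- by move=> t x tT; apply: cvgD; exact: C12_time_continuous.
Qed.

Lemma interior_itv t : 0 < t < T -> 0 <= t <= T.
Proof. by move=> /andP[/ltW-> /ltW->]. Qed.

Lemma C00_continuous (u : R -> rV -> R) t x : C00 T u -> 0 < t < T ->
  {for (t, x), continuous (fun z => u z.1 z.2)}.
Proof.
move=> /(C00P T0) cu tT.
have E : \forall z \near (t, x), u (clamp T z.1) z.2 = u z.1 z.2.
  by move: (near_interior x tT); apply: filterS => z zT; rewrite clamp_id ?interior_itv.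
rewrite /prop_for /continuous_at -(nbhs_singleton E).
by apply: (cvg_trans (near_eq_cvg E)); exact: cu.
Qed.

Lemma C12_comp (u : R -> rV -> R) (phi phi' phi'' : R -> R) : C12 T u ->
  (forall t x, 0 <= t <= T -> is_derive (u t x) 1 phi (phi' (u t x))) ->
  (forall t x, 0 <= t <= T -> is_derive (u t x) 1 phi' (phi'' (u t x))) ->
  (forall t x, 0 <= t <= T -> {for u t x, continuous phi''}) ->
  C12 T (fun t x => phi (u t x)).
Proof.
move=> cu dphi dphi' cphi''; have cu1 := C12_C01 cu; have cu0 := C01_C00 cu1.
have c' t x (tT : 0 <= t <= T) := is_derive_continuous (dphi' t x tT).
apply: (C12_intro (du := fun w t x => phi' (u t x) * 'D_w (u t) x)
  (dtu := fun t x => phi' (u t x) * derive1 (u ^~ x) t)).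
- apply: (C00_comp T0 cu0) => t x tT; exact: is_derive_continuous (dphi t x tT).
- by move=> w t x tT; exact: (is_derive_comp1 (C01_derive cu1 w x tT) (dphi t x tT)).
- move=> w.
  exact: (C01M T0 (C01_comp T0 cu1 dphi' cphi'') (C12_C01D w cu)).
- move=> t x tT.
  exact: (is_derive_comp1 (C12_time x cu tT) (dphi t x (interior_itv tT))).
- move=> t x tT; apply: cvgM; last exact: C12_time_continuous.
  apply: (@continuous_comp _ _ _ (fun z : R * rV => u z.1 z.2) phi').
    exact: C00_continuous.
  by apply: c'; exact: interior_itv.
Qed.

Lemma C12_sep (th th' : R -> R) (s : rV -> R) : (forall t : R, is_derive t 1 th (th' t)) ->
  continuous th' -> C12 T (fun _ : R => s) -> C12 T (fun t x => th t * s x).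
Proof.
move=> dth cth' cs.
have cth : continuous th by move=> t; exact: is_derive_continuous (dth t).
have C1 (g : rV -> R) : C01 T (fun _ : R => g) -> C01 T (fun t x => th t * g x).
  move=> cg; apply: (C01_intro T0 (du := fun w t x => th t * 'D_w g x)).
  - by apply: C00M => //; [exact: C00_time|exact: C01_C00].
  - move=> w t x tT; apply: is_deriveZ; exact: (C01_derive cg w x tT).
  - move=> w; apply: (C00M T0 (u := fun t _ => th t) (v := fun _ => 'D_w g)).
      exact: C00_time.
    exact: (C01_C00D (u := fun=> g)) cg.
have cs1 := C12_C01 cs.
have cs0 : continuous s.
  move=> x; have /(C00P T0) H := C01_C00 cs1.
  apply: (@continuous_comp _ _ _ (fun y : rV => (0 : R, y)) (fun z => s z.2)); last exact: H.
  by apply: continuous_pair; [exact: cst_continuous|exact: cvg_id].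
apply: (C12_intro (du := fun w t x => th t * 'D_w s x) (dtu := fun t x => th' t * s x)).
- by apply: C00M => //; [exact: C00_time|exact: C01_C00].
- by move=> w t x tT; apply: is_deriveZ; exact: (C01_derive cs1 w x tT).
- by move=> w; apply: C1; exact: (C12_C01D w cs).
- by move=> t x tT; rewrite mulrC; under eq_fun do rewrite mulrC; exact: is_deriveZ.
- move=> t x tT; apply: cvgM.
    by apply: (@continuous_comp _ _ _ fst th'); [exact: cvg_fst|exact: cth'].
  by apply: (@continuous_comp _ _ _ snd s); [exact: cvg_snd|exact: cs0].
Qed.

Lemma C01_rVP (f : R -> rV -> rV) :
  C01 T f <-> forall j, C01 T (fun t x => f t x ord0 j).
Proof.
split=> [[cf df] j|cf].
  split.
    have /(C00P T0) cf' := cf; apply/(C00P T0) => z.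
    exact: ((rV_continuousP _ _).1 (cf' z) j).
  move=> w; have [dw cw] := df w; split.
    by move=> t x tT; have /derivable_mxP := dw t x tT; exact.
  have /(C00P T0) cw' := cw; apply/(C00P T0) => z.
  have H := (rV_continuousP _ _).1 (cw' z) j.
  under [X in continuous_at _ X]eq_fun => y.
    rewrite (_ : 'D_w _ _ = 'D_w (f (clamp T y.1)) y.2 ord0 j); last first.
      by rewrite derive_mx ?mxE//; apply: dw; exact: clamp_itv.
    over.
  exact: H.
have df w t x : 0 <= t <= T -> derivable (f t) x w.
  move=> tT; apply/derivable_mxP => i j; rewrite (ord1 i).
  by have [_ /(_ w)[+ _]] := cf j; exact.
split.
  apply/(C00P T0) => z; apply/rV_continuousP => j.
  by have /(C00P T0) := C01_C00 (cf j); exact.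
move=> w; split; first exact: df.
apply/(C00P T0) => z; apply/rV_continuousP => j.
have /(C00P T0) H := C01_C00D (w := w) (cf j).
have -> : (fun y : R * rV => 'D_w (f (clamp T y.1)) y.2 ord0 j) =
    (fun y => 'D_w (fun x => f (clamp T y.1) x ord0 j) y.2).
  by apply/funext => y; rewrite derive_mx ?mxE//; apply: df; exact: clamp_itv.
exact: H.
Qed.

End spacetime_regularity_closure.

(** * Compactly supported test functions *)

Definition pospart (s : R) : R := Num.max 0 s.

Lemma pospart_continuous : continuous pospart.
Proof.
move=> s; apply: (@continuous_max _ _ (cst 0) id); last exact: cvg_id.
exact: cst_continuous.
Qed.

(** Away from 0 the function is locally 0 or a power. At 0 the increment is at most |h|^(n+2), hence
    at most e |h| once |h| is below both 1 and [e]. *)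
Lemma is_derive_pospart n (s : R) :
  is_derive s 1 (fun s => pospart s ^+ n.+2) (n.+2%:R * pospart s ^+ n.+1).
Proof.
have [s0|s0|->] := ltgtP s 0.
- rewrite /pospart (max_l (ltW s0)) expr0n/= mulr0.
  apply: (@near_eq_is_derive _ _ _ (cst 0 : R -> R)).
  near=> t; rewrite max_l ?expr0n//; near: t.
  by apply: filterS (lt_nbhsl s0) => t /ltW.
- rewrite /pospart (max_r (ltW s0)).
  apply: (@near_eq_is_derive _ _ _ (fun t : R => t ^+ n.+2 : R)).
    near=> t; rewrite max_r//; near: t.
    by apply: filterS (lt_nbhsr s0) => t /ltW.
  split; first exact: exprn_derivable.
  by rewrite exp_derive; exact: mulr1.
- rewrite /pospart maxxx expr0n/= mulr0; apply/is_derive1P => e e0.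
  near=> h; rewrite addr0 maxxx expr0n/= subr0 mulr0 subr0.
  have h1 : `|h| <= 1 by near: h; apply: (@nbhs0_le R R).
  have he : `|h| <= e by near: h; apply: (@nbhs0_le R R).
  have m0 : 0 <= Num.max 0 h by rewrite le_max lexx.
  have mh : Num.max 0 h <= `|h| by rewrite ge_max normr_ge0 ler_norm.
  rewrite ger0_norm ?exprn_ge0// exprS mulrC ler_pM ?exprn_ge0//.
  rewrite (le_trans _ he)// (le_trans _ mh)// exprS ler_piMr//.
  by rewrite exprn_ile1// (le_trans mh).
Unshelve. all: by end_near. Qed.

Section bump.
Context {d : nat} (T : R) (T0 : 0 <= T).
Local Notation rV := 'rV[R]_d.

Lemma is_derive_coord (x w : rV) j : is_derive x w (fun y : rV => y ord0 j) (w ord0 j).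
Proof.
apply/is_deriveP => e e0; near=> h.
by rewrite !mxE addrK subrr normr0 mulr_ge0// ltW.
Unshelve. all: by end_near. Qed.

Lemma C01_coord j : C01 T (fun (_ : R) (x : rV) => x ord0 j).
Proof.
apply: (C01_intro T0 (du := fun w _ _ => w ord0 j)).
- by apply: (C00_space T0 (s := fun x : rV => x ord0 j)); exact: coord_continuous.
- by move=> w t x _; exact: is_derive_coord.
- by move=> w; exact: C00_cst.
Qed.

Definition paraboloid (a : rV) (r : R) (x : rV) : R :=
  r ^+ 2 - \sum_j (x ord0 j - a ord0 j) ^+ 2.

(** The exponent 3 makes the bump twice continuously differentiable, as [C12] demands of the
    perturbed density. The paraboloid is positive exactly in the Euclidean ball of radius [r] around
    [a] when [r] is nonnegative. *)
Definition bump (a : rV) (r : R) (x : rV) : R := pospart (paraboloid a r x) ^+ 3.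

Lemma C12_paraboloid a r : C12 T (fun _ : R => paraboloid a r).
Proof.
pose du (w : rV) (t : R) (x : rV) := \sum_j (- 2 * w ord0 j) * (x ord0 j + - a ord0 j).
have Cc j : C01 T (fun (_ : R) (x : rV) => x ord0 j + - a ord0 j).
  by apply: C01D => //; [exact: C01_coord|exact: C01_cst].
apply: (C12_intro T0 (du := du) (dtu := fun _ _ => 0)).
- apply: (C00D T0); first exact: C00_cst.
  apply: (@eq_C00 _ _ T0 _ (fun (_ : R) (x : rV) => -1 * \sum_j (x ord0 j + - a ord0 j) * (x ord0 j + - a ord0 j))).
    by move=> t _ x; rewrite mulN1r.
  apply: (C00M T0); first exact: C00_cst.
  by apply: (C00_sum T0) => j; apply: C00M => //; exact: C01_C00 (Cc j).
- move=> w t x _.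
  have -> : du w t x = 0 - \sum_j ((x ord0 j - a ord0 j) * w ord0 j + (x ord0 j - a ord0 j) * w ord0 j).
    rewrite sub0r -sumrN; apply: eq_bigr => j _; ring.
  apply: is_deriveB.
  have -> : (fun x : rV => \sum_j (x ord0 j - a ord0 j) ^+ 2) =
      \sum_j (fun x : rV => (x ord0 j - a ord0 j) * (x ord0 j - a ord0 j)).
    by apply/funext => y; rewrite fct_sumE.
  apply: is_derive_sum => j; apply: is_deriveMx;
    by rewrite -[w ord0 j]subr0; apply: is_deriveB; exact: is_derive_coord.
- by move=> w; apply: (C01_sum T0) => j; apply: C01M => //; exact: C01_cst.
- by move=> t x _; exact: is_derive_cst.
- by move=> t x _; exact: cst_continuous.
Qed.

Lemma C12_bump a r : C12 T (fun _ : R => bump a r).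
Proof.
apply: (C12_comp T0 (phi := fun s => pospart s ^+ 3) (phi' := fun s => 3 * pospart s ^+ 2)
  (phi'' := fun s => 3 * (2 * pospart s ^+ 1)) (C12_paraboloid a r)).
- by move=> t x _; exact: is_derive_pospart.
- by move=> t x _; apply: is_deriveZ; exact: is_derive_pospart.
- move=> t x _; apply: cvgMl_tmp; apply: cvgMl_tmp; exact: pospart_continuous.
Qed.

Lemma bump_ge0 a r x : 0 <= bump a r x.
Proof. by rewrite exprn_ge0// le_max lexx. Qed.

Lemma bump_gt0 a r : 0 < r -> 0 < bump a r a.
Proof.
move=> r0; rewrite exprn_gt0// lt_max; apply/orP; right.
rewrite /paraboloid big1 ?subr0 ?exprn_gt0// => j _.
by rewrite subrr expr0n.
Qed.

Lemma bump_supp a r x : 0 <= r -> ~ cube a r x -> bump a r x = 0.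
Proof.
move=> r0 xr; rewrite /bump /pospart max_l ?expr0n// subr_le0.
have /existsNP[j /negP] := xr; rewrite -ltNge => rj.
rewrite (bigD1 j)//= -[leLHS]addr0 lerD ?sumr_ge0//; last by move=> i _; exact: sqr_ge0.
by rewrite -[leRHS]real_normK ?num_real// lerXn2r ?nnegrE// ltW.
Qed.

Lemma bump_shift a r x (v : rV) : bump a r (x - v) = bump (a + v) r x.
Proof.
rewrite /bump /paraboloid; congr (pospart (_ - _) ^+ _); apply: eq_bigr => j _.
by rewrite !mxE opprD addrAC addrA.
Qed.

End bump.

Lemma is_derive_lineP (V : normedModType R) (f : V -> R) (x w : V) l :
  is_derive (0 : R) 1 (fun p => f (p *: w + x)) l -> is_derive x w f l.
Proof.
move=> /is_derive1P H; apply/is_deriveP => e /H; apply: filterS => h.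
by rewrite addr0 scale0r add0r.
Qed.

Section segment_average.
Context {d : nat} (T : R) (T0 : 0 <= T).
Local Notation rV := 'rV[R]_d.
Variables (v : rV) (h : R).
Hypothesis h0 : 0 <= h.

(** The integral of [g] over the segment from [x - h *: v] to [x]. Its derivative along [v] is a
    difference of two translates of [g], which is how a compactly supported chi with a prescribed
    D_i chi is made. *)
Definition segment_int (g : rV -> R) (x : rV) : R :=
  Kint leb id `[0, h] (fun s => g (x - s *: v)).

Lemma shift_continuous (g : rV -> R) : continuous g ->
  continuous (fun z : rV * R => g (z.1 - z.2 *: v)).
Proof.
move=> cg z; apply: (@continuous_comp _ _ _ (fun z : rV * R => z.1 - z.2 *: v) g); last exact: cg.
by apply: cvgB; [exact: cvg_fst|apply: cvgZr_tmp; exact: cvg_snd].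
Qed.

Lemma slice_continuous (U W Z : topologicalType) (k : U -> W -> Z) (u : U) :
  continuous (fun z : U * W => k z.1 z.2) -> continuous (k u).
Proof.
move=> ck w; apply: (@continuous_comp _ _ _ (fun y : W => (u, y)) (fun z => k z.1 z.2)); last exact: ck.
by apply: continuous_pair; [exact: cst_continuous|exact: cvg_id].
Qed.

Lemma segment_int_continuous (g : rV -> R) : continuous g -> continuous (segment_int g).
Proof.
move=> cg x; have cg2 := shift_continuous cg.
apply: (Kint_continuous (P := rV) (domain_itv 0 h) (h := fun (x : rV) (s : R) => g (x - s *: v))).
  near=> y; exact: (slice_continuous (k := fun (x : rV) (s : R) => g (x - s *: v))).
by move=> s _; exact: cg2.
Unshelve. all: by end_near. Qed.

Lemma is_derive_segment_int (g dg : rV -> R) (x w : rV) :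
  continuous g -> continuous dg ->
  (forall y, is_derive y w g (dg y)) ->
  is_derive x w (segment_int g) (segment_int dg x).
Proof.
move=> cg cdg Dg; apply: is_derive_lineP.
have cl (k : rV -> R) : continuous k ->
    continuous (fun z : R * R => k (z.1 *: w + x - z.2 *: v)).
  move=> ck z; apply: (@continuous_comp _ _ _ (fun z : R * R => z.1 *: w + x - z.2 *: v) k); last exact: ck.
  apply: cvgB; last by apply: cvgZr_tmp; exact: cvg_snd.
  by apply: cvgD; [apply: cvgZr_tmp; exact: cvg_fst|exact: cvg_cst].
have -> : segment_int dg x = segment_int dg (0 *: w + x) by rewrite scale0r add0r.
apply: (Kint_derive (domain_itv 0 h) (q := fun p s : R => g (p *: w + x - s *: v))
   (h := fun p s : R => dg (p *: w + x - s *: v))).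
- near=> p; split.
    exact: (slice_continuous (k := fun p s : R => g (p *: w + x - s *: v)) (u := p) (cl _ cg)).
  move=> s _; have := Dg (p *: w + x - s *: v); rewrite -addrA => Dgs.
  have [+ DE] := Dgs => /is_derive_line; rewrite DE.
  by under eq_fun do rewrite addrA; rewrite addrA.
- exact: (slice_continuous (k := fun p s : R => dg (p *: w + x - s *: v)) (u := 0) (cl _ cdg)).
- by move=> s _; exact: cl.
Unshelve. all: by end_near. Qed.

Lemma segment_int_partial (g dg : rV -> R) (x : rV) : continuous dg ->
  (forall y, is_derive y v g (dg y)) ->
  segment_int dg x = g x - g (x - h *: v).
Proof.
move=> cdg Dg; rewrite /segment_int /Kint.
have H := @Rintegral_derive (fun s => - g (x - s *: v)) (fun s => dg (x - s *: v)) 0 h h0.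
transitivity (- g (x - h *: v) - - g (x - 0 *: v)); last first.
  by rewrite scale0r subr0 opprK addrC.
apply: H.
  move=> s; apply: (slice_continuous (k := fun (x : rV) (s : R) => dg (x - s *: v))).
  exact: shift_continuous.
move=> s _; have E : (fun s => - g (x - s *: v)) = (fun s => -1 * g ((-1 * s) *: v + x)).
  by apply/funext => p; rewrite !mulN1r scaleNr addrC.
rewrite E; have -> : dg (x - s *: v) = -1 * (dg ((-1 * s) *: v + x) * -1).
  by rewrite !mulN1r mulrN1 opprK scaleNr addrC.
apply: is_deriveZ; apply: (@is_derive_comp1 _ (fun s : R => -1 * s) (fun p => g (p *: v + x))).
  by rewrite -[X in is_derive _ _ _ X]mulr1; apply: is_deriveZ.
by have [+ DE] := Dg ((-1 * s) *: v + x) => /is_derive_line; rewrite DE.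
Qed.

End segment_average.

Lemma loc_holder_continuous (V : normedModType R) (u : V -> R) :
  loc_holder u -> continuous u.
Proof.
move=> [a /andP[a0 _] Hu] y; apply/cvgrPdist_le => e e0.
have [C HC] := Hu (`|y| + 1).
(* [dl] solves c dl^a = e. Passing from [C] to [c] makes the constant positive, and the ball of
   radius |y| + 1 contains every [z] at distance at most 1 from [y]. *)
pose c := `|C| + 1; have c0 : 0 < c by rewrite ltr_wpDl.
pose dl := (e / c) `^ a^-1; have dl0 : 0 < dl by rewrite powR_gt0// divr_gt0.
near=> z.
have yz1 : `|y - z| <= 1 by near: z; apply: cvgr_dist_le.
have yzd : `|y - z| <= dl by near: z; apply: cvgr_dist_le.
apply: le_trans (HC y z _ _) _.
- by rewrite lerDl.
- rewrite -(subKr y z) (le_trans (ler_normB _ _))// lerD2l//.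
- have pw : `|y - z| `^ a <= e / c.
    have -> : e / c = dl `^ a.
      by rewrite /dl -powRrM mulVf ?gt_eqF// powRr1// divr_ge0// ltW.
    by apply: ge0_ler_powR => //; rewrite ?nnegrE// ltW.
  apply: (@le_trans _ _ (c * (e / c))); last by rewrite mulrCA divff ?gt_eqF// mulr1.
  have [C0|C0] := leP 0 C; last first.
    rewrite (@le_trans _ _ 0)//; first by rewrite mulr_le0_ge0 ?powR_ge0// ltW.
    by rewrite mulr_ge0 ?divr_ge0// ltW.
  by apply: ler_pM; rewrite ?powR_ge0// /c ger0_norm// lerDl.
Unshelve. all: by end_near. Qed.

Lemma is_derive_curve (V : normedModType R) (u : V -> R) (p : R) (g : R -> V) n
    (e : 'I_n -> V) (c : 'I_n -> R -> R) (c' : 'I_n -> R) :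
  (forall i y, derivable u y (e i)) ->
  (forall i, continuous ('D_(e i) u)) ->
  (forall s, g s = g p + \sum_i (c i s - c i p) *: e i) ->
  (forall i, is_derive p 1 (c i) (c' i)) ->
  is_derive p 1 (fun s => u (g s)) (\sum_i c' i * 'D_(e i) u (g p)).
Proof.
move=> du cu gE dc.
have H : is_derive (0 : R) 1 (fun s => u (g p + \sum_i (c i (s + p) - c i p) *: e i))
    (\sum_i c' i * 'D_(e i) u (g p)).
  apply: (is_derive_dir_comp (c := fun i s => c i (s + p) - c i p)) => //.
  - by move=> i; exact: cu.
  - by move=> i; rewrite add0r subrr.
  - move=> i; apply/is_derive1P => eps eps0; have := (is_derive1P _ _ _).1 (dc i) _ eps0.
    by apply: filterS => h; rewrite addr0 add0r subrr subr0.
apply/is_derive1P => eps eps0; have := (is_derive1P _ _ _).1 H _ eps0.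
by apply: filterS => h; rewrite addr0 add0r -!gE.
Qed.

(** * Composition with a vector field *)

Section field_composition.
Context {d : nat} (T : R) (T0 : 0 <= T).
Local Notation rV := 'rV[R]_d.
Local Notation W := (rV * rV)%type.

Definition xdir (w : rV) : W := (w, 0).
Definition vdir (w : rV) : W := (0, w).
Definition basis (j : 'I_d) : rV := delta_mx ord0 j.

Lemma rV_sum_basis (x : rV) : x = \sum_j x ord0 j *: basis j.
Proof. exact: row_sum_delta. Qed.

Lemma vdir_sum (a : 'I_d -> R) :
  \sum_j a j *: vdir (basis j) = vdir (\sum_j a j *: basis j).
Proof.
rewrite (big_morph vdir (id1 := 0) (op1 := +%R))//; last first.
  by move=> x y; rewrite /vdir; congr pair; rewrite /= addr0.
by apply: eq_bigr => j _; congr pair; rewrite /= scaler0.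
Qed.

Lemma C00_field_comp (M : R -> W -> R) (f : R -> rV -> rV) :
  continuous (fun z : R * W => M z.1 z.2) -> C00 T f ->
  C00 T (fun t x => M t (x, f t x)).
Proof.
move=> cM /(C00P T0) cf; apply/(C00P T0) => z.
apply: (@continuous_comp _ _ _ (fun z : R * rV => (clamp T z.1, (z.2, f (clamp T z.1) z.2)))
  (fun z : R * W => M z.1 z.2)); last exact: cM.
apply: (@continuous_pair _ _ _ (fun z : R * rV => clamp T z.1)).
  by apply: continuous_comp; [exact: cvg_fst|exact: clamp_continuous].
apply: (@continuous_pair _ _ _ (fun z : R * rV => z.2)); first exact: cvg_snd.
exact: cf.
Qed.

(** Moving [x] along [w] moves the pair [(x, f t x)] along [xdir w] and, through each coordinate of
    [f], along [vdir (basis j)]. With these d + 1 directions [is_derive_curve] is the chain rule. *)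
Lemma C01_field_comp (M : R -> W -> R) (f : R -> rV -> rV) :
  continuous (fun z : R * W => M z.1 z.2) ->
  (forall w t y, derivable (M t) y w) ->
  (forall w, continuous (fun z : R * W => 'D_w (M z.1) z.2)) ->
  C01 T f -> C01 T (fun t x => M t (x, f t x)).
Proof.
move=> cM dM cdM cf; have cf0 : C00 T f by case: cf.
have cfj := (C01_rVP T0 f).1 cf.
apply: (C01_intro T0 (du := fun w t x => 'D_(xdir w) (M t) (x, f t x) +
  \sum_j 'D_w (fun y => f t y ord0 j) x * 'D_(vdir (basis j)) (M t) (x, f t x))).
- exact: C00_field_comp.
- move=> w t x tT; apply: is_derive_lineP.
  pose g p : W := (p *: w + x, f t (p *: w + x)).
  (* Index 0 carries the direction [xdir w], the lifted indices carry the coordinates of [f]. *)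
  pose e (i : 'I_d.+1) : W := if unlift ord0 i is Some j then vdir (basis j) else xdir w.
  pose c (i : 'I_d.+1) (s : R) : R :=
    if unlift ord0 i is Some j then f t (s *: w + x) ord0 j else s.
  pose c' (i : 'I_d.+1) : R :=
    if unlift ord0 i is Some j then 'D_w (fun y => f t y ord0 j) x else 1.
  have g0 : g 0 = (x, f t x) by rewrite /g scale0r add0r.
  have -> : 'D_(xdir w) (M t) (x, f t x) +
      \sum_j 'D_w (fun y => f t y ord0 j) x * 'D_(vdir (basis j)) (M t) (x, f t x) =
      \sum_i c' i * 'D_(e i) (M t) (g 0).
    rewrite big_ord_recl {1}/e {1}/c' unlift_none mul1r g0; congr (_ + _).
    by apply: eq_bigr => j _; rewrite /e /c' liftK.
  apply: (is_derive_curve (g := g) (c := c)).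
  + by move=> i y; exact: dM.
  + by move=> i; exact: (slice_continuous (k := fun t y => 'D_(e i) (M t) y) (u := t) (cdM (e i))).
  + move=> s; rewrite g0 big_ord_recl /c /e unlift_none subr0.
    under eq_bigr do rewrite liftK scale0r add0r.
    rewrite vdir_sum; congr pair => /=; first by rewrite addr0 addrC.
    rewrite scaler0 add0r [LHS]rV_sum_basis {1}(rV_sum_basis (f t x)) -big_split/=.
    by apply: eq_bigr => j _; rewrite -scalerDl subrKC.
  + move=> i; rewrite /c /c'; case: unliftP => [j _|_]; last exact: is_derive_id.
    rewrite -[in 'D_w _ x](add0r x) -(scale0r w).
    apply: is_derive_line; rewrite scale0r add0r.
    by have [] := C01_derive (cfj j) w x tT.
- move=> w; apply: (C00D T0).
    exact: (C00_field_comp (M := fun t y => 'D_(xdir w) (M t) y)).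
  apply: (C00_sum T0) => j; apply: (C00M T0); first exact: (C01_C00D (cfj j)).
  exact: (C00_field_comp (M := fun t y => 'D_(vdir (basis j)) (M t) y)).
Qed.

End field_composition.

(** * The Hamiltonian and the costs *)

Lemma continuous_sum (T : topologicalType) n (f : 'I_n -> T -> R) (x : T) :
  (forall i, {for x, continuous (f i)}) ->
  {for x, continuous (fun y => \sum_i f i y)}.
Proof.
by move=> cf; apply: cvg_big => [|i _]; [exact: add_continuous|exact: cf].
Qed.

Lemma continuous_scale (T : topologicalType) (c : R) (f : T -> R) (x : T) :
  {for x, continuous f} -> {for x, continuous (fun y => c * f y)}.
Proof. by move=> cf; apply: cvgMl_tmp. Qed.

Section hamiltonian.
Context {d : nat}.
Local Notation rV := 'rV[R]_d.

Lemma norm2_sqr (a : rV) : norm2 a ^+ 2 = dotp a a.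
Proof. by rewrite sqr_sqrtr// sumr_ge0// => i _; rewrite -expr2 sqr_ge0. Qed.

Lemma dotpC (a b : rV) : dotp a b = dotp b a.
Proof. by apply: eq_bigr => i _; rewrite mulrC. Qed.

Lemma dotpDr (a b c : rV) : dotp a (b + c) = dotp a b + dotp a c.
Proof. by rewrite -big_split; apply: eq_bigr => i _; rewrite mxE mulrDr. Qed.

Lemma dotpZr (s : R) (a b : rV) : dotp a (s *: b) = s * dotp a b.
Proof. by rewrite mulr_sumr; apply: eq_bigr => i _; rewrite mxE mulrCA. Qed.

Lemma dotpBr (a b c : rV) : dotp a (b - c) = dotp a b - dotp a c.
Proof. by rewrite dotpDr -scaleN1r dotpZr mulN1r. Qed.

Lemma dotp_basis (a : rV) j : dotp a (basis j) = a ord0 j.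
Proof.
rewrite /dotp (bigD1 j)//= mxE !eqxx mulr1 big1 ?addr0// => i ij.
by rewrite mxE (negbTE ij) andbF mulr0.
Qed.

(** Named so that a linear structure can be attached to it: the differential of the Hamiltonian is
    identified with this linear map. *)
Definition dotp_fun (v : rV) : rV -> R := dotp v.

Lemma dotp_fun_linear v : linear (dotp_fun v).
Proof. by move=> s a b; rewrite /dotp_fun dotpDr dotpZr. Qed.

HB.instance Definition _ v := GRing.isLinear.Build R rV R _ (dotp_fun v) (dotp_fun_linear v).

Lemma dotp_continuous v : continuous (dotp_fun v).
Proof.
move=> x; apply: (@continuous_sum _ _ (fun i (y : rV) => v ord0 i * y ord0 i)) => i.
by apply: continuous_scale; exact: coord_continuous.
Qed.

Lemma dotp_le (a : rV) : dotp a a <= d%:R * `|a| ^+ 2.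
Proof.
have -> : d%:R * `|a| ^+ 2 = \sum_(i < d) `|a| ^+ 2.
  by rewrite sumr_const card_ord mulr_natl.
apply: ler_sum => i _; rewrite -expr2 -[leLHS]real_normK ?num_real//.
by rewrite lerXn2r ?nnegrE//; exact: ((rV_norm_le a (normr_ge0 a)).1 (lexx _)).
Qed.

(** Young's inequality; the right side minus the left is |m a - b|^2 / (2 m). *)
Lemma dotp_young (m : R) (a b : rV) : 0 < m ->
  dotp a b <= m / 2 * dotp a a + (2 * m)^-1 * dotp b b.
Proof.
move=> m0; rewrite !mulr_sumr -big_split/=; apply: ler_sum => i _.
have -> : m / 2 * (a ord0 i * a ord0 i) + (2 * m)^-1 * (b ord0 i * b ord0 i) =
  a ord0 i * b ord0 i + (2 * m)^-1 * (m * a ord0 i - b ord0 i) ^+ 2.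
  by field; rewrite gt_eqF.
by rewrite lerDl mulr_ge0 ?sqr_ge0// invr_ge0 mulr_ge0// ltW.
Qed.

(** The Hamiltonian with [(t, x)] frozen. The hypothesis [lp] below says that [p] is a subgradient
    of [l] at [v], with a quadratic gain of modulus [m]. *)
Definition legendre (l : rV -> R) (q : rV) : R :=
  sup [set dotp w q - l w | w in [set: rV]].

Variables (l : rV -> R) (v p : rV) (m : R).
Hypothesis m0 : 0 < m.
Hypothesis lp : forall w, l v + dotp p (w - v) + m / 2 * dotp (w - v) (w - v) <= l w.
Local Notation H := (legendre l).

(** The quadratic gain in [lp] absorbs the cross term between [w - v] and [q] by Young's inequality,
    which leaves a bound independent of [w]. *)
Lemma legendre_le w q :
  dotp w (p + q) - l w <= dotp v p - l v + dotp v q + (2 * m)^-1 * dotp q q.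
Proof.
have lw := lp w; have := dotp_young (w - v) q m0.
rewrite (dotpC (w - v) q) dotpBr dotpC.
move: lw; rewrite (dotpBr p) (dotpC p w) (dotpC p v) (dotpDr w) (dotpC q v); lra.
Qed.

Lemma legendre_ub q : ubound [set dotp w (p + q) - l w | w in [set: rV]]
   (dotp v p - l v + dotp v q + (2 * m)^-1 * dotp q q).
Proof. by move=> _ [w _ <-]; exact: legendre_le. Qed.

(** The competitor [w = v] gives the lower bound, [legendre_le] the upper one and the finiteness of
    the supremum. The two differ by a multiple of |q|^2, which already means differentiability at
    [p] with gradient [v]. *)
Lemma legendre_bounds q :
  dotp v p - l v + dotp v q <= H (p + q) <=
  dotp v p - l v + dotp v q + (2 * m)^-1 * dotp q q.
Proof.
apply/andP; split; last first.
  by apply: sup_le_ub; [exists (dotp v (p + q) - l v), v|exact: legendre_ub].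
have -> : dotp v p - l v + dotp v q = dotp v (p + q) - l v by rewrite dotpDr addrAC.
apply: ub_le_sup; last by exists v.
by exists (dotp v p - l v + dotp v q + (2 * m)^-1 * dotp q q); exact: legendre_ub.
Qed.

Lemma legendreE : H p = dotp v p - l v.
Proof.
have := legendre_bounds 0; rewrite addr0 -(scale0r p) !dotpZr !mul0r mulr0 !addr0.
by rewrite -eq_le => /eqP.
Qed.

Lemma legendre_expansion :
  (H : rV -> R) \o shift p = cst (H p) + (dotp_fun v : rV -> R) +o_ (0 : rV) id.
Proof.
apply/eqaddoP => _/posnumP[e]; near=> q.
rewrite !fctE/= legendreE (addrC q).
have /andP[h1 h2] := legendre_bounds q.
rewrite ger0_norm; last by move: h1; rewrite /dotp_fun; lra.
(* The factor [d] comes from [dotp_le], since |q| is the sup norm; [d + 1] keeps the divisor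
   positive. *)
have q1 : `|q| <= e%:num * (2 * m) / (d%:R + 1).
  by near: q; apply: (@nbhs0_le R rV); rewrite divr_gt0// ?mulr_gt0// ltr_wpDl.
apply: (@le_trans _ _ ((2 * m)^-1 * (d%:R * `|q| ^+ 2))).
  have im0 : 0 <= (2 * m)^-1 by rewrite invr_ge0 ltW// mulr_gt0.
  by have := ler_wpM2l im0 (dotp_le q); move: h2; rewrite /dotp_fun; lra.
rewrite expr2 !mulrA ler_wpM2r// -mulrA mulrC ler_pdivrMr ?mulr_gt0//.
move: q1; rewrite ler_pdivlMr ?ltr_wpDl// => q1; apply: le_trans q1.
by rewrite mulrC ler_wpM2l// lerDl.
Unshelve. all: by end_near. Qed.

Lemma legendre_diff : differentiable H p /\ grad H p = v.
Proof.
have dE := diff_unique (@dotp_continuous v) legendre_expansion.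
have dH : differentiable H p.
  apply/diff_locallyP; rewrite dE; split; first exact: dotp_continuous.
  exact: legendre_expansion.
split => //; apply/rowP => j; rewrite mxE deriveE// dE.
exact: dotp_basis.
Qed.

End hamiltonian.

(** * Strong convexity and the gradient of the Hamiltonian *)

Section running_cost.
Context {d : nat}.
Local Notation rV := 'rV[R]_d.
Local Notation W := (rV * rV)%type.
Variable L : R -> rV -> rV -> R.
Hypothesis L_regular : regular_running_cost L.
Hypothesis L_convex : strongly_convex_in_v L.

Definition pairL (t : R) (y : W) : R := L t y.1 y.2.

Definition vgrad (t : R) (x v : rV) : rV :=
  \row_j 'D_(vdir (basis j)) (pairL t) (x, v).

Lemma pairL_continuous : continuous (fun z : R * W => pairL z.1 z.2).
Proof. by have [/loc_holder_continuous] := L_regular. Qed.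

Lemma pairL_derivable w t y : derivable (pairL t) y w.
Proof. by have [_ _ _ /(_ w w)[+ _ _ _]] := L_regular; exact. Qed.

Lemma pairL_D_continuous w : continuous (fun z : R * W => 'D_w (pairL z.1) z.2).
Proof. by have [_ _ _ /(_ w w)[_ /loc_holder_continuous + _ _]] := L_regular. Qed.

Lemma pairL_D_derivable w w' t y : derivable ('D_w (pairL t)) y w'.
Proof. by have [_ _ _ /(_ w w')[_ _ + _]] := L_regular; exact. Qed.

Lemma pairL_DD_continuous w w' :
  continuous (fun z : R * W => 'D_w' ('D_w (pairL z.1)) z.2).
Proof. by have [_ _ _ /(_ w w')[_ _ _ /loc_holder_continuous]] := L_regular. Qed.

Lemma is_derive_running_v t x (p : R) (g : R -> rV) (g' : rV) :
  (forall j, is_derive p 1 (fun s => g s ord0 j) (g' ord0 j)) ->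
  is_derive p 1 (fun s => L t x (g s)) (dotp (vgrad t x (g p)) g').
Proof.
move=> dg.
have -> : dotp (vgrad t x (g p)) g' =
    \sum_j g' ord0 j * 'D_(vdir (basis j)) (pairL t) (x, g p).
  by apply: eq_bigr => j _; rewrite mxE mulrC.
apply: (is_derive_curve (u := pairL t) (g := fun s => (x, g s)) (c := fun j s => g s ord0 j)) => //.
- by move=> j y; exact: pairL_derivable.
- move=> j; exact: (slice_continuous (k := fun t y => 'D_(vdir (basis j)) (pairL t) y)
    (u := t) (pairL_D_continuous (w := vdir (basis j)))).
- move=> s; rewrite vdir_sum; congr pair => /=; first by rewrite addr0.
  rewrite [LHS]rV_sum_basis {1}(rV_sum_basis (g p)) -big_split/=.
  by apply: eq_bigr => j _; rewrite -scalerDl subrKC.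
Qed.

(** Strong convexity on the segment from [v] to [w], divided by [s], as s tends to 0. The limit is
    replaced by one small [s] for each tolerance [e]: half of [e] pays for the remainder of the
    derivative, half for the term of first order in [s]. *)
Lemma strong_convexity_subgradient t x : exists2 m : R, 0 < m & forall v w,
  L t x v + dotp (vgrad t x v) (w - v) + m / 2 * dotp (w - v) (w - v) <= L t x w.
Proof.
have [m m0 Hm] := L_convex t x; exists m => // v w.
apply/ler_addgt0Pr => e e0.
have e20 : 0 < e / 2 by rewrite divr_gt0.
set q := dotp (w - v) (w - v).
have q0 : 0 <= q by rewrite /q -norm2_sqr sqr_ge0.
have D : is_derive (0 : R) 1 (fun s => L t x (v + s *: (w - v))) (dotp (vgrad t x v) (w - v)).
  have := @is_derive_running_v t x 0 (fun s => v + s *: (w - v)) (w - v).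
  rewrite scale0r addr0; apply => j.
  apply/is_derive1P => e' e'0; near=> h.
  rewrite !mxE [X in `|X|](_ : _ = 0); last by ring.
  by rewrite normr0 mulr_ge0// ltW.
have {}D := (is_derive1P _ _ _).1 D _ e20.
have [s [s0 s1 sq sD]] : exists s : R, [/\ 0 < s, s <= 1, m / 2 * s * q <= e / 2 &
    `|L t x (v + s *: (w - v)) - L t x v - s * dotp (vgrad t x v) (w - v)| <= e / 2 * s].
  move/nbhs_normP : D => [r /= r0 rD].
  (* In turn: within the range of the derivative estimate, at most 1 for convexity, and small enough
     for m / 2 s q <= e / 2. *)
  pose s := Num.min (r / 2) (Num.min 1 (e / 2 / (m / 2 * q + 1))).
  have c0 : 0 < m / 2 * q + 1 by rewrite ltr_wpDl// mulr_ge0// divr_ge0// ltW.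
  have s0 : 0 < s by rewrite !lt_min ltr01 !divr_gt0.
  have s1 : s <= 1 by rewrite !ge_min lexx/= orbT.
  have s2 : s <= r / 2 by rewrite ge_min lexx.
  have s3 : s <= e / 2 / (m / 2 * q + 1) by rewrite !ge_min lexx !orbT.
  exists s; split => //.
    move: s3; rewrite ler_pdivlMr// => s3; apply: le_trans s3; nra.
  have := rD s; rewrite /= sub0r normrN gtr0_norm// addr0 scale0r addr0; apply; lra.
have := Hm w v s; rewrite (ltW s0) s1 => /(_ isT).
rewrite norm2_sqr -/q.
have -> : s *: w + (1 - s) *: v = v + s *: (w - v).
  by rewrite scalerBl scale1r scalerBr addrCA addrA.
move: sD; rewrite ler_norml => /andP[sD _] HL.
rewrite -(ler_pM2l s0); nra.
Unshelve. all: by end_near. Qed.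

(** Legendre duality: D_p H inverts the map from [v] to D_v L, because the subgradient inequality is
    the hypothesis [lp] with D_v L as slope. *)
Lemma hamiltonian_vgrad t x v :
  differentiable (hamiltonian L t x) (vgrad t x v) /\ DpH L t x (vgrad t x v) = v.
Proof.
have [m m0 Hm] := strong_convexity_subgradient t x.
exact: (legendre_diff m0 (Hm v)).
Qed.

End running_cost.

(** * Density-dependent costs *)

Section density_costs.
Context {d : nat}.
Local Notation rV := 'rV[R]_d.
Local Notation W := (rV * R)%type.

Lemma is_derive_snd (u : W -> R) (x : rV) (r l : R) :
  is_derive (x, r) ((0, 1) : W) u l -> is_derive r 1 (fun s => u (x, s)) l.
Proof.
move=> /is_deriveP H; apply/is_derive1P => e /H; apply: filterS => h.
suff -> : h *: ((0, 1) : W) + (x, r) = (x, h + r) by [].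
by congr pair; rewrite /= ?scaler0 ?add0r// [_ *: _]mulr1.
Qed.

Variable F : R -> rV -> R -> R.
Hypothesis F_regular : regular_density_cost F.
Local Notation pairF := (fun (t : R) (z : W) => F t z.1 z.2).

Lemma density_cost_continuous : continuous (fun z : R * W => F z.1 z.2.1 z.2.2).
Proof. by have [/loc_holder_continuous] := F_regular. Qed.

(** The first part guarantees that the [derive1] in [Ftilde] is a genuine derivative; the product
    rule form in the second part is the source of its joint continuity. *)
Lemma is_derive_Ftilde t x (r : R) :
  is_derive r 1 (fun s => F t x s * s) (Ftilde F t x r) /\
  Ftilde F t x r = F t x r + r * 'D_((0, 1) : W) (pairF t) (x, r).
Proof.
have [_ _ _ /(_ (0, 1) (0, 1))[/(_ t (x, r)) /derivableP/is_derive_snd/= dF _ _ _]] := F_regular.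
have H : is_derive r 1 (fun s => F t x s * s) (F t x r + r * 'D_((0, 1) : W) (pairF t) (x, r)).
  by have := is_deriveM dF (is_derive_id r 1); rewrite [F t x r *: 1]mulr1.
by rewrite /Ftilde derive1E; have [dH DH] := H; split => //; apply/derivableP.
Qed.

Lemma Ftilde_continuous : continuous (fun z : R * W => Ftilde F z.1 z.2.1 z.2.2).
Proof.
have [_ _ _ /(_ (0, 1) (0, 1))[_ /loc_holder_continuous cD _ _]] := F_regular.
have -> : (fun z : R * W => Ftilde F z.1 z.2.1 z.2.2) =
    (fun z => F z.1 z.2.1 z.2.2 + z.2.2 * 'D_((0, 1) : W) (pairF z.1) z.2).
  by apply/funext => -[t [x r]] /=; have [_ ->] := is_derive_Ftilde t x r.
move=> z; apply: cvgD; first exact: density_cost_continuous.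
apply: cvgM; last exact: cD.
by apply: continuous_comp; [exact: cvg_snd|exact: cvg_snd].
Qed.

Variable G : rV -> R -> R.
Hypothesis G_regular : regular_terminal_cost G.

Lemma terminal_cost_continuous : continuous (fun z : W => G z.1 z.2).
Proof. by have [/loc_holder_continuous] := G_regular. Qed.

Lemma is_derive_Gtilde x (r : R) :
  is_derive r 1 (fun s => G x s * s) (Gtilde G x r) /\
  Gtilde G x r = G x r + r * 'D_((0, 1) : W) (fun z => G z.1 z.2) (x, r).
Proof.
have [_ /(_ (0, 1) (0, 1))[/(_ (x, r)) /derivableP/is_derive_snd/= dG _ _ _]] := G_regular.
have E : Gtilde G x r = G x r + r * 'D_((0, 1) : W) (fun z => G z.1 z.2) (x, r).
  by rewrite /Gtilde derive1E; have [_ ->] := dG; rewrite addrC mulrC.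
split => //; rewrite E.
by have := is_deriveM dG (is_derive_id r 1); rewrite [G x r *: 1]mulr1.
Qed.

Lemma Gtilde_continuous : continuous (fun z : W => Gtilde G z.1 z.2).
Proof.
have [_ /(_ (0, 1) (0, 1))[_ /loc_holder_continuous cD _ _]] := G_regular.
have -> : (fun z : W => Gtilde G z.1 z.2) =
    (fun z => G z.1 z.2 + z.2 * 'D_((0, 1) : W) (fun z => G z.1 z.2) z).
  by apply/funext => -[x r] /=; have [_ ->] := is_derive_Gtilde x r.
move=> z; apply: cvgD; first exact: terminal_cost_continuous.
by apply: cvgM; [exact: cvg_snd|exact: cD].
Qed.

End density_costs.

Lemma KintE d (X : measurableType d) (mu : {measure set X -> \bar R})
    (V : topologicalType) (iota : X -> V) (K : set V) (h : V -> R) :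
  compact_domain mu iota K -> continuous h ->
  (\int[mu]_(x in iota @^-1` K) (h (iota x))%:E = (Kint mu iota K h)%:E)%E.
Proof.
move=> dom ch; have [_ mK _ _] := dom; rewrite /Kint fineK//.
by apply: integrable_fin_num => //; exact: (Kint_integrable dom ch).
Qed.

(** * Fubini on [0, T] x R^d *)

Section fubini_slab.
Context {d : nat} (T : R).
Local Notation rV := 'rV[R]_d.
Local Notation mT := (d.-tuple (measurableTypeR R)).
Local Notation nu := (leb \x lebesgue_tuple d)%E.
Local Notation slab := (`[0%R, T]%classic `*` [set: mT]).

Lemma measurable_slab : measurable (slab : set (measurableTypeR R * mT)).
Proof. by apply: measurableX => //; exact: measurable_itv. Qed.

(** The cost is an iterated integral, while admissibility speaks of integrability on the product.
    Extending by 0 outside the slab brings Fubini on the full product to bear. *)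
Lemma fubini_slab (k : R -> rV -> R) :
  nu.-integrable slab (fun z => (k z.1 (vec_of z.2))%:E) ->
  (\int[leb]_(t in `[0%R, T]) integral_Rd (k t) =
   \int[nu]_(z in slab) (k z.1 (vec_of z.2))%:E)%E.
Proof.
pose k' (z : measurableTypeR R * mT) : \bar R := (k z.1 (vec_of z.2))%:E.
move=> ik.
have ik' : nu.-integrable setT (k' \_ slab).
  exact: (iffLR (@integrable_mkcond _ _ R nu _ k' measurable_slab) ik).
rewrite [RHS]integral_mkcond -(integral12_prod_meas1 ik') [LHS]integral_mkcond.
apply: eq_integral => t _; rewrite patchE; case: ifPn => [|/negP] tT.
  apply: eq_integral => x _; rewrite patchE mem_set//; split => //.
  by move: tT; rewrite inE.
rewrite [RHS]integral0_eq// => x _; rewrite patchE memNset// => -[/= H _].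
by apply: tT; rewrite inE.
Qed.

Lemma Kint_fubini (r : R) (k : R * rV -> R) : 0 <= r -> continuous k ->
  (forall t x, 0 <= t <= T -> ~ cube 0 r x -> k (t, x) = 0) ->
  Kint nu (fun z => (z.1, vec_of z.2)) (`[0, T] `*` cube 0 r) k =
  Kint leb id `[0, T] (fun t => Kint (lebesgue_tuple d) vec_of (cube 0 r) (fun x => k (t, x))).
Proof.
move=> r0 ck k0.
have dom := domain_spacetime (n := d) 0 T 0 r0.
have sub : (fun z : R * mT => (z.1, vec_of z.2)) @^-1` (`[0, T] `*` cube 0 r) `<=` slab.
  by move=> z [].
have [|ik E] := Kint_supp dom measurable_slab sub ck.
  move=> z [/= zT _] zK; apply: k0; first by move: zT; rewrite in_itv.
  by move=> zc; apply: zK; split.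
apply: EFin_inj; rewrite -[LHS]E -[LHS](fubini_slab (k := fun t x => k (t, x)) ik).
have cK t : continuous (fun x => k (t, x)).
  by move=> x; apply: continuous_comp; [apply: continuous_pair; [exact: cst_continuous|exact: cvg_id]|exact: ck].
have cI : continuous (fun t => Kint (lebesgue_tuple d) vec_of (cube 0 r) (fun x => k (t, x))).
  move=> t; apply: (Kint_continuous (domain_cube 0 r0) (h := fun t x => k (t, x))).
    by near=> s; exact: cK.
  by move=> x _; rewrite /prop_for /continuous_at; under eq_fun do rewrite -surjective_pairing; exact: ck.
rewrite -[RHS](KintE (domain_itv 0 T) cI).
rewrite preimage_id; apply: eq_integral => t /[!inE] /= tT.
have [|_ E'] := Kint_supp (domain_cube 0 r0) measurableT (@subsetT _ _) (cK t).
  by move=> x _ xc; apply: k0 => //; move: tT; rewrite in_itv.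
exact: E'.
Unshelve. all: by end_near. Qed.

End fubini_slab.

Section pointwise_continuity.
Context {Y : topologicalType}.
Implicit Types (a b : Y -> R) (y : Y).

Lemma continuous_add a b y : {for y, continuous a} -> {for y, continuous b} ->
  {for y, continuous (fun z => a z + b z)}.
Proof. by move=> ca cb; exact: cvgD. Qed.

Lemma continuous_mul a b y : {for y, continuous a} -> {for y, continuous b} ->
  {for y, continuous (fun z => a z * b z)}.
Proof. by move=> ca cb; exact: cvgM. Qed.

Lemma continuous_inv a y : a y != 0 -> {for y, continuous a} ->
  {for y, continuous (fun z => (a z)^-1)}.
Proof. by move=> a0 ca; exact: cvgV. Qed.

Lemma continuous_sub a b y : {for y, continuous a} -> {for y, continuous b} ->
  {for y, continuous (fun z => a z - b z)}.
Proof. by move=> ca cb; exact: cvgB. Qed.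

Lemma continuous_dotp n (a b : Y -> 'rV[R]_n) y :
  {for y, continuous a} -> {for y, continuous b} ->
  {for y, continuous (fun z => dotp (a z) (b z))}.
Proof.
move=> /rV_continuousP ca /rV_continuousP cb.
by apply: (@continuous_sum _ _ (fun i z => a z ord0 i * b z ord0 i)) => i; apply: continuous_mul.
Qed.

End pointwise_continuity.

Section composed_regularity.
Context {d : nat} (T : R) (T0 : 0 <= T).
Local Notation rV := 'rV[R]_d.

Lemma C01_sep (th : R -> R) (g : rV -> R) : continuous th ->
  C01 T (fun _ : R => g) -> C01 T (fun t x => th t * g x).
Proof.
move=> cth cg; apply: (C01_intro T0 (du := fun w t x => th t * 'D_w g x)).
- by apply: C00M => //; [exact: C00_time|exact: C01_C00].
- move=> w t x tT; apply: is_deriveZ; exact: (C01_derive cg w x tT).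
- move=> w; apply: (C00M T0 (u := fun t _ => th t) (v := fun _ => 'D_w g)).
    exact: C00_time.
  exact: (C01_C00D (u := fun=> g)) cg.
Qed.

Lemma is_derive_inv (s : R) : s != 0 -> is_derive s 1 (fun s => s^-1) (- (s ^+ 2)^-1).
Proof.
move=> s0; have := is_deriveV s0 (is_derive_id s 1).
by rewrite [X in is_derive _ _ _ X -> _]mulr1.
Qed.

Lemma C01_inv (u : R -> rV -> R) : (forall t x, 0 <= t <= T -> 0 < u t x) ->
  C01 T u -> C01 T (fun t x => (u t x)^-1).
Proof.
move=> u0 cu; apply: (C01_comp T0 (phi := fun s => s^-1) (phi' := fun s => - (s ^+ 2)^-1) cu).
- by move=> t x tT; apply: is_derive_inv; rewrite gt_eqF// u0.
- move=> t x tT; apply: cvgN; apply: cvgV.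
    by rewrite expf_neq0// gt_eqF// u0.
  exact: exprn_continuous.
Qed.

Lemma C12_ln (u : R -> rV -> R) : (forall t x, 0 <= t <= T -> 0 < u t x) ->
  C12 T u -> C12 T (fun t x => ln (u t x)).
Proof.
move=> u0 cu; apply: (C12_comp T0 (phi := @ln R) (phi' := fun s => s^-1)
  (phi'' := fun s => - (s ^+ 2)^-1) cu).
- by move=> t x tT; apply: is_derive1_ln; exact: u0.
- by move=> t x tT; apply: is_derive_inv; rewrite gt_eqF// u0.
- move=> t x tT; apply: cvgN; apply: cvgV.
    by rewrite expf_neq0// gt_eqF// u0.
  exact: exprn_continuous.
Qed.

Lemma derive_ln (u : R -> rV -> R) t x w : C01 T u -> 0 <= t <= T -> 0 < u t x ->
  'D_w (fun y => ln (u t y)) x = (u t x)^-1 * 'D_w (u t) x.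
Proof.
move=> cu tT u0.
by have [_ ->] := is_derive_comp1 (C01_derive cu w x tT) (is_derive1_ln u0).
Qed.

End composed_regularity.

(** * First variation of the cost *)

Section variation.
Context {d : nat} (T gamma : R) (T0 : 0 <= T).
Local Notation rV := 'rV[R]_d.
Local Notation Y := (R * (R * rV))%type.
Variables (f : R -> rV -> rV) (rho : R -> rV -> R).
Hypothesis rho_C12 : C12 T rho.
Hypothesis f_C01 : C01 T f.
Hypothesis rho_gt0 : forall t x, 0 <= t <= T -> 0 < rho t x.
Variables (i : 'I_d) (th th' : R -> R) (chi sg : rV -> R) (M : R).
Hypothesis M0 : 0 <= M.
Hypothesis dth : forall t : R, is_derive t 1 th (th' t).
Hypothesis cth' : continuous th'.
Hypothesis th0 : th 0 = 0.
Hypothesis chi_C01 : C01 T (fun _ : R => chi).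
Hypothesis sg_C12 : C12 T (fun _ : R => sg).
Hypothesis dchi : forall x, is_derive x (basis i) chi (sg x).
Hypothesis chi0 : forall x, ~ cube 0 M x -> chi x = 0.
Hypothesis sg0 : forall x, ~ cube 0 M x -> sg x = 0.

Definition velocity (t : R) (x : rV) : rV := f t x + gamma *: score rho t x.

(** The sign serves the constraint: the time derivative - th' sg of this variation cancels the
    divergence th' D_i chi of the variation of rho f. *)
Definition dens_var (t : R) (x : rV) : R := - th t * sg x.

(** The variation of rho v, not of rho f: as rho times the score is grad rho, the flux rho v equals
    rho f + gamma grad rho, and varying the density adds the second term. *)
Definition flux_var (t : R) (x : rV) : rV :=
  (th' t * chi x) *: basis i + gamma *: grad (dens_var t) x.

Definition dens_at (e t : R) (x : rV) : R := rho t x + e * dens_var t x.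

(* The perturbed flux divided by the perturbed density. *)
Definition ctrl_at (e t : R) (x : rV) : rV :=
  (dens_at e t x)^-1 *: (rho t x *: f t x + (e * (th' t * chi x)) *: basis i).

(** Because grad rho is linear in the density, the perturbed flux rho v is affine in [e]. By
    [ctrl_at_velocity] the quotient is the perturbed control plus gamma times the perturbed
    score. *)
Definition vel_at (e t : R) (x : rV) : rV :=
  (dens_at e t x)^-1 *: (rho t x *: velocity t x + e *: flux_var t x).

Let rho_C01 : C01 T rho := C12_C01 rho_C12.

Lemma dens_var_C12 : C12 T dens_var.
Proof.
apply: (C12_sep T0 (th := fun t => - th t) (th' := fun t => - th' t) _ _ sg_C12).
by move=> t; apply: cvgN; exact: cth'.
Qed.

Lemma dens_at_C12 e : C12 T (dens_at e).
Proof.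
apply: (C12D T0 rho_C12).
have -> : (fun t x => e * dens_var t x) = (fun t x => (e * - th t) * sg x).
  by apply/funext => t; apply/funext => x; rewrite mulrA.
apply: (C12_sep T0 (th := fun t => e * - th t) (th' := fun t => e * - th' t) _ _ sg_C12).
by move=> t; apply: (@continuous_scale R e (fun t => - th' t) t); apply: cvgN; exact: cth'.
Qed.

Lemma velocity_C01 j : C01 T (fun t x => velocity t x ord0 j).
Proof.
apply: (eq_C01 T0 (u := fun t x => f t x ord0 j + gamma * 'D_(basis j) (fun y => ln (rho t y)) x)).
  by move=> t tT x; rewrite !mxE.
apply: (C01D T0); first exact: ((C01_rVP T0 f).1 f_C01 j).
apply: (C01M T0); first exact: C01_cst.
exact: (C12_C01D (basis j) (C12_ln T0 rho_gt0 rho_C12)).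
Qed.

Lemma flux_var_C00 j : C00 T (fun t x => flux_var t x ord0 j).
Proof.
apply: (eq_C00 T0 (u := fun t x => th' t * chi x * (basis i) ord0 j + gamma * 'D_(basis j) (dens_var t) x)).
  by move=> t tT x; rewrite !mxE.
apply: (C00D T0).
  apply: (C00M T0); last exact: C00_cst.
  by apply: (C00M T0); [exact: C00_time|exact: (C01_C00 chi_C01)].
apply: (C00M T0); first exact: C00_cst.
exact: (C01_C00D (C12_C01 dens_var_C12)).
Qed.

Lemma dens_var0 t x : ~ cube 0 M x -> dens_var t x = 0.
Proof. by move=> xM; rewrite /dens_var sg0// mulr0. Qed.

(** No positive lower bound for [rho] on the whole space is at hand. The quotient of [dens_var] by
    [rho] is bounded on the compact set [0, T] x cube, and outside the cube the density is
    unchanged. *)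
Lemma dens_at_gt0 : exists2 e0 : R, 0 < e0 & forall e, `|e| < e0 ->
  forall t x, 0 <= t <= T -> 0 < dens_at e t x.
Proof.
have /(C00P T0) cq : C00 T (fun t x => dens_var t x * (rho t x)^-1).
  apply: (C00M T0); first exact: (C01_C00 (C12_C01 dens_var_C12)).
  exact: (C01_C00 (C01_inv T0 rho_gt0 rho_C01)).
have [c Hc] := continuous_compact_bounded (domain_spacetime 0 T 0 M0) cq.
have c1 : 0 < `|c| + 1 by rewrite ltr_wpDl.
exists (`|c| + 1)^-1; first by rewrite invr_gt0.
move=> e ee t x tT; rewrite /dens_at.
have r0 := rho_gt0 x tT.
have [xM|xM] := pselect (cube 0 M x); last by rewrite dens_var0// mulr0 addr0.
have /= := Hc (t, x); rewrite clamp_id// => /(_ _).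
have tx : (`[0, T]%classic `*` cube 0 M) (t, x) by split => //=; rewrite in_itv.
move=> /(_ tx); rewrite normrM normfV (gtr0_norm r0) ler_pdivrMr// => sr.
have {}sr : `|dens_var t x| <= (`|c| + 1) * rho t x.
  apply: (le_trans sr); apply: ler_wpM2r; first exact: ltW.
  by rewrite (le_trans (ler_norm c))// lerDl.
have : `|e * dens_var t x| < rho t x.
  rewrite normrM (le_lt_trans (ler_wpM2l (normr_ge0 e) sr))// mulrA gtr_pMl//.
  by rewrite -ltr_pdivlMr// div1r.
by rewrite ltr_norml => /andP[+ _]; lra.
Qed.

(** * The perturbed pair satisfies the constraint *)

Section fixed_eps.
Variable e : R.
Hypothesis e_pos : forall t x, 0 <= t <= T -> 0 < dens_at e t x.

Lemma D_dens_at t x w : 0 <= t <= T ->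
  'D_w (dens_at e t) x = 'D_w (rho t) x + e * 'D_w (dens_var t) x.
Proof.
move=> tT; have d1 := C01_derive rho_C01 w x tT.
have d2 := C01_derive (C12_C01 dens_var_C12) w x tT.
by have [_ ->] := is_deriveD d1 (is_deriveZ e d2).
Qed.

Lemma ctrl_at_velocity t x : 0 <= t <= T ->
  ctrl_at e t x + gamma *: score (dens_at e) t x = vel_at e t x.
Proof.
move=> tT; have p1 := e_pos x tT; have p0 := rho_gt0 x tT.
apply/rowP => j; rewrite /ctrl_at /vel_at /velocity /flux_var !mxE.
rewrite (derive_ln _ (C12_C01 (dens_at_C12 e)) tT p1) (derive_ln _ rho_C01 tT p0).
by rewrite D_dens_at//; field; rewrite !gt_eqF.
Qed.

Lemma ctrl_at_C01 : C01 T (ctrl_at e).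
Proof.
apply/(C01_rVP T0) => j.
apply: (eq_C01 T0 (u := fun t x => (dens_at e t x)^-1 *
  (rho t x * f t x ord0 j + e * (th' t * chi x) * (basis i) ord0 j))).
  by move=> t tT x; rewrite !mxE.
apply: (C01M T0); first by apply: (C01_inv T0 e_pos); exact: C12_C01 (dens_at_C12 e).
apply: (C01D T0); first exact: (C01M T0 rho_C01 ((C01_rVP T0 f).1 f_C01 j)).
apply: (C01M T0); last exact: (C01_cst T0).
exact: (C01M T0 (C01_cst T0 e) (C01_sep T0 cth' chi_C01)).
Qed.

Lemma flux_at t x : 0 <= t <= T -> dens_at e t x *: ctrl_at e t x =
  rho t x *: f t x + (e * (th' t * chi x)) *: basis i.
Proof. by move=> tT; rewrite scalerA divff ?scale1r// gt_eqF// e_pos. Qed.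

Lemma continuity_at t x : 0 < t < T ->
  derive1 (rho ^~ x) t + divg (fun y => rho t y *: f t y) x = 0 ->
  derive1 (dens_at e ^~ x) t + divg (fun y => dens_at e t y *: ctrl_at e t y) x = 0.
Proof.
move=> tT <-; have tT' := interior_itv tT.
have -> : (fun y => dens_at e t y *: ctrl_at e t y) =
    (fun y => rho t y *: f t y + (e * (th' t * chi y)) *: basis i).
  by apply/funext => y; exact: flux_at.
have -> : divg (fun y => rho t y *: f t y + (e * (th' t * chi y)) *: basis i) x =
    divg (fun y => rho t y *: f t y) x + e * (th' t * sg x).
  rewrite /divg.
  have -> : e * (th' t * sg x) = \sum_j e * (th' t * 'D_(basis j) chi x) * basis i ord0 j.
    rewrite (bigD1 i)//= [X in _ + X]big1 ?addr0.
      by rewrite mxE !eqxx mulr1; have [_ ->] := dchi x.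
    by move=> j ji; rewrite mxE (negbTE ji) andbF mulr0.
  rewrite -big_split/=; apply: eq_bigr => j _.
  have d1 : is_derive x (basis j) (fun y => (rho t y *: f t y) ord0 j)
      ('D_(basis j) (fun y => (rho t y *: f t y) ord0 j) x).
    apply: (C01_derive (u := fun t y => (rho t y *: f t y) ord0 j) _ _ _ tT').
    apply: (eq_C01 T0 (u := fun t y => rho t y * f t y ord0 j)).
      by move=> s sT y; rewrite mxE.
    exact: (C01M T0 rho_C01 ((C01_rVP T0 f).1 f_C01 j)).
  have d2 := C01_derive chi_C01 (basis j) x tT'.
  have := is_deriveD d1 (is_deriveZ (basis i ord0 j) (is_deriveZ e (is_deriveZ (th' t) d2))).
  move=> [_]; rewrite [X in _ = _ + X -> _]mulrC => <-; congr ('D_ _ _ _).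
  apply/funext => y; transitivity ((rho t y *: f t y) ord0 j +
    basis i ord0 j * (e * (th' t * chi y))); last by [].
  by rewrite [LHS]mxE; congr (_ + _); rewrite mxE mulrC.
have -> : derive1 (dens_at e ^~ x) t = derive1 (rho ^~ x) t + e * (- th' t * sg x).
  have d1 := C12_time x rho_C12 tT.
  have d2 : is_derive t 1 (dens_var ^~ x) (- th' t * sg x).
    rewrite /dens_var mulrC; under eq_fun do rewrite mulrC.
    exact: (is_deriveZ (sg x) (is_deriveN (dth t))).
  by rewrite derive1E; have [_ ->] := is_deriveD d1 (is_deriveZ e d2).
by ring.
Qed.

(** Mass is preserved because [sg] is a partial derivative of the compactly supported [chi] and so
    has integral 0; [e_pos] gives the sign. *)
Lemma prob_density_at t : 0 <= t <= T -> prob_density (rho t) -> prob_density (dens_at e t).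
Proof.
move=> tT [r_ge0 mr r1].
have csg : continuous sg.
  move=> x; have /(C00P T0) H := C01_C00 (C12_C01 sg_C12).
  exact: (slice_continuous (k := fun (_ : R) y => sg y) (u := 0) H).
pose c := e * - th t.
have E x : dens_at e t x = rho t x + c * sg x by rewrite /dens_at /dens_var mulrA.
have csg' : continuous (fun x => c * sg x).
  by move=> x; apply: (@continuous_scale rV c sg x); exact: csg.
have c0 x : ~ cube 0 M x -> c * sg x = 0 by move=> /sg0 ->; rewrite mulr0.
have I0 : integral_Rd (fun x => c * sg x) = 0%E.
  apply: (integral_partial_eq0 (j := i) (h := fun x => c * chi x) M0 csg') => //.
  by move=> x /chi0 ->; rewrite mulr0.
have [isg _] := Kint_supp (domain_cube 0 M0) measurableT (@subsetT _ _) csg' (fun x _ => c0 (vec_of x)).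
have ir : (lebesgue_tuple d).-integrable setT (fun x => (rho t (vec_of x))%:E).
  apply/integrableP; split; first exact/measurable_EFinP.
  under eq_integral do rewrite gee0_abs ?lee_fin//.
  by rewrite [ltLHS]r1 ltry.
split.
- by move=> x; rewrite ltW// e_pos.
- under eq_fun do rewrite E; apply: measurable_funD => //.
  exact: measurable_fun_vec_of csg'.
- rewrite /integral_Rd; under eq_integral do rewrite E EFinD.
  rewrite [LHS]integralD// [X in (X + _)%E]r1 [X in (_ + X)%E]I0 adde0//.
Qed.

End fixed_eps.

(** * Derivative of the perturbed cost densities *)

Variables (L : R -> rV -> rV -> R) (F : R -> rV -> R -> R) (G : rV -> R -> R).
Hypothesis L_regular : regular_running_cost L.
Hypothesis F_regular : regular_density_cost F.
Hypothesis G_regular : regular_terminal_cost G.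

Definition run_at (e t : R) (x : rV) : R :=
  (L t x (vel_at e t x) + F t x (dens_at e t x)) * dens_at e t x.

(** The velocity varies at rate (flux_var - dens_var vel_at) / dens_at. The weight [dens_at] in the
    cost cancels this denominator, so no quotient is left in front of the momentum term. *)
Definition run_der (e t : R) (x : rV) : R :=
  dotp (vgrad L t x (vel_at e t x)) (flux_var t x - dens_var t x *: vel_at e t x)
  + (L t x (vel_at e t x) + Ftilde F t x (dens_at e t x)) * dens_var t x.

Definition term_at (e : R) (x : rV) : R := G x (dens_at e T x) * dens_at e T x.

Lemma dens_at0 t x : dens_at 0 t x = rho t x.
Proof. by rewrite /dens_at mul0r addr0. Qed.

Lemma vel_at0 t x : 0 <= t <= T -> vel_at 0 t x = velocity t x.
Proof.
by move=> tT; rewrite /vel_at dens_at0 scale0r addr0 scalerA mulVf ?scale1r// gt_eqF// rho_gt0.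
Qed.

Lemma running_at e t x : (forall t x, 0 <= t <= T -> 0 < dens_at e t x) -> 0 <= t <= T ->
  running L F gamma (ctrl_at e) (dens_at e) t x = run_at e t x.
Proof. by move=> e_pos tT; rewrite /running ctrl_at_velocity. Qed.

Lemma running_at0 t x : 0 <= t <= T -> running L F gamma f rho t x = run_at 0 t x.
Proof. by move=> tT; rewrite /run_at vel_at0// dens_at0. Qed.

Lemma is_derive_dens_at (e : R) t x : is_derive e 1 (fun s => dens_at s t x) (dens_var t x).
Proof.
apply/is_derive1P => eps eps0; near=> h.
rewrite /dens_at [X in `|X|](_ : _ = 0); last by ring.
by rewrite normr0 mulr_ge0// ltW.
Unshelve. all: by end_near. Qed.

Lemma vel_at_coord e t x j : vel_at e t x ord0 j =
  (dens_at e t x)^-1 * (rho t x * velocity t x ord0 j + e * flux_var t x ord0 j).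
Proof.
by rewrite /vel_at; move: (velocity t x) (flux_var t x) => v w; rewrite !mxE.
Qed.

Lemma is_derive_vel_at (e : R) t x j : 0 < dens_at e t x ->
  is_derive e 1 (fun s => vel_at s t x ord0 j)
    (((dens_at e t x)^-1 *: (flux_var t x - dens_var t x *: vel_at e t x)) ord0 j).
Proof.
move=> p0; have p0' : dens_at e t x != 0 by rewrite gt_eqF.
pose a := rho t x * velocity t x ord0 j; pose b := flux_var t x ord0 j.
have d1 : is_derive e 1 (fun s => (dens_at s t x)^-1) (- (dens_at e t x ^+ 2)^-1 * dens_var t x).
  exact: (is_derive_comp1 (is_derive_dens_at e t x) (is_derive_inv p0')).
have d2 : is_derive e 1 (fun s => a + s * b) b.
  apply/is_derive1P => eps eps0; near=> h.
  rewrite [X in `|X|](_ : _ = 0); last by ring.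
  by rewrite normr0 mulr_ge0// ltW.
have := is_deriveMx d1 d2.
have -> : (fun s => (dens_at s t x)^-1 * (a + s * b)) = (fun s => vel_at s t x ord0 j).
  by apply/funext => s; rewrite vel_at_coord.
suff -> : (dens_at e t x)^-1 * b + (a + e * b) * (- (dens_at e t x ^+ 2)^-1 * dens_var t x) =
  ((dens_at e t x)^-1 *: (flux_var t x - dens_var t x *: vel_at e t x)) ord0 j by [].
have -> : ((dens_at e t x)^-1 *: (flux_var t x - dens_var t x *: vel_at e t x)) ord0 j =
    (dens_at e t x)^-1 * (b - dens_var t x * vel_at e t x ord0 j).
  by rewrite /b; move: (flux_var t x) (vel_at e t x) => v w; rewrite !mxE.
rewrite vel_at_coord -/a -/b.
by field.
Unshelve. all: by end_near. Qed.

Lemma is_derive_run_at (e : R) t x : 0 < dens_at e t x ->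
  is_derive e 1 (fun s => run_at s t x) (run_der e t x).
Proof.
move=> p0; have p0' : dens_at e t x != 0 by rewrite gt_eqF.
have dL := is_derive_running_v L_regular t x (fun j => is_derive_vel_at j p0).
have [dF _] := is_derive_Ftilde F_regular t x (dens_at e t x).
have dd := is_derive_dens_at e t x.
have d1 := is_deriveM dL dd.
have d2 := is_derive_comp1 dd dF.
have := is_deriveD d1 d2; rewrite dotpZr.
have -> : (fun s => L t x (vel_at s t x)) * (fun s => dens_at s t x) +
   (fun s => F t x (dens_at s t x) * dens_at s t x) = (fun s => run_at s t x).
  by apply/funext => s; rewrite /run_at mulrDl.
suff -> : L t x (vel_at e t x) *: dens_var t x +
   dens_at e t x *: ((dens_at e t x)^-1 *
     dotp (vgrad L t x (vel_at e t x)) (flux_var t x - dens_var t x *: vel_at e t x)) +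
   Ftilde F t x (dens_at e t x) * dens_var t x = run_der e t x by [].
rewrite /run_der; set D := dotp _ _.
have sE (a b : R) : a *: b = a * b by [].
by rewrite !sE; field.
Qed.

Lemma is_derive_term_at (e : R) x :
  is_derive e 1 (fun s => term_at s x) (Gtilde G x (dens_at e T x) * dens_var T x).
Proof.
have [dG _] := is_derive_Gtilde G_regular x (dens_at e T x).
exact: (is_derive_comp1 (is_derive_dens_at e T x) dG).
Qed.

(** The cube is closed, so a function that vanishes off it vanishes near each outside point, and so
    do its derivatives there. *)
Lemma cube_near x : ~ cube 0 M x -> \forall y \near x, ~ cube (0 : rV) M y.
Proof.
move=> xM; have oC : open (~` cube (0 : rV) M).
  by apply: closed_openC; apply: compact_closed; [exact: norm_hausdorff|exact: compact_cube].
by apply: (@open_nbhs_nbhs _ x (~` cube (0 : rV) M)); split.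
Qed.

Lemma flux_var0 t x : ~ cube 0 M x -> flux_var t x = 0.
Proof.
move=> xM; rewrite /flux_var chi0// mulr0 scale0r add0r.
suff -> : grad (dens_var t) x = 0 by rewrite scaler0.
apply/rowP => j; rewrite !mxE.
rewrite (@near_eq_derive _ _ _ _ (cst 0)) ?derive_cst//.
by move: (cube_near xM); apply: filterS => y /dens_var0 ->.
Qed.

Lemma run_at_out e t x : ~ cube 0 M x -> run_at e t x = run_at 0 t x.
Proof.
move=> xM; rewrite /run_at /vel_at /dens_at dens_var0// flux_var0//.
by rewrite !mulr0 !scaler0.
Qed.

Lemma run_der_out e t x : ~ cube 0 M x -> run_der e t x = 0.
Proof.
move=> xM; rewrite /run_der dens_var0// flux_var0// scale0r subr0 mulr0 addr0.
by rewrite -(scale0r 0) dotpZr mul0r.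
Qed.

(** [Y] gathers e, t and x, since [Kint_derive] asks for continuity jointly in the parameter and the
    integration variables. *)
Lemma clamped_continuous (u : R -> rV -> R) (y : Y) : C00 T u ->
  {for y, continuous (fun y : Y => u (clamp T y.2.1) y.2.2)}.
Proof.
move=> /(C00P T0) cu.
exact: (@continuous_comp _ _ _ (@snd R (R * rV)) (fun z => u (clamp T z.1) z.2) y (@cvg_snd _ _ _ _ _) (cu _)).
Qed.

Lemma space_continuous (y : Y) : {for y, continuous (fun y : Y => y.2.2)}.
Proof.
apply: (@continuous_comp _ _ _ (@snd R (R * rV)) (@snd R rV) y); exact: cvg_snd.
Qed.

Lemma clamp_time_continuous (y : Y) : {for y, continuous (fun y : Y => clamp T y.2.1)}.
Proof.
apply: (@continuous_comp _ _ _ (fun y : Y => y.2.1) (clamp T) y); last exact: clamp_continuous.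
by apply: (@continuous_comp _ _ _ (@snd R (R * rV)) (@fst R rV) y); [exact: cvg_snd|exact: cvg_fst].
Qed.

Lemma dens_at_continuous (y : Y) :
  {for y, continuous (fun y : Y => dens_at y.1 (clamp T y.2.1) y.2.2)}.
Proof.
apply: (@continuous_add Y (fun y => rho (clamp T y.2.1) y.2.2)
   (fun y => y.1 * dens_var (clamp T y.2.1) y.2.2)).
  exact: clamped_continuous (C01_C00 rho_C01).
apply: (@continuous_mul Y fst (fun y => dens_var (clamp T y.2.1) y.2.2)); first exact: cvg_fst.
exact: clamped_continuous (C01_C00 (C12_C01 dens_var_C12)).
Qed.

Section at_positive_density.
Variable y : Y.
Hypothesis y_pos : 0 < dens_at y.1 (clamp T y.2.1) y.2.2.

Lemma vel_at_continuous :
  {for y, continuous (fun y : Y => vel_at y.1 (clamp T y.2.1) y.2.2)}.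
Proof.
apply/rV_continuousP => j.
have -> : (fun y : Y => vel_at y.1 (clamp T y.2.1) y.2.2 ord0 j) =
  (fun y => (dens_at y.1 (clamp T y.2.1) y.2.2)^-1 *
    (rho (clamp T y.2.1) y.2.2 * velocity (clamp T y.2.1) y.2.2 ord0 j +
     y.1 * flux_var (clamp T y.2.1) y.2.2 ord0 j)).
  by apply/funext => z; exact: vel_at_coord.
apply: continuous_mul.
  by apply: continuous_inv; [rewrite gt_eqF|exact: dens_at_continuous].
apply: continuous_add; apply: continuous_mul.
- exact: clamped_continuous (C01_C00 rho_C01).
- exact: (@clamped_continuous (fun t x => velocity t x ord0 j) y (C01_C00 (velocity_C01 j))).
- exact: cvg_fst.
- exact: (@clamped_continuous (fun t x => flux_var t x ord0 j) y (flux_var_C00 (j := j))).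
Qed.

Lemma state_continuous : {for y, continuous (fun y : Y =>
  (clamp T y.2.1, (y.2.2, vel_at y.1 (clamp T y.2.1) y.2.2)))}.
Proof.
apply: continuous_pair; first exact: clamp_time_continuous.
by apply: continuous_pair; [exact: space_continuous|exact: vel_at_continuous].
Qed.

Lemma density_state_continuous : {for y, continuous (fun y : Y =>
  (clamp T y.2.1, (y.2.2, dens_at y.1 (clamp T y.2.1) y.2.2)))}.
Proof.
apply: continuous_pair; first exact: clamp_time_continuous.
by apply: continuous_pair; [exact: space_continuous|exact: dens_at_continuous].
Qed.

Lemma L_at_continuous : {for y, continuous (fun y : Y =>
  L (clamp T y.2.1) y.2.2 (vel_at y.1 (clamp T y.2.1) y.2.2))}.
Proof.
apply: (@continuous_comp _ _ _ (fun y : Y => (clamp T y.2.1, (y.2.2, vel_at y.1 (clamp T y.2.1) y.2.2)))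
  (fun z : R * (rV * rV) => pairL L z.1 z.2) y);
  [exact: state_continuous|exact: (pairL_continuous L_regular)].
Qed.

Lemma vgrad_at_continuous : {for y, continuous (fun y : Y =>
  vgrad L (clamp T y.2.1) y.2.2 (vel_at y.1 (clamp T y.2.1) y.2.2))}.
Proof.
apply/rV_continuousP => j.
have -> : (fun y : Y => vgrad L (clamp T y.2.1) y.2.2 (vel_at y.1 (clamp T y.2.1) y.2.2) ord0 j) =
  (fun y => 'D_(vdir (basis j)) (pairL L (clamp T y.2.1)) (y.2.2, vel_at y.1 (clamp T y.2.1) y.2.2)).
  by apply/funext => z; rewrite mxE.
apply: (@continuous_comp _ _ _ (fun y : Y => (clamp T y.2.1, (y.2.2, vel_at y.1 (clamp T y.2.1) y.2.2)))
  (fun z : R * (rV * rV) => 'D_(vdir (basis j)) (pairL L z.1) z.2) y);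
  [exact: state_continuous|exact: (pairL_D_continuous L_regular (w := vdir (basis j)))].
Qed.

Lemma run_at_continuous : {for y, continuous (fun y : Y => run_at y.1 (clamp T y.2.1) y.2.2)}.
Proof.
apply: continuous_mul; last exact: dens_at_continuous.
apply: continuous_add; first exact: L_at_continuous.
apply: (@continuous_comp _ _ _ (fun y : Y => (clamp T y.2.1, (y.2.2, dens_at y.1 (clamp T y.2.1) y.2.2)))
  (fun z : R * (rV * R) => F z.1 z.2.1 z.2.2) y);
  [exact: density_state_continuous|exact: (density_cost_continuous F_regular)].
Qed.

Lemma run_der_continuous : {for y, continuous (fun y : Y => run_der y.1 (clamp T y.2.1) y.2.2)}.
Proof.
have cs := clamped_continuous (y := y) (C01_C00 (C12_C01 dens_var_C12)).
apply: continuous_add.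
  apply: continuous_dotp; first exact: vgrad_at_continuous.
  apply/rV_continuousP => j.
  have -> : (fun y : Y => (flux_var (clamp T y.2.1) y.2.2 -
      dens_var (clamp T y.2.1) y.2.2 *: vel_at y.1 (clamp T y.2.1) y.2.2) ord0 j) =
    (fun y => flux_var (clamp T y.2.1) y.2.2 ord0 j -
      dens_var (clamp T y.2.1) y.2.2 * vel_at y.1 (clamp T y.2.1) y.2.2 ord0 j).
    apply/funext => z; move: (flux_var _ _) (vel_at _ _ _) => v w; by rewrite !mxE.
  apply: continuous_sub.
    exact: (@clamped_continuous (fun t x => flux_var t x ord0 j) y (flux_var_C00 (j := j))).
  by apply: continuous_mul => //; exact: ((rV_continuousP _ _).1 vel_at_continuous j).
apply: continuous_mul => //; apply: continuous_add; first exact: L_at_continuous.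
apply: (@continuous_comp _ _ _ (fun y : Y => (clamp T y.2.1, (y.2.2, dens_at y.1 (clamp T y.2.1) y.2.2)))
  (fun z : R * (rV * R) => Ftilde F z.1 z.2.1 z.2.2) y);
  [exact: density_state_continuous|exact: (Ftilde_continuous F_regular)].
Qed.

End at_positive_density.

Lemma slice_continuous_at (U V Z : topologicalType) (k : U -> V -> Z) (u : U) (v : V) :
  {for (u, v), continuous (fun z : U * V => k z.1 z.2)} -> {for v, continuous (k u)}.
Proof.
move=> ck; apply: (@continuous_comp _ _ _ (fun y : V => (u, y)) (fun z => k z.1 z.2)); last exact: ck.
by apply: continuous_pair; [exact: cst_continuous|exact: cvg_id].
Qed.

(** Fermat's rule: if [l] were not 0, a small step [h] of sign opposite to [l] would give J h <= -
    |l| |h| / 2 < 0. *)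
Lemma is_derive_min0 (J : R -> R) l : is_derive (0 : R) 1 J l -> J 0 = 0 ->
  (\forall e \near (0 : R), 0 <= J e) -> l = 0.
Proof.
move=> dJ J0 Jge; apply/eqP; apply: contraT => l0.
have nl : 0 < `|l| by rewrite normr_gt0.
have dJ2 := (is_derive1P _ _ _).1 dJ _ (divr_gt0 nl (ltr0Sn _ 1)).
have [r /= r0 rJ] := (nbhs_normP _ _).1 (filterI dJ2 Jge).
have sl : Num.sg l * l = `|l| by rewrite normrEsg.
pose h := - (Num.sg l * (r / 2)).
have nh : `|h| = r / 2.
  by rewrite normrN normrM normr_sg l0 mul1r gtr0_norm// divr_gt0.
have [] := rJ h; first by rewrite /= sub0r normrN nh; lra.
rewrite addr0 J0 subr0 nh ler_norml => /andP[_ H1] H2.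
have hl : h * l = - (`|l| * (r / 2)) by rewrite /h -sl; ring.
by move: H1; rewrite hl; nra.
Qed.

Local Notation nu := (leb \x lebesgue_tuple d)%E.
Local Notation iota := (fun z : measurableTypeR R * d.-tuple (measurableTypeR R) =>
  (z.1, vec_of z.2)).
Local Notation KT := (`[0, T]%classic `*` cube (0 : rV) M).
Local Notation slab := (`[0%R, T]%classic `*` [set: d.-tuple (measurableTypeR R)]).

Definition run_diff (e : R) (z : R * rV) : R :=
  run_at e (clamp T z.1) z.2 - run_at 0 (clamp T z.1) z.2.

Definition term_diff (e : R) (x : rV) : R := term_at e x - term_at 0 x.

(** The integrands depend on [e] only over the cube. Differentiating this difference instead of the
    cost itself keeps the derivative inside integrals over compact sets. *)
Definition cost_diff (e : R) : R :=
  Kint nu iota KT (run_diff e) + Kint (lebesgue_tuple d) vec_of (cube 0 M) (term_diff e).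

Lemma dens_at0_gt0 t x : 0 <= t <= T -> 0 < dens_at 0 t x.
Proof. by move=> tT; rewrite dens_at0 rho_gt0. Qed.

Lemma term_at_continuous e : continuous (term_at e).
Proof.
have TT : 0 <= T <= T by rewrite T0 lexx.
have cd : continuous (dens_at e T).
  move=> x; have H := slice_continuous_at
    (k := fun (e : R) (z : R * rV) => dens_at e (clamp T z.1) z.2)
    (dens_at_continuous (y := (e, (T, x)))).
  have := slice_continuous_at (k := fun (t : R) (x : rV) => dens_at e (clamp T t) x) H.
  by rewrite clamp_id.
move=> x; apply: continuous_mul; last exact: cd.
apply: (@continuous_comp _ _ _ (fun x : rV => (x, dens_at e T x)) (fun z => G z.1 z.2)).
  by apply: continuous_pair; [exact: cvg_id|exact: cd].
exact: (terminal_cost_continuous G_regular).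
Qed.

Lemma term_diff_out e x : ~ cube 0 M x -> term_diff e x = 0.
Proof.
by move=> xM; rewrite /term_diff /term_at /dens_at dens_var0// !mulr0 subrr.
Qed.

Lemma run_diff_out e z : ~ cube 0 M z.2 -> run_diff e z = 0.
Proof. by move=> xM; rewrite /run_diff run_at_out// subrr. Qed.

Lemma sub_slab : iota @^-1` KT `<=` slab.
Proof. by move=> z []. Qed.

Section fixed_variation.
Variable e : R.
Hypothesis e_pos : forall t x, 0 <= t <= T -> 0 < dens_at e t x.

Lemma run_diff_continuous : continuous (run_diff e).
Proof.
have cr e' z : (forall t x, 0 <= t <= T -> 0 < dens_at e' t x) ->
    {for z, continuous (fun z : R * rV => run_at e' (clamp T z.1) z.2)}.
  move=> p; apply: (slice_continuous_at
    (k := fun (e : R) (z : R * rV) => run_at e (clamp T z.1) z.2)).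
  by apply: run_at_continuous; apply: p; exact: clamp_itv.
move=> z; apply: (@continuous_sub _ (fun z : R * rV => run_at e (clamp T z.1) z.2)
  (fun z => run_at 0 (clamp T z.1) z.2)); apply: cr => //.
exact: dens_at0_gt0.
Qed.

Lemma term_diff_continuous : continuous (term_diff e).
Proof.
by move=> x; apply: (@continuous_sub _ (term_at e) (term_at 0)); exact: term_at_continuous.
Qed.

Lemma running_split (z : R * rV) : 0 <= z.1 <= T ->
  running L F gamma (ctrl_at e) (dens_at e) z.1 z.2 =
  running L F gamma f rho z.1 z.2 + run_diff e z.
Proof. by move=> zT; rewrite running_at// running_at0// /run_diff clamp_id// subrKC. Qed.

Lemma terminal_split x : terminal G T (dens_at e) x = terminal G T rho x + term_diff e x.
Proof. by rewrite /term_diff /term_at dens_at0 subrKC. Qed.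

Variable rho0 : rV -> R.
Hypothesis adm : admissible L F G gamma T rho0 f rho.

Let run_diff_supp := Kint_supp (domain_spacetime 0 T 0 M0) (measurable_slab T)
  sub_slab run_diff_continuous
  (fun z (zT : slab z) zK => run_diff_out e (fun zc => zK (conj zT.1 zc))).

Let term_diff_supp := Kint_supp (domain_cube 0 M0) measurableT (@subsetT _ _)
  term_diff_continuous (fun x _ => @term_diff_out e (vec_of x)).

Lemma slabE (z : measurableTypeR R * d.-tuple (measurableTypeR R)) : z \in slab ->
  ((running L F gamma (ctrl_at e) (dens_at e) z.1 (vec_of z.2))%:E =
  (running L F gamma f rho z.1 (vec_of z.2))%:E + (run_diff e (iota z))%:E)%E.
Proof.
move=> /[!inE] -[/= zT _]; rewrite -EFinD; congr EFin.
by apply: (running_split (z := (z.1, vec_of z.2))); move: zT; rewrite in_itv.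
Qed.

Lemma integrable_running_at : nu.-integrable slab
  (fun z => (running L F gamma (ctrl_at e) (dens_at e) z.1 (vec_of z.2))%:E).
Proof.
have [_ _ _ ir _] := adm.
pose k0 (z : measurableTypeR R * d.-tuple (measurableTypeR R)) : \bar R :=
  (running L F gamma f rho z.1 (vec_of z.2))%:E.
pose k1 (z : measurableTypeR R * d.-tuple (measurableTypeR R)) : \bar R :=
  (running L F gamma (ctrl_at e) (dens_at e) z.1 (vec_of z.2))%:E.
apply: (@eq_integrable _ _ R nu _ (measurable_slab T)
  (k0 \+ (EFin \o (run_diff e \o iota)))%E k1).
  by move=> z zs; rewrite /k1 (slabE zs).
exact: (integrableD (measurable_slab T) ir run_diff_supp.1).
Qed.

Lemma integrable_terminal_at : integrable_Rd (terminal G T (dens_at e)).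
Proof.
have [_ _ _ _ it] := adm.
rewrite /integrable_Rd; under eq_fun do rewrite terminal_split EFinD.
exact: (integrableD measurableT it term_diff_supp.1).
Qed.

Lemma admissible_at : admissible L F G gamma T rho0 (ctrl_at e) (dens_at e).
Proof.
have [_ [_ pd] [ce ic] _ _] := adm; split.
- by split; [exact: dens_at_C12|exact: ctrl_at_C01].
- by split => // t tT; apply: prob_density_at => //; exact: pd.
- split => [t x tT|x]; first by apply: continuity_at => //; exact: ce.
  by rewrite /dens_at /dens_var th0 oppr0 mul0r mulr0 addr0.
- exact: integrable_running_at.
- exact: integrable_terminal_at.
Qed.

Lemma cost_at : cost L F G gamma T (ctrl_at e) (dens_at e) =
  (cost L F G gamma T f rho + (cost_diff e)%:E)%E.
Proof.
have [_ _ _ ir it] := adm.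
rewrite /cost (fubini_slab integrable_running_at) (fubini_slab ir).
rewrite (eq_integral _ _ slabE) integralD//; last 2 first.
- exact: measurable_slab.
- exact: run_diff_supp.1.
rewrite run_diff_supp.2 /integral_Rd.
under [X in (_ + X)%E = _]eq_integral do rewrite terminal_split EFinD.
rewrite integralD//; last exact: term_diff_supp.1.
by rewrite term_diff_supp.2 /cost_diff EFinD addeACA.
Qed.

End fixed_variation.

Lemma C00_slice (u : R -> rV -> R) t : C00 T u -> 0 <= t <= T -> continuous (u t).
Proof.
move=> /(C00P T0) cu tT.
have := slice_continuous (k := fun t x => u (clamp T t) x) (u := t) cu.
by rewrite clamp_id.
Qed.

(** * Optimality and the first variation *)

Section optimality.
Variable rho0 : rV -> R.
Hypothesis adm : admissible L F G gamma T rho0 f rho.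
Hypothesis opt : forall f' rho', admissible L F G gamma T rho0 f' rho' ->
  (cost L F G gamma T f rho <= cost L F G gamma T f' rho')%E.

(** Finiteness allows the optimal cost to be cancelled from an inequality between extended reals. *)
Lemma cost_fin_num : cost L F G gamma T f rho \is a fin_num.
Proof.
have [_ _ _ ir it] := adm; rewrite /cost (fubini_slab ir) fin_numD; apply/andP; split.
  exact: (integrable_fin_num (measurable_slab T) ir).
exact: (integrable_fin_num measurableT it).
Qed.

Lemma cost_diff_ge0 e : (forall t x, 0 <= t <= T -> 0 < dens_at e t x) -> 0 <= cost_diff e.
Proof.
move=> e_pos; have := opt (admissible_at e_pos adm).
by rewrite (cost_at e_pos adm) -[leLHS]adde0 leeD2lE ?cost_fin_num// lee_fin.
Qed.

Lemma is_derive_diff (k : R -> R) (p l : R) : is_derive p 1 k l ->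
  is_derive p 1 (fun e => k e - k 0) l.
Proof.
by move=> dk; have := is_deriveB dk (is_derive_cst (k 0) p 1); rewrite subr0.
Qed.

Lemma is_derive_cost_diff : is_derive (0 : R) 1 cost_diff
  (Kint nu iota KT (fun z => run_der 0 (clamp T z.1) z.2) +
   Kint (lebesgue_tuple d) vec_of (cube 0 M)
     (fun x => Gtilde G x (dens_at 0 T x) * dens_var T x)).
Proof.
have TT : 0 <= T <= T by rewrite T0 lexx.
have [e0 e00 He0] := dens_at_gt0.
have ne : \forall e \near (0 : R), `|e| < e0 by apply: (@nbhs0_lt R R).
have c0 (z : R * rV) : {for (0, z), continuous (fun y : Y => run_der y.1 (clamp T y.2.1) y.2.2)}.
  by apply: run_der_continuous; apply: dens_at0_gt0; exact: clamp_itv.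
apply: is_deriveD.
  apply: (Kint_derive (domain_spacetime 0 T 0 M0) (q := run_diff)
    (h := fun e z => run_der e (clamp T z.1) z.2)).
  - move: ne; apply: filterS => e ee; split; first exact: (run_diff_continuous (He0 e ee)).
    move=> z _.
    apply: (@is_derive_diff (fun e => run_at e (clamp T z.1) z.2)).
    by apply: is_derive_run_at; apply: (He0 e ee); exact: clamp_itv.
  - move=> z; exact: (slice_continuous_at
      (k := fun e (z : R * rV) => run_der e (clamp T z.1) z.2) (c0 z)).
  - by move=> z _; exact: c0.
have cd (e : R) (x : rV) : {for (e, x), continuous (fun y : R * rV => dens_at y.1 T y.2)}.
  have H := @dens_at_continuous (e, (T, x)).
  have : {for (e, x), continuous (fun y : R * rV => dens_at y.1 (clamp T T) y.2)}.
    apply: (@continuous_comp _ _ _ (fun y : R * rV => (y.1, (T, y.2)))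
      (fun y : Y => dens_at y.1 (clamp T y.2.1) y.2.2)); last exact: H.
    apply: continuous_pair; first exact: cvg_fst.
    by apply: continuous_pair; [exact: cst_continuous|exact: cvg_snd].
  by rewrite clamp_id.
have ct (e : R) (x : rV) : {for (e, x), continuous
    (fun y : R * rV => Gtilde G y.2 (dens_at y.1 T y.2) * dens_var T y.2)}.
  apply: (@continuous_mul _ (fun y : R * rV => Gtilde G y.2 (dens_at y.1 T y.2)) (fun y => dens_var T y.2)).
    apply: (@continuous_comp _ _ _ (fun y : R * rV => (y.2, dens_at y.1 T y.2)) (fun z => Gtilde G z.1 z.2)).
      by apply: continuous_pair; [exact: cvg_snd|exact: cd].
    exact: (Gtilde_continuous G_regular).
  apply: (@continuous_comp _ _ _ (@snd R rV) (dens_var T)); first exact: cvg_snd.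
  exact: (C00_slice (C01_C00 (C12_C01 dens_var_C12)) TT).
apply: (Kint_derive (domain_cube 0 M0) (q := term_diff)
  (h := fun e x => Gtilde G x (dens_at e T x) * dens_var T x)).
- near=> e; split; first exact: term_diff_continuous.
  move=> x _; apply: (@is_derive_diff (fun e => term_at e x)).
  exact: is_derive_term_at.
- move=> x; exact: (slice_continuous_at
    (k := fun e x => Gtilde G x (dens_at e T x) * dens_var T x) (ct 0 x)).
- by move=> x _; exact: ct.
Unshelve. all: by end_near. Qed.

(** The perturbed pair is a competitor for small [e] of either sign, so [cost_diff] is nonnegative
    on both sides of 0, where it vanishes; Fermat's rule applies. *)
Lemma first_variation :
  Kint nu iota KT (fun z => run_der 0 (clamp T z.1) z.2) +
  Kint (lebesgue_tuple d) vec_of (cube 0 M)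
     (fun x => Gtilde G x (rho T x) * dens_var T x) = 0.
Proof.
under [X in _ + X]eq_Kint => x _ do rewrite -dens_at0.
apply: (is_derive_min0 is_derive_cost_diff).
  rewrite /cost_diff.
  rewrite (@eq_Kint _ _ nu _ iota KT _ (fun=> 0)); last by move=> z _; rewrite /run_diff subrr.
  rewrite (@eq_Kint _ _ _ _ _ _ (term_diff 0) (fun=> 0)); last by move=> z _; rewrite /term_diff subrr.
  by rewrite /Kint /Rintegral !integral0_eq ?addr0.
have [e0 e00 He0] := dens_at_gt0.
near=> e; apply: cost_diff_ge0; apply: He0; near: e.
by apply: (@nbhs0_lt R R).
Unshelve. all: by end_near. Qed.

End optimality.

(** * The weak optimality condition *)

Definition costate (t : R) (x : rV) : rV := vgrad L t x (velocity t x).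

(** The coefficient of the density variation: L + Ftilde - P . v is the derivative of the cost
    density with respect to rho at fixed flux rho v, and - gamma div P is left by the integration by
    parts of gamma P . grad [dens_var]. *)
Definition source (t : R) (x : rV) : R :=
  L t x (velocity t x) + Ftilde F t x (rho t x) - dotp (costate t x) (velocity t x)
  - gamma * divg (costate t) x.

Lemma velocity_rV_C01 : C01 T velocity.
Proof. by apply/(C01_rVP T0) => j; exact: velocity_C01. Qed.

(** A space derivative of P costs a second derivative of [L] and one of the velocity, hence two of
    ln rho: this uses the full order of regularity assumed. *)
Lemma costate_C01 j : C01 T (fun t x => costate t x ord0 j).
Proof.
apply: (eq_C01 T0 (u := fun t x => 'D_(vdir (basis j)) (pairL L t) (x, velocity t x))).
  by move=> t _ x; rewrite [RHS]mxE.
apply: (C01_field_comp T0 (M := fun t y => 'D_(vdir (basis j)) (pairL L t) y)).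
- exact: (pairL_D_continuous L_regular).
- by move=> w t y; exact: (pairL_D_derivable L_regular).
- by move=> w; exact: (pairL_DD_continuous L_regular).
- exact: velocity_rV_C01.
Qed.

Lemma source_C00 : C00 T source.
Proof.
have cL : C00 T (fun t x => L t x (velocity t x)).
  apply: (C00_field_comp T0 (M := pairL L) (pairL_continuous L_regular)).
  by case: velocity_rV_C01.
have cF : C00 T (fun t x => Ftilde F t x (rho t x)).
  apply/(C00P T0) => z.
  apply: (@continuous_comp _ _ _ (fun z : R * rV => (clamp T z.1, (z.2, rho (clamp T z.1) z.2)))
    (fun z : R * (rV * R) => Ftilde F z.1 z.2.1 z.2.2) z); last exact: (Ftilde_continuous F_regular).
  apply: (@continuous_pair _ _ _ (fun z : R * rV => clamp T z.1)).
    by apply: (@continuous_comp _ _ _ (@fst R rV) (clamp T) z); [exact: cvg_fst|exact: clamp_continuous].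
  apply: (@continuous_pair _ _ _ (fun z : R * rV => z.2)); first exact: cvg_snd.
  exact: ((C00P T0 _).1 (C01_C00 rho_C01)).
have cD : C00 T (fun t x => \sum_j costate t x ord0 j * velocity t x ord0 j).
  apply: (C00_sum T0) => j.
  exact: (C00M T0 (C01_C00 (costate_C01 j)) (C01_C00 (velocity_C01 j))).
have cG : C00 T (fun t x => \sum_j 'D_(basis j) (fun y => costate t y ord0 j) x).
  apply: (C00_sum T0) => j; exact: (C01_C00D (costate_C01 j)).
have cN (a : R) (u : R -> rV -> R) : C00 T u -> C00 T (fun t x => a * u t x).
  by move=> cu; apply: (C00M T0 _ cu); exact: C00_cst.
apply: (eq_C00 T0 (u := fun t x => L t x (velocity t x) + Ftilde F t x (rho t x) +
    (- 1) * (\sum_j costate t x ord0 j * velocity t x ord0 j) +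
    (- gamma) * (\sum_j 'D_(basis j) (fun y => costate t y ord0 j) x))).
  by move=> t _ x; rewrite mulN1r mulNr.
exact: (C00D T0 (C00D T0 (C00D T0 cL cF) (cN (- 1) _ cD)) (cN (- gamma) _ cG)).
Qed.

(** The product rule applied to P times [dens_var]: the term gamma P . grad [dens_var] becomes a
    divergence, which integrates to 0, minus gamma [dens_var] div P, which goes into [source]. *)
Lemma run_der_divergence t x : 0 <= t <= T -> run_der 0 t x =
  (th' t * (chi x * costate t x ord0 i) + - th t * (source t x * sg x)) +
  gamma * \sum_j 'D_(basis j) (fun y => costate t y ord0 j * dens_var t y) x.
Proof.
move=> tT; rewrite /run_der vel_at0// dens_at0 -/(costate t x).
have -> : \sum_j 'D_(basis j) (fun y => costate t y ord0 j * dens_var t y) x =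
    dotp (costate t x) (grad (dens_var t) x) + dens_var t x * divg (costate t) x.
  rewrite mulr_sumr -big_split/=; apply: eq_bigr => j _; rewrite [X in _ = _ * X + _]mxE.
  by have [_ ->] := is_deriveMx (C01_derive (costate_C01 j) (basis j) x tT)
    (C01_derive (C12_C01 dens_var_C12) (basis j) x tT).
rewrite dotpBr dotpZr dotpDr !dotpZr dotp_basis /source /dens_var.
by move: (dotp _ (grad _ _)) (dotp _ (velocity _ _)) => p q; ring.
Qed.

Lemma Kint_partial_eq0 j (h g : rV -> R) : continuous g ->
  (forall x, is_derive x (basis j) h (g x)) ->
  (forall x, ~ cube 0 M x -> h x = 0) -> (forall x, ~ cube 0 M x -> g x = 0) ->
  Kint (lebesgue_tuple d) vec_of (cube 0 M) g = 0.
Proof.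
move=> cg hg h0 g0; have := integral_partial_eq0 M0 cg hg h0 g0.
have [_ +] := Kint_supp (domain_cube 0 M0) measurableT (@subsetT _ _) cg
  (fun x _ => g0 (vec_of x)).
by rewrite /integral_Rd => -> [].
Qed.

Lemma derive_out (h : rV -> R) w x : (forall x, ~ cube 0 M x -> h x = 0) ->
  ~ cube 0 M x -> 'D_w h x = 0.
Proof.
move=> h0 xM; rewrite (@near_eq_derive _ _ _ _ (cst 0)) ?derive_cst//.
by move: (cube_near xM); apply: filterS => y /h0 ->.
Qed.

Lemma Kint_divergence_eq0 t : 0 <= t <= T ->
  Kint (lebesgue_tuple d) vec_of (cube 0 M)
    (fun x => \sum_j 'D_(basis j) (fun y => costate t y ord0 j * dens_var t y) x) = 0.
Proof.
move=> tT; pose h j y := costate t y ord0 j * dens_var t y.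
have Cj j : C01 T (fun t y => costate t y ord0 j * dens_var t y).
  exact: (C01M T0 (costate_C01 j) (C12_C01 dens_var_C12)).
have h0 j x : ~ cube 0 M x -> h j x = 0 by move=> xM; rewrite /h dens_var0// mulr0.
have cg j : continuous ('D_(basis j) (h j)) by exact: (C00_slice (C01_C00D (Cj j)) tT).
have I0 j : Kint (lebesgue_tuple d) vec_of (cube 0 M) ('D_(basis j) (h j)) = 0.
  apply: (@Kint_partial_eq0 j (h j)) => //.
  - by move=> x; exact: (C01_derive (Cj j) (basis j) x tT).
  - exact: h0.
  - by move=> x; exact: (derive_out _ (h0 j)).
(* Additivity of [Kint] asks for continuous summands, so continuity of the partial sums is carried
   through the induction. *)
have [] : continuous (fun x => \sum_(j <- index_enum 'I_d) 'D_(basis j) (h j) x) /\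
    Kint (lebesgue_tuple d) vec_of (cube 0 M)
      (fun x => \sum_(j <- index_enum 'I_d) 'D_(basis j) (h j) x) = 0; last by [].
elim: (index_enum 'I_d) => [|j s [cs Is]].
  split; first by under [X in continuous X]eq_fun do rewrite big_nil; exact: cst_continuous.
  by rewrite /Kint /Rintegral integral0_eq// => x _; rewrite big_nil.
split.
  have <- : (fun x => 'D_(basis j) (h j) x + \sum_(j <- s) 'D_(basis j) (h j) x) =
      (fun x => \sum_(j <- j :: s) 'D_(basis j) (h j) x).
    by apply/funext => x; rewrite big_cons.
  by move=> x; exact: (continuous_add (cg j x) (cs x)).
have H := KintD (domain_cube 0 M0) (cg j) cs; rewrite I0 Is addr0 in H.
by rewrite -[RHS]H; apply: eq_Kint => x _; rewrite big_cons.
Qed.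

Section weak_form.
Variable rho0 : rV -> R.
Hypothesis adm : admissible L F G gamma T rho0 f rho.
Hypothesis opt : forall f' rho', admissible L F G gamma T rho0 f' rho' ->
  (cost L F G gamma T f rho <= cost L F G gamma T f' rho')%E.

Let sg_continuous : continuous sg.
Proof.
by apply: (C00_slice (u := fun=> sg) (t := 0) (C01_C00 (C12_C01 sg_C12))); rewrite lexx.
Qed.

Lemma weak_costate :
  Kint leb id `[0, T] (fun t =>
    th' t * Kint (lebesgue_tuple d) vec_of (cube 0 M) (fun x => chi x * costate t x ord0 i)
    - th t * Kint (lebesgue_tuple d) vec_of (cube 0 M) (fun x => source t x * sg x)) =
  th T * Kint (lebesgue_tuple d) vec_of (cube 0 M) (fun x => Gtilde G x (rho T x) * sg x).
Proof.
have TT : 0 <= T <= T by rewrite T0 lexx.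
apply/eqP; rewrite -subr_eq0; apply/eqP.
rewrite -[RHS](first_variation adm opt); congr (_ + _); last first.
  have cG : continuous (fun x => Gtilde G x (rho T x) * sg x).
    move=> x; apply: (@continuous_mul _ (fun x => Gtilde G x (rho T x)) sg); last exact: sg_continuous.
    apply: (@continuous_comp _ _ _ (fun x => (x, rho T x)) (fun z => Gtilde G z.1 z.2)).
      by apply: continuous_pair; [exact: cvg_id|exact: (C00_slice (C01_C00 rho_C01) TT)].
    exact: (Gtilde_continuous G_regular).
  rewrite -mulNr -(KintZ (domain_cube 0 M0) _ cG).
  by apply: eq_Kint => x _; rewrite /dens_var mulrCA.
rewrite (Kint_fubini M0); last 2 first.
- move=> z; exact: (slice_continuous_at
    (k := fun e (z : R * rV) => run_der e (clamp T z.1) z.2)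
    (run_der_continuous (y := (0, z)) (dens_at0_gt0 _ (clamp_itv _ T0)))).
- by move=> t x _ xM; exact: run_der_out.
apply: eq_Kint => t; rewrite /= in_itv/= => tT; rewrite clamp_id//.
have c1 : continuous (fun x => chi x * costate t x ord0 i).
  exact: (C00_slice (C00M T0 (C01_C00 chi_C01) (C01_C00 (costate_C01 i))) tT).
have c2 : continuous (fun x => source t x * sg x).
  exact: (C00_slice (C00M T0 source_C00 (C01_C00 (C12_C01 sg_C12))) tT).
have c3 : continuous (fun x => \sum_j 'D_(basis j) (fun y => costate t y ord0 j * dens_var t y) x).
  apply: (C00_slice (u := fun t x => \sum_j 'D_(basis j) (fun y => costate t y ord0 j * dens_var t y) x) _ tT).
  apply: (C00_sum T0) => j.
  exact: (C01_C00D (C01M T0 (costate_C01 j) (C12_C01 dens_var_C12))).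
have cZ (a : R) (u : rV -> R) : continuous u -> continuous (fun x => a * u x).
  by move=> cu x; apply: continuous_scale; exact: cu.
have dom := domain_cube (0 : rV) M0.
transitivity (Kint (lebesgue_tuple d) vec_of (cube 0 M) (fun x =>
  (th' t * (chi x * costate t x ord0 i) + - th t * (source t x * sg x)) +
  gamma * \sum_j 'D_(basis j) (fun y => costate t y ord0 j * dens_var t y) x)); last first.
  by apply: eq_Kint => x _; rewrite run_der_divergence.
have c12 : continuous (fun x => th' t * (chi x * costate t x ord0 i) + - th t * (source t x * sg x)).
  by move=> x; exact: (continuous_add (cZ _ _ c1 x) (cZ _ _ c2 x)).
have H1 := KintD dom c12 (cZ gamma _ c3).
have H2 := KintD dom (cZ (th' t) _ c1) (cZ (- th t) _ c2).
have I1 := KintZ dom (th' t) c1; have I2 := KintZ dom (- th t) c2.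
have I3 := KintZ dom gamma c3; rewrite Kint_divergence_eq0// mulr0 in I3.
by rewrite I3 addr0 H2 I1 I2 mulNr in H1; rewrite H1.
Qed.

End weak_form.
End variation.

(** * Localisation *)

(** The increment splits into a change of [u] at fixed [t0], where the interval of integration is
    fixed and [Kint_continuous] applies, and a change of [t], where the slope stays within 1 of
    [g u0 t0]. *)
Lemma primitive_continuous (U : topologicalType) (g : U -> R -> R) :
  continuous (fun z : U * R => g z.1 z.2) ->
  continuous (fun z : U * R => primitive (g z.1) z.2).
Proof.
move=> cg [u0 t0]; have cgu u : continuous (g u) := slice_continuous (k := g) (u := u) cg.
have cI a b : {for u0, continuous (fun u => Kint leb id `[a, b] (g u))}.
  apply: (Kint_continuous (domain_itv a b)); last by move=> x _; exact: cg.
  by near=> u; exact: cgu.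
have ct : {for u0, continuous (fun u => primitive (g u) t0)}.
  exact: (continuous_sub (cI (- (`|t0| + 1)) t0) (cI (- (`|t0| + 1)) 0)).
have [[A B]/= [nA /nbhs_normP[r /= r0 Br]] AB] :
    nbhs (u0, t0) [set z : U * R | `|g z.1 z.2 - g u0 t0| <= 1].
  by have /cvgrPdist_le/(_ _ ltr01) := cg (u0, t0); apply: filterS => z /=; rewrite distrC.
apply/cvgrPdist_le => e e0.
pose c := `|g u0 t0| + 1; have c0 : 0 < c by rewrite ltr_wpDl.
have e20 : 0 < e / 2 by rewrite divr_gt0.
have near4 : \forall z \near (u0, t0), `|primitive (g u0) t0 - primitive (g z.1) t0| <= e / 2.
  have cc : {for (u0, t0), continuous (fun z : U * R => primitive (g z.1) t0)}.
    by apply: (@continuous_comp _ _ _ (@fst U R) (fun u => primitive (g u) t0)); [exact: cvg_fst|exact: ct].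
  by have /cvgrPdist_le/(_ _ e20) := cc.
near=> z => /=.
have z1 : A z.1.
  by near: z; exists (A, setT) => [|y []//]; split => //; exact: filterT.
have z2 : `|t0 - z.2| < r by near: z; apply: cvgr_dist_lt => //; exact: cvg_snd.
have z3 : `|t0 - z.2| <= e / 2 / c.
  by near: z; apply: cvgr_dist_le; [exact: cvg_snd|rewrite !divr_gt0].
have z4 : `|primitive (g u0) t0 - primitive (g z.1) t0| <= e / 2 by near: z.
have H : `|primitive (g z.1) z.2 - primitive (g z.1) t0 - (z.2 - t0) * g u0 t0| <= 1 * `|z.2 - t0|.
  apply: (mvt_le (g := g z.1)) => s st; first exact: is_derive_primitive.
  apply: (AB (z.1, s)); split => //; apply: Br; rewrite /= distrC.
  by apply: le_lt_trans (norm_between_sub st) _; rewrite distrC.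
move: z4 H; rewrite mul1r.
set p0 := primitive (g u0) t0; set p1 := primitive (g z.1) t0; set p2 := primitive (g z.1) z.2.
set w := (z.2 - t0) * g u0 t0 => z4 H.
have wE : `|w| = `|t0 - z.2| * `|g u0 t0| by rewrite normrM distrC.
rewrite (_ : p0 - p2 = (p0 - p1) - ((p2 - p1 - w) + w)); last by rewrite subrK; lra.
rewrite (le_trans (ler_normB _ _))// [leRHS]splitr lerD// (le_trans (ler_normD _ _))//.
move: z3; rewrite ler_pdivlMr// /c mulrDr mulr1 -wE => z3.
by rewrite (le_trans _ z3)// addrC lerD2l [leRHS]distrC.
Unshelve. all: by end_near. Qed.

(** The derivative is two-sided, but [W] is constant only on [0, T]. A step of length at most T / 2
    taken towards the middle of the interval stays inside, also when [t] is an endpoint. *)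
Lemma derive_eq0_itv (W : R -> R) (T t l : R) : 0 < T -> 0 <= t <= T ->
  (forall s, 0 <= s <= T -> W s = W 0) -> is_derive t 1 W l -> l = 0.
Proof.
move=> T0 tT WE /is_derive1P dW; apply/eqP; apply: contraT => l0.
have nl : 0 < `|l| by rewrite normr_gt0.
have [r /= r0 rW] := (nbhs_normP _ _).1 (dW _ (divr_gt0 nl (ltr0Sn _ 1))).
pose m := Num.min (r / 2) (T / 2).
have m0 : 0 < m by rewrite lt_min !divr_gt0.
have mr : m < r by rewrite (@le_lt_trans _ _ (r / 2)) ?ge_min ?lexx// ltr_pdivrMr// ltr_pMr// ltr1n.
have mT : m <= T / 2 by rewrite ge_min lexx orbT.
have [h hm ht] : exists2 h, `|h| = m & 0 <= h + t <= T.
  have [tT2|tT2] := leP t (T / 2).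
    by exists m; [exact: gtr0_norm|move: tT => /andP[? ?]; apply/andP; split; lra].
  by exists (- m); [rewrite normrN; exact: gtr0_norm|move: tT => /andP[? ?]; apply/andP; split; lra].
have := rW h; rewrite /= sub0r normrN hm (WE _ ht) (WE _ tT) subrr sub0r normrN normrM hm.
by move=> /(_ mr); rewrite mulrC ler_pM2r//; lra.
Qed.

Section space_localisation.
Context {d : nat}.
Local Notation rV := 'rV[R]_d.
Local Notation KI M := (Kint (lebesgue_tuple d) vec_of (cube (0 : rV) M)).
Variable i : 'I_d.

Definition bump_drop (a : rV) (h r : R) (x : rV) : R :=
  bump a r x - bump (a + h *: basis i) r x.

(** The chi that belongs to [bump_drop] as sg. Integrating one bump along a segment shows directly
    that the antiderivative has compact support. *)
Definition bump_flux (a : rV) (h r : R) : rV -> R := segment_int (basis i) h (bump a r).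

Section test_pair.
Variables (a : rV) (h r T : R).
Hypotheses (h0 : 0 <= h) (r0 : 0 <= r) (T0 : 0 <= T).
Local Notation M := (`|a| + h + r).

Lemma test_radius_ge0 : 0 <= M.
Proof. by rewrite !addr_ge0. Qed.

(** [M] bounds every coordinate of a point of the shifted bump: |a| for the centre, [h] for the
    shift, [r] for the support. *)
Lemma bump_out s x : 0 <= s <= h -> ~ cube 0 M x -> bump a r (x - s *: basis i) = 0.
Proof.
move=> /andP[s0 sh] xM; apply: bump_supp => // H; apply: xM => j.
rewrite mxE subr0; have := H j; rewrite !mxE => {}H.
have aj : `|a ord0 j| <= `|a| by apply: (rV_norm_le _ _).1.
have sj : `|s * ((0 == 0 :> 'I_1) && (j == i))%:R| <= h.
  by rewrite normrM (ger0_norm s0); case: (_ && _); rewrite ?normr1 ?normr0 ?mulr1 ?mulr0//.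
rewrite (_ : x ord0 j = a ord0 j + s * ((0 == 0 :> 'I_1) && (j == i))%:R +
  (x ord0 j - s * ((0 == 0 :> 'I_1) && (j == i))%:R - a ord0 j)); last by ring.
by rewrite (le_trans (ler_normD _ _))// lerD// (le_trans (ler_normD _ _))// lerD.
Qed.

Lemma bump_dropE x : bump_drop a h r x = bump a r x - bump a r (x - h *: basis i).
Proof. by rewrite bump_shift. Qed.

Lemma bump_drop_out x : ~ cube 0 M x -> bump_drop a h r x = 0.
Proof.
move=> xM; rewrite bump_dropE (bump_out _ xM) ?h0 ?lexx//.
by have := bump_out (s := 0) _ xM; rewrite scale0r subr0 lexx h0 => ->; rewrite ?subrr.
Qed.

Lemma bump_flux_out x : ~ cube 0 M x -> bump_flux a h r x = 0.
Proof.
move=> xM; rewrite /bump_flux /segment_int /Kint /Rintegral integral0_eq// => s.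
by rewrite /= in_itv/= => sh; rewrite bump_out.
Qed.

Let bump_C12 : C12 T (fun _ : R => bump a r) := C12_bump T0 a r.

Lemma bump_slice (u : rV -> R) : C00 T (fun _ : R => u) -> continuous u.
Proof. by move=> cu; apply: (C00_slice T0 (t := 0) cu); rewrite lexx. Qed.

Let D_bump w y : is_derive y w (bump a r) ('D_w (bump a r) y).
Proof.
have T00 : 0 <= (0 : R) <= T by rewrite lexx T0.
exact: (C01_derive (C12_C01 bump_C12) w y T00).
Qed.

Lemma C12_bump_drop : C12 T (fun _ : R => bump_drop a h r).
Proof.
have := C12D T0 bump_C12 (C12_sep T0 (th := fun=> -1) (th' := fun=> 0) _ _
  (C12_bump T0 (a + h *: basis i) r)).
have -> : (fun _ : R => bump_drop a h r) =
    (fun _ x => bump a r x + -1 * bump (a + h *: basis i) r x).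
  by apply/funext => t; apply/funext => x; rewrite mulN1r.
by apply; exact: cst_continuous.
Qed.

Lemma C01_bump_flux : C01 T (fun _ : R => bump_flux a h r).
Proof.
have cb : continuous (bump a r) by exact: (bump_slice (C01_C00 (C12_C01 bump_C12))).
have cD w : continuous ('D_w (bump a r)).
  exact: (bump_slice (C01_C00D (w := w) (C12_C01 bump_C12))).
apply: (C01_intro T0 (du := fun w _ => segment_int (basis i) h ('D_w (bump a r)))).
- by apply: (C00_space T0); exact: segment_int_continuous.
- by move=> w t x _; apply: is_derive_segment_int => // y; exact: D_bump.
- by move=> w; apply: (C00_space T0); exact: segment_int_continuous.
Qed.

Lemma is_derive_bump_flux x : is_derive x (basis i) (bump_flux a h r) (bump_drop a h r x).
Proof.
have cb : continuous (bump a r) by exact: (bump_slice (C01_C00 (C12_C01 bump_C12))).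
have cD : continuous ('D_(basis i) (bump a r)).
  exact: (bump_slice (C01_C00D (w := basis i) (C12_C01 bump_C12))).
rewrite bump_dropE -(segment_int_partial h0 x cD (D_bump (basis i))).
exact: (is_derive_segment_int _ _ _ cb cD (D_bump (basis i))).
Qed.

End test_pair.

(** The test functions are constant in time, so the horizon can be taken to be 0 here. *)
Lemma bump_drop_continuous a h r : continuous (bump_drop a h r).
Proof. exact: (bump_slice (lexx 0) (C01_C00 (C12_C01 (C12_bump_drop a h r (lexx 0))))). Qed.

Lemma bump_flux_continuous a h r : continuous (bump_flux a h r).
Proof. exact: (bump_slice (lexx 0) (C01_C00 (C01_bump_flux a h r (lexx 0)))). Qed.

(* For small [r] the positive bump of [bump_drop] sits where [k] is below the
   mean of its values at the two centres, the negative one where it is above. *)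
Lemma bump_drop_separates (k : rV -> R) (a : rV) (h : R) : 0 <= h -> continuous k ->
  (forall r, 0 < r -> KI (`|a| + h + r) (fun x => k x * bump_drop a h r x) = 0) ->
  k (a + h *: basis i) <= k a.
Proof.
move=> h0 ck I0; rewrite leNgt; apply/negP => lk.
set b := a + h *: basis i in lk *; pose m := (k a + k b) / 2.
have [am mb] : k a < m /\ m < k b by rewrite /m; split; lra.
have [s s0 Hs] : exists2 s : R, 0 < s & forall x, `|a - x| < s -> k x < m.
  have /nbhs_normP[s /= s0 Hs] : \forall x \near a, k x < m by exact: (@cvgr_lt _ _ (nbhs a) _ k (k a) (ck a) _ am).
  by exists s.
have [s' s'0 Hs'] : exists2 s : R, 0 < s & forall x, `|b - x| < s -> m < k x.
  have /nbhs_normP[s' /= s'0 Hs'] : \forall x \near b, m < k x by exact: (@cvgr_gt _ _ (nbhs b) _ k (k b) (ck b) _ mb).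
  by exists s'.
pose r := Num.min s s' / 2.
have r0 : 0 < r by rewrite divr_gt0// lt_min s0.
have rm : r < Num.min s s' by rewrite ltr_pdivrMr// ltr_pMr ?ltr1n// lt_min s0.
have [rs rs'] : r < s /\ r < s' by move: rm; rewrite lt_min => /andP[].
have nc (c x : rV) : cube c r x -> `|c - x| <= r.
  by move=> cx; apply/rV_norm_le => [|j]; [exact: ltW|rewrite !mxE distrC; exact: cx].
have M0 := test_radius_ge0 a h0 (ltW r0); have dom := domain_cube (0 : rV) M0.
have csg := @bump_drop_continuous a h r.
have I1 : KI (`|a| + h + r) (bump_drop a h r) = 0.
  apply: (Kint_partial_eq0 M0 csg (j := i) (h := bump_flux a h r)).
  - by move=> x; exact: (is_derive_bump_flux a r h0 (lexx (0 : R)) x).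
  - by move=> x; exact: (bump_flux_out h0 (ltW r0)).
  - by move=> x; exact: (bump_drop_out h0 (ltW r0)).
(* The contradiction: [q] is nonnegative and positive at [a], yet its integral is 0, because both
   [bump_drop] and its product with [k] integrate to 0. *)
pose q (x : rV) := m * bump_drop a h r x - k x * bump_drop a h r x.
have cm : continuous (fun x => m * bump_drop a h r x).
  by move=> x; apply: continuous_scale; exact: csg.
have ckm : continuous (fun x => k x * bump_drop a h r x).
  by move=> x; exact: (continuous_mul (ck x) (csg x)).
have cq : continuous q by move=> x; exact: (continuous_sub (cm x) (ckm x)).
have qE x : q x = (m - k x) * bump a r x + (k x - m) * bump b r x.
  by rewrite /q /bump_drop -/b; ring.
have p1 x : 0 <= (m - k x) * bump a r x.
  have [xa|xa] := pselect (cube a r x); last by rewrite bump_supp ?mulr0// ltW.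
  rewrite mulr_ge0 ?bump_ge0// subr_ge0 ltW// Hs//.
  exact: le_lt_trans (nc _ _ xa) rs.
have p2 x : 0 <= (k x - m) * bump b r x.
  have [xb|xb] := pselect (cube b r x); last by rewrite bump_supp ?mulr0// ltW.
  rewrite mulr_ge0 ?bump_ge0// subr_ge0 ltW// Hs'//.
  exact: le_lt_trans (nc _ _ xb) rs'.
have : 0 < KI (`|a| + h + r) q.
  apply: (Kint_gt0 (a := a)) => //.
  - by move=> x; rewrite qE addr_ge0.
  - by move=> x xM; rewrite /q bump_drop_out ?mulr0 ?subrr// ltW.
  - by rewrite qE ltr_pwDl// mulr_gt0 ?bump_gt0// subr_gt0.
have := KintB dom cm ckm; rewrite (KintZ dom m csg) I0// I1 mulr0 subrr => E.
by rewrite {}E ltxx.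
Qed.

(** The antiderivative of [p] along the line through [x] parallel to e_i, starting from the
    hyperplane x_i = 0. The integrand depends on the line but not on the position of [x] in it, so
    D_i of this function is [p]. *)
Definition line_primitive (p : rV -> R) (x : rV) : R :=
  primitive (fun s => p (x + (s - x ord0 i) *: basis i)) (x ord0 i).

Lemma line_primitive_continuous (p : rV -> R) : continuous p -> continuous (line_primitive p).
Proof.
move=> cp x; pose g (x : rV) (s : R) := p (x + (s - x ord0 i) *: basis i).
apply: (@continuous_comp _ _ _ (fun x : rV => (x, x ord0 i)) (fun z => primitive (g z.1) z.2)).
  by apply: continuous_pair; [exact: cvg_id|exact: coord_continuous].
apply: primitive_continuous => z.
apply: (@continuous_comp _ _ _ (fun z : rV * R => z.1 + (z.2 - z.1 ord0 i) *: basis i) p); last exact: cp.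
apply: cvgD; first exact: cvg_fst.
apply: cvgZr_tmp; apply: (@continuous_sub _ snd (fun z : rV * R => z.1 ord0 i)); first exact: cvg_snd.
apply: (@continuous_comp _ _ _ (@fst rV R) (fun x : rV => x ord0 i)); first exact: cvg_fst.
exact: coord_continuous.
Qed.

Lemma is_derive_line_primitive (p : rV -> R) x : continuous p ->
  is_derive x (basis i) (line_primitive p) (p x).
Proof.
move=> cp; pose g s := p (x + (s - x ord0 i) *: basis i).
have cg : continuous g.
  move=> s; apply: (@continuous_comp _ _ _ (fun s : R => x + (s - x ord0 i) *: basis i) p); last exact: cp.
  apply: cvgD; first exact: cvg_cst.
  by apply: cvgZr_tmp; apply: cvgB; [exact: cvg_id|exact: cvg_cst].
have gx : g (x ord0 i) = p x by rewrite /g subrr scale0r addr0.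
have LE (s : R) : line_primitive p (s *: basis i + x) = primitive g (s + x ord0 i).
  have ci : (s *: basis i + x) ord0 i = s + x ord0 i by rewrite !mxE !eqxx mulr1.
  rewrite /line_primitive ci; congr (primitive _ _); apply/funext => u; rewrite /g.
  congr p; rewrite addrAC -scalerDl addrC; congr (_ + _ *: _); ring.
have /is_derive1P dg := is_derive_primitive (x ord0 i) cg.
apply/is_deriveP => e e0; have := dg e e0; apply: filterS => s.
by rewrite LE gx -[x in line_primitive p x]add0r -(scale0r (basis i)) LE add0r.
Qed.

(** A du Bois-Reymond lemma for a merely continuous [q]. By parts, the integral of chi p is minus
    that of sg times [line_primitive p], so the hypothesis makes [k] orthogonal to every
    [bump_drop]. Then [bump_drop_separates], for [k] and for [- k], makes [k] constant on lines
    parallel to e_i, and D_i q = - D_i (line_primitive p). *)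
Lemma is_derive_localised (p q : rV -> R) : continuous p -> continuous q ->
  (forall a h r, 0 <= h -> 0 < r ->
     KI (`|a| + h + r) (fun x => bump_flux a h r x * p x) =
     KI (`|a| + h + r) (fun x => q x * bump_drop a h r x)) ->
  forall x, is_derive x (basis i) q (- p x).
Proof.
move=> cp cq H; pose k x := line_primitive p x + q x.
have cE := line_primitive_continuous cp.
have ck : continuous k by move=> x; exact: (continuous_add (cE x) (cq x)).
have I0 a h r : 0 <= h -> 0 < r ->
    KI (`|a| + h + r) (fun x => k x * bump_drop a h r x) = 0.
  move=> h0 r0; have M0 := test_radius_ge0 a h0 (ltW r0).
  have dom := domain_cube (0 : rV) M0; have csg := @bump_drop_continuous a h r.
  have cchi := @bump_flux_continuous a h r.
  have c1 : continuous (fun x => line_primitive p x * bump_drop a h r x).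
    by move=> x; exact: (continuous_mul (cE x) (csg x)).
  have c2 : continuous (fun x => bump_flux a h r x * p x).
    by move=> x; exact: (continuous_mul (cchi x) (cp x)).
  have c3 : continuous (fun x => q x * bump_drop a h r x).
    by move=> x; exact: (continuous_mul (cq x) (csg x)).
  have c12 : continuous (fun x => line_primitive p x * bump_drop a h r x + bump_flux a h r x * p x).
    by move=> x; exact: (continuous_add (c1 x) (c2 x)).
  have : KI (`|a| + h + r)
      (fun x => line_primitive p x * bump_drop a h r x + bump_flux a h r x * p x) = 0.
    apply: (Kint_partial_eq0 M0 c12 (j := i) (h := fun x => line_primitive p x * bump_flux a h r x)).
    - move=> x; exact: (is_deriveMx (is_derive_line_primitive x cp)
        (is_derive_bump_flux a r h0 (lexx (0 : R)) x)).
    - by move=> x xM; rewrite (bump_flux_out h0 (ltW r0) xM) mulr0.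
    - by move=> x xM; rewrite (bump_flux_out h0 (ltW r0) xM) (bump_drop_out h0 (ltW r0) xM) mulr0 mul0r addr0.
  rewrite (KintD dom c1 c2) (H a h r h0 r0) -(KintD dom c1 c3) => <-.
  by apply: eq_Kint => x _; rewrite /k mulrDl.
have cNk : continuous (fun x => - k x) by move=> x; exact: (cvgN (ck x)).
have k_ge a h : 0 <= h -> k (a + h *: basis i) = k a.
  move=> h0; apply/eqP; rewrite eq_le; apply/andP; split.
    exact: (bump_drop_separates h0 ck (fun r => I0 a h r h0)).
  rewrite -lerN2; apply: (bump_drop_separates h0 cNk) => r r0.
  have M0 := test_radius_ge0 a h0 (ltW r0); have dom := domain_cube (0 : rV) M0.
  have c1 : continuous (fun x => k x * bump_drop a h r x).
    by move=> x; exact: (continuous_mul (ck x) (@bump_drop_continuous a h r x)).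
  transitivity (KI (`|a| + h + r) (fun x => -1 * (k x * bump_drop a h r x))).
    by apply: eq_Kint => x _; rewrite mulN1r mulNr.
  by rewrite (KintZ dom _ c1) I0// mulr0.
have kE x (h : R) : k (h *: basis i + x) = k x.
  rewrite addrC; have [h0|/ltW h0] := leP 0 h; first exact: k_ge.
  have h0' : 0 <= - h by rewrite oppr_ge0.
  by rewrite -(k_ge (x + h *: basis i) _ h0') -addrA -scalerDl subrr scale0r addr0.
move=> x; apply/is_deriveP => e e0.
have := (is_deriveP _ _ _ _).1 (is_derive_line_primitive x cp) e e0; apply: filterS => h.
rewrite -normrN; congr (`|_| <= _).
by have := kE x h; rewrite /k mulrN; lra.
Qed.

End space_localisation.

(** * The value function *)

Section optimal_pair.
Context {d : nat} (T gamma : R) (T_gt0 : 0 < T).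
Local Notation rV := 'rV[R]_d.
Variables (f : R -> rV -> rV) (rho : R -> rV -> R).
Variables (L : R -> rV -> rV -> R) (F : R -> rV -> R -> R) (G : rV -> R -> R).
Hypothesis L_regular : regular_running_cost L.
Hypothesis F_regular : regular_density_cost F.
Hypothesis G_regular : regular_terminal_cost G.
Variable rho0 : rV -> R.
Hypothesis adm : admissible L F G gamma T rho0 f rho.
Hypothesis opt : forall f' rho', admissible L F G gamma T rho0 f' rho' ->
  (cost L F G gamma T f rho <= cost L F G gamma T f' rho')%E.

Let T0 : 0 <= T := ltW T_gt0.
Let rho_C12 : C12 T rho. Proof. by have [[]] := adm. Qed.
Let f_C01 : C01 T f. Proof. by have [[]] := adm. Qed.
Let rho_gt0 t x : 0 <= t <= T -> 0 < rho t x.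
Proof. by have [_ [rho_gt0 _] _ _ _] := adm; exact: rho_gt0. Qed.
Let TT : 0 <= T <= T. Proof. by rewrite T0 lexx. Qed.

Local Notation P := (costate gamma f rho L).
Local Notation B := (source gamma f rho L F).
Local Notation KI M := (Kint (lebesgue_tuple d) vec_of (cube (0 : rV) M)).

Let P_C01 j : C01 T (fun t x => P t x ord0 j).
Proof. exact: (costate_C01 gamma T0 rho_C12 f_C01 rho_gt0 L_regular j). Qed.

Let B_C00 : C00 T B.
Proof. exact: (@source_C00 _ _ gamma T0 _ _ rho_C12 f_C01 rho_gt0 _ _ L_regular F_regular). Qed.

(** The difference of primitives is the integral of the source from [t] to [T]. The clamp makes the
    integrand continuous on the whole line, so that the formula is differentiable in time at every
    real [t], endpoints included. *)
Definition cost_to_go (t : R) (x : rV) : R :=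
  Gtilde G x (rho T x) +
  (primitive (fun s => B (clamp T s) x) T - primitive (fun s => B (clamp T s) x) t).

Let B_continuous : continuous (fun z : R * rV => B (clamp T z.1) z.2).
Proof. exact: ((C00P T0 _).1 B_C00). Qed.

Let B_swap : continuous (fun z : rV * R => B (clamp T z.2) z.1).
Proof.
move=> z; apply: (@continuous_comp _ _ _ (fun z : rV * R => (z.2, z.1))
  (fun z : R * rV => B (clamp T z.1) z.2)); last exact: B_continuous.
by apply: continuous_pair; [exact: cvg_snd|exact: cvg_fst].
Qed.

Let B_time x : continuous (fun s => B (clamp T s) x).
Proof. exact: (slice_continuous (k := fun (x : rV) s => B (clamp T s) x) (u := x) B_swap). Qed.

Lemma terminal_momentum_continuous : continuous (fun x => Gtilde G x (rho T x)).
Proof.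
move=> x; apply: (@continuous_comp _ _ _ (fun x => (x, rho T x)) (fun z => Gtilde G z.1 z.2)).
  by apply: continuous_pair; [exact: cvg_id|exact: (C00_slice T0 (C01_C00 (C12_C01 rho_C12)) TT)].
exact: (Gtilde_continuous G_regular).
Qed.

Lemma cost_to_go_continuous : continuous (fun z : R * rV => cost_to_go z.1 z.2).
Proof.
have cp := primitive_continuous (g := fun x s => B (clamp T s) x) B_swap.
have cpt (h : R * rV -> R) : continuous h ->
    continuous (fun z : R * rV => primitive (fun s => B (clamp T s) z.2) (h z)).
  move=> ch z; apply: (@continuous_comp _ _ _ (fun z : R * rV => (z.2, h z))
    (fun z : rV * R => primitive (fun s => B (clamp T s) z.1) z.2)); last exact: cp.
  by apply: continuous_pair; [exact: cvg_snd|exact: ch].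
have cg : continuous (fun z : R * rV => Gtilde G z.2 (rho T z.2)).
  move=> z; apply: (@continuous_comp _ _ _ (@snd R rV) (fun x => Gtilde G x (rho T x))).
    exact: cvg_snd.
  exact: terminal_momentum_continuous.
have c1 : continuous (fun z : R * rV => primitive (fun s => B (clamp T s) z.2) T).
  by apply: (cpt (fun=> T)); exact: cst_continuous.
have c2 : continuous (fun z : R * rV => primitive (fun s => B (clamp T s) z.2) z.1).
  by apply: (cpt fst) => z; exact: cvg_fst.
by move=> z; exact: (continuous_add (cg z) (continuous_sub (c1 z) (c2 z))).
Qed.

Lemma is_derive_cost_to_go (t : R) x : is_derive t 1 (cost_to_go ^~ x) (- B (clamp T t) x).
Proof.
have := is_deriveB (is_derive_cst (Gtilde G x (rho T x) + primitive (fun s => B (clamp T s) x) T) t 1)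
  (is_derive_primitive t (@B_time x)).
rewrite sub0r; set p := (X in is_derive _ _ X _ -> _) => dp.
by have -> : cost_to_go ^~ x = p by apply/funext => s; rewrite /cost_to_go addrA.
Qed.

Lemma cost_to_go_end x : cost_to_go T x = Gtilde G x (rho T x).
Proof. by rewrite /cost_to_go subrr addr0. Qed.

(** * Duality between costate and cost-to-go *)

Section duality.
Variables (i : 'I_d) (chi sg : rV -> R) (M : R).
Hypothesis M0 : 0 <= M.
Hypothesis chi_C01 : C01 T (fun _ : R => chi).
Hypothesis sg_C12 : C12 T (fun _ : R => sg).
Hypothesis dchi : forall x, is_derive x (basis i) chi (sg x).
Hypothesis chi0 : forall x, ~ cube 0 M x -> chi x = 0.
Hypothesis sg0 : forall x, ~ cube 0 M x -> sg x = 0.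

Let dom := domain_cube (0 : rV) M0.

Let moment_continuous (u : R -> rV -> R) : continuous (fun z : R * rV => u z.1 z.2) ->
  continuous (fun t => KI M (u t)).
Proof.
move=> cu t; apply: (Kint_continuous (P := R) dom (p0 := t) (h := u)).
  by near=> s; exact: (slice_continuous (k := u) cu).
by move=> x _; exact: cu.
Unshelve. all: by end_near. Qed.

Let A (t : R) := KI M (fun x => chi x * P (clamp T t) x ord0 i).
Let S (t : R) := KI M (fun x => cost_to_go t x * sg x).
Let b (t : R) := KI M (fun x => B (clamp T t) x * sg x).

Let A_continuous : continuous A.
Proof.
apply: (moment_continuous (u := fun t x => chi x * P (clamp T t) x ord0 i)).
exact: ((C00P T0 _).1 (C00M T0 (C01_C00 chi_C01) (C01_C00 (P_C01 i)))).
Qed.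

Let Bsg_continuous : continuous (fun z : R * rV => B (clamp T z.1) z.2 * sg z.2).
Proof. exact: ((C00P T0 _).1 (C00M T0 B_C00 (C01_C00 (C12_C01 sg_C12)))). Qed.

Let b_continuous : continuous b.
Proof. exact: (moment_continuous (u := fun t x => B (clamp T t) x * sg x)). Qed.

Let sg_continuous : continuous sg.
Proof. exact: (C00_slice T0 (u := fun=> sg) (C01_C00 (C12_C01 sg_C12)) TT). Qed.

Let dS (t : R) : is_derive t 1 S (- b t).
Proof.
have cB : continuous (fun x => B (clamp T t) x * sg x).
  exact: (slice_continuous (k := fun t x => B (clamp T t) x * sg x) Bsg_continuous).
have -> : - b t = KI M (fun x => - (B (clamp T t) x * sg x)).
  rewrite -mulN1r -(KintZ dom _ cB).
  by apply: eq_Kint => x _; rewrite mulN1r.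
apply: (Kint_derive dom (q := fun t x => cost_to_go t x * sg x)
  (h := fun t x => - (B (clamp T t) x * sg x))).
- near=> s; split.
    move=> x; apply: (@continuous_mul _ (cost_to_go s) sg); last exact: sg_continuous.
    exact: (slice_continuous (k := cost_to_go) cost_to_go_continuous).
  move=> x _; apply/is_derive1P => e e0.
  have e1 : 0 < e / (`|sg x| + 1) by rewrite divr_gt0// ltr_wpDl.
  have := (is_derive1P _ _ _).1 (is_derive_cost_to_go s x) _ e1; apply: filterS => h Hh.
  rewrite (_ : _ - _ = sg x * (cost_to_go (h + s) x - cost_to_go s x - h * - B (clamp T s) x)); last by ring.
  rewrite normrM mulrC (le_trans (ler_wpM2r _ Hh))// mulrAC ler_wpM2r//.
  by rewrite mulrAC ler_pdivrMr ?ltr_wpDl// ler_pM2l// lerDl.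
- by move=> x; exact: (cvgN (cB x)).
- by move=> x _; exact: (cvgN (@Bsg_continuous (t, x))).
Unshelve. all: by end_near. Qed.

(* With this multiplier the weak form becomes [int_0^T th'^2 = 0]. *)
Let th' t := A t - S t.
Let th := primitive th'.

Let S_continuous : continuous S.
Proof. by move=> t; exact: (is_derive_continuous (dS t)). Qed.

Let th'_continuous : continuous th'.
Proof. by move=> t; exact: (continuous_sub (@A_continuous t) (@S_continuous t)). Qed.

Let dth (t : R) : is_derive t 1 th (th' t). Proof. exact: is_derive_primitive. Qed.

Let th_continuous : continuous th.
Proof. by move=> t; exact: (is_derive_continuous (dth t)). Qed.

(** As th(0) = 0 and S' = - b, the integral of (th S)' is th(T) S(T). This is also the right side of
    the weak form, since [cost_to_go] ends at Gtilde. Subtracting, the terms in [b] cancel and th'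
    (A - S) remains. *)
Let square_int : Kint leb id `[0, T] (fun t => th' t * th' t) = 0.
Proof.
have cA : continuous (fun t => th' t * A t - th t * b t).
  move=> t; exact: (continuous_sub (continuous_mul (@th'_continuous t) (@A_continuous t))
    (continuous_mul (@th_continuous t) (@b_continuous t))).
have cS : continuous (fun t => th t * - b t + S t * th' t).
  move=> t; apply: (continuous_add (continuous_mul (@th_continuous t) _)
    (continuous_mul (@S_continuous t) (@th'_continuous t))).
  exact: (cvgN (@b_continuous t)).
have dthS (t : R) : is_derive t 1 (fun t => th t * S t) (th t * - b t + S t * th' t).
  exact: (is_deriveMx (dth t) (dS t)).
have IS : Kint leb id `[0, T] (fun t => th t * - b t + S t * th' t) = th T * S T.
  rewrite -[RHS]subr0 -[X in _ - X](mul0r (S 0)) -{2}(primitive0 th').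
  by apply: (Rintegral_derive T0 cS) => t _; exact: dthS.
have IA : Kint leb id `[0, T] (fun t => th' t * A t - th t * b t) = th T * S T.
  rewrite -[S T](_ : KI M (fun x => Gtilde G x (rho T x) * sg x) = _); last first.
    by apply: eq_Kint => x _; rewrite cost_to_go_end.
  rewrite -(weak_costate T0 rho_C12 f_C01 rho_gt0 M0 dth th'_continuous (primitive0 _)
    chi_C01 sg_C12 dchi chi0 sg0 L_regular F_regular G_regular adm opt).
  by apply: eq_Kint => t; rewrite /= in_itv/= => tT; rewrite /A /b clamp_id.
have := KintB (domain_itv 0 T) cA cS; rewrite IA IS subrr => E; rewrite -[RHS]E.
by apply: eq_Kint => t _; rewrite {2}/th'; ring.
Qed.

(** The primitive [W] of the square is nondecreasing with equal values at 0 and [T], hence constant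
    on [0, T]. Its derivative th'^2 thus vanishes at every time, endpoints included. *)
Lemma costate_duality t : 0 <= t <= T ->
  KI M (fun x => chi x * P t x ord0 i) = KI M (fun x => cost_to_go t x * sg x).
Proof.
move=> tT; have c2 : continuous (fun t => th' t * th' t).
  by move=> s; exact: (continuous_mul (@th'_continuous s) (@th'_continuous s)).
pose W := primitive (fun t => th' t * th' t).
have dW (s : R) : is_derive s 1 W (th' s * th' s) by exact: is_derive_primitive.
have W_le s u : s <= u -> W s <= W u.
  move=> su; rewrite -subr_ge0 -(Rintegral_derive su c2 (fun t _ => dW t)).
  by apply: Rintegral_ge0 => // r _; rewrite -expr2 sqr_ge0.
have WT : W T = W 0.
  apply/eqP; rewrite -subr_eq0; apply/eqP.
  exact: (etrans (esym (Rintegral_derive T0 c2 (fun t _ => dW t))) square_int).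
have : th' t * th' t = 0.
  apply: (derive_eq0_itv T_gt0 tT _ (dW t)) => s /andP[s0 sT].
  by apply/eqP; rewrite eq_le (W_le _ _ s0) -WT W_le.
move=> /eqP; rewrite mulf_eq0 orbb subr_eq0 /A clamp_id// => /eqP.
exact.
Qed.

End duality.

Lemma is_derive_cost_to_go_space t x j : 0 <= t <= T ->
  is_derive x (basis j) (cost_to_go t) (- P t x ord0 j).
Proof.
move=> tT; apply: (is_derive_localised (i := j) (p := fun x => P t x ord0 j)).
- exact: (C00_slice T0 (C01_C00 (P_C01 j)) tT).
- exact: (slice_continuous (k := cost_to_go) cost_to_go_continuous).
move=> a h r h0 r0; apply: costate_duality.
- exact: (test_radius_ge0 a h0 (ltW r0)).
- exact: C01_bump_flux.
- exact: C12_bump_drop.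
- by move=> y; exact: (is_derive_bump_flux j a r h0 (lexx (0 : R)) y).
- by move=> y; exact: (bump_flux_out j h0 (ltW r0)).
- by move=> y; exact: (bump_drop_out j h0 (ltW r0)).
- exact: tT.
Qed.

Local Notation v := (velocity gamma f rho).

Let ln_C12 : C12 T (fun t x => ln (rho t x)).
Proof. exact: (C12_ln T0 rho_gt0 rho_C12). Qed.

(** [C01] speaks of all directions, the localisation only of the coordinate ones; continuity of the
    partial derivatives bridges the gap through [is_derive_curve]. *)
Lemma is_derive_cost_to_go_dir t x w : 0 <= t <= T ->
  is_derive x w (cost_to_go t) (- dotp w (P t x)).
Proof.
move=> tT; have dS y j := is_derive_cost_to_go_space y j tT.
have DE j y : 'D_(basis j) (cost_to_go t) y = - P t y ord0 j by have [_ ->] := dS y j.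
apply: is_derive_lineP.
have -> : - dotp w (P t x) = \sum_j w ord0 j * 'D_(basis j) (cost_to_go t) (0 *: w + x).
  rewrite /dotp -sumrN; apply: eq_bigr => j _.
  by rewrite DE mulrN scale0r add0r.
apply: (is_derive_curve (g := fun s => s *: w + x) (c := fun j s => s * w ord0 j)).
- by move=> j y; have [] := dS y j.
- move=> j; have -> : 'D_(basis j) (cost_to_go t) = (fun y => - P t y ord0 j).
    by apply/funext => y; exact: DE.
  move=> y.
  exact: (cvgN (@C00_slice _ _ T0 _ _ (C01_C00 (P_C01 j)) tT y)).
- move=> s; rewrite scale0r add0r addrC {1}(rV_sum_basis w) scaler_sumr; congr (_ + _).
  by apply: eq_bigr => j _; rewrite mul0r subr0 scalerA.
- move=> j; have := is_deriveMx (is_derive_id (0 : R) 1) (is_derive_cst (w ord0 j) (0 : R) 1).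
  by rewrite mulr0 add0r mulr1.
Qed.

Definition value_fun (t : R) (x : rV) : R := - cost_to_go t x - gamma * ln (rho t x).

Let C12Z (c : R) (u : R -> rV -> R) : C12 T u -> C12 T (fun t x => c * u t x).
Proof.
move=> cu; apply: (C12_comp T0 (phi := fun s => c * s) (phi' := fun=> c) (phi'' := fun=> 0) cu).
- move=> t x _; have := is_deriveZ c (is_derive_id (u t x) 1).
  by rewrite [_ *: _]mulr1.
- by move=> t x _; exact: cst_continuous.
Qed.

(** The second space derivatives come from the identification of the gradient with - P, which is
    itself [C01]. *)
Lemma cost_to_go_C12 : C12 T cost_to_go.
Proof.
have cC : C00 T cost_to_go.
  apply/(C00P T0) => z.
  apply: (@continuous_comp _ _ _ (fun z : R * rV => (clamp T z.1, z.2))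
    (fun z : R * rV => cost_to_go z.1 z.2)); last exact: cost_to_go_continuous.
  apply: (@continuous_pair _ _ _ (fun z : R * rV => clamp T z.1)); last exact: cvg_snd.
  by apply: (@continuous_comp _ _ _ (@fst R rV) (clamp T)); [exact: cvg_fst|exact: clamp_continuous].
apply: (C12_intro T0 (du := fun w t x => - dotp w (P t x)) (dtu := fun t x => - B (clamp T t) x) cC).
- by move=> w t x tT; exact: is_derive_cost_to_go_dir.
- move=> w; apply: (eq_C01 T0 (u := fun t x => \sum_j - w ord0 j * P t x ord0 j)).
    by move=> t _ x; rewrite /dotp -sumrN; apply: eq_bigr => j _; rewrite mulNr.
  by apply: (C01_sum T0) => j; exact: (C01M T0 (C01_cst T0 _) (P_C01 j)).
- by move=> t x _; exact: is_derive_cost_to_go.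
- by move=> t x _; exact: (cvgN (@B_continuous (t, x))).
Qed.

Lemma value_fun_C12 : C12 T value_fun.
Proof.
have -> : value_fun = (fun t x => -1 * cost_to_go t x + - gamma * ln (rho t x)).
  by apply/funext => t; apply/funext => x; rewrite mulN1r mulNr.
exact: (C12D T0 (C12Z (-1) cost_to_go_C12) (C12Z (- gamma) ln_C12)).
Qed.

Lemma grad_value_fun t x : 0 <= t <= T ->
  grad (value_fun t) x = P t x - gamma *: score rho t x.
Proof.
move=> tT; apply/rowP => j; rewrite [LHS]mxE.
have dl := C01_derive (C12_C01 ln_C12) (basis j) x tT.
have [_ ->] := is_deriveB (is_deriveN (is_derive_cost_to_go_dir x (basis j) tT)) (is_deriveZ gamma dl).
by rewrite opprK dotpC dotp_basis; move: (P t x) => p; rewrite !mxE.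
Qed.

Lemma momentum_value_fun t x : 0 <= t <= T -> momentum gamma rho value_fun t x = P t x.
Proof. by move=> tT; rewrite /momentum grad_value_fun// subrK. Qed.

Lemma divg_addZ (u w : rV -> rV) (c : R) x :
  (forall j, derivable (fun y => u y ord0 j) x (basis j)) ->
  (forall j, derivable (fun y => w y ord0 j) x (basis j)) ->
  divg (fun y => u y + c *: w y) x = divg u x + c * divg w x.
Proof.
move=> du dw; rewrite mulr_sumr -big_split/=; apply: eq_bigr => j _.
have -> : (fun y => (u y + c *: w y) ord0 j) = (fun y => u y ord0 j) + c \*: (fun y => w y ord0 j).
  apply/funext => y; transitivity (u y ord0 j + c * w y ord0 j); last by [].
  by rewrite !mxE.
have [_ E] := is_deriveD (derivableP (du j)) (is_deriveZ c (derivableP (dw j))).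
exact: E.
Qed.

Hypothesis L_convex : strongly_convex_in_v L.

Lemma DpH_value_fun t x : 0 <= t <= T ->
  differentiable (hamiltonian L t x) (momentum gamma rho value_fun t x) /\
  DpH_field L gamma rho value_fun t x = v t x.
Proof.
by move=> tT; rewrite /DpH_field momentum_value_fun//; exact: hamiltonian_vgrad.
Qed.

Let DpH_eq t : 0 <= t <= T -> DpH_field L gamma rho value_fun t = v t.
Proof. by move=> tT; apply/funext => x; have [_] := DpH_value_fun x tT. Qed.

Lemma DpH_value_fun_C01 : C01 T (DpH_field L gamma rho value_fun).
Proof.
apply: (eq_C01 T0 (u := v)); first by move=> t tT x; rewrite DpH_eq.
exact: (velocity_rV_C01 gamma T0 rho_C12 f_C01 rho_gt0).
Qed.

Let f_j_C01 j : C01 T (fun t x => f t x ord0 j).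
Proof. exact: ((C01_rVP T0 f).1 f_C01 j). Qed.

Let score_j_C01 j : C01 T (fun t x => score rho t x ord0 j).
Proof.
apply: (eq_C01 T0 _ (C12_C01D (basis j) ln_C12)) => t _ x.
by rewrite [RHS]mxE.
Qed.

Let C01_derivable (u : R -> rV -> R) t x w : C01 T u -> 0 <= t <= T -> derivable (u t) x w.
Proof. by move=> cu tT; have [] := C01_derive cu w x tT. Qed.

(** Since rho v = rho f + gamma grad rho, the divergence of rho v exceeds that of rho f by gamma
    times the Laplacian, and the continuity equation disposes of the rest. *)
Lemma fokker_planck_value_fun t x : 0 < t < T -> fokker_planck L gamma rho value_fun t x.
Proof.
move=> tT; have tT' := interior_itv tT; rewrite /fokker_planck DpH_eq//.
have -> : (fun y => rho t y *: v t y) = (fun y => rho t y *: f t y + gamma *: grad (rho t) y).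
  apply/funext => y; rewrite scalerDr; congr (_ + _).
  rewrite scalerA mulrC -scalerA; congr (_ *: _).
  apply/rowP => j; rewrite mxE [score _ _ _ _ _]mxE (derive_ln _ (C12_C01 rho_C12) tT' (rho_gt0 y tT')) [RHS]mxE.
  by rewrite mulVKf// gt_eqF// rho_gt0.
rewrite divg_addZ; last 2 first.
- move=> j; have -> : (fun y => (rho t y *: f t y) ord0 j) = (fun y => rho t y * f t y ord0 j).
    by apply/funext => y; rewrite mxE.
  exact: (@C01_derivable _ _ x (basis j) (C01M T0 (C12_C01 rho_C12) (f_j_C01 j)) tT').
- move=> j; have -> : (fun y => grad (rho t) y ord0 j) = 'D_(basis j) (rho t).
    by apply/funext => y; rewrite mxE.
  exact: (@C01_derivable _ _ x (basis j) (C12_C01D (basis j) rho_C12) tT').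
have [_ _ [ce _] _ _] := adm.
by rewrite addrA ce// add0r.
Qed.

(** Serves to eliminate the time derivative of ln rho that [value_fun] brings into the
    Hamilton-Jacobi equation. *)
Lemma continuity_log t x : 0 < t < T ->
  derive1 (fun s => ln (rho s x)) t + dotp (score rho t x) (f t x) + divg (f t) x = 0.
Proof.
move=> tT; have tT' := interior_itv tT; have r0 := rho_gt0 x tT'.
have rn : rho t x != 0 by rewrite gt_eqF.
have dt : derive1 (fun s => ln (rho s x)) t = (rho t x)^-1 * derive1 (rho ^~ x) t.
  rewrite derive1E.
  by have [_ ->] := is_derive_comp1 (C12_time x rho_C12 tT) (is_derive1_ln r0).
have [_ _ [ce _] _ _] := adm.
have : (rho t x)^-1 * (derive1 (rho ^~ x) t + divg (fun y => rho t y *: f t y) x) = 0.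
  by rewrite ce// mulr0.
rewrite mulrDr -dt => <-; rewrite -addrA; congr (_ + _).
rewrite -big_split/= mulr_sumr; apply: eq_bigr => j _.
have -> : (fun y => (rho t y *: f t y) ord0 j) = (fun y => rho t y * f t y ord0 j).
  by apply/funext => y; rewrite mxE.
have [_ ->] := is_deriveMx (C01_derive (C12_C01 rho_C12) (basis j) x tT')
  (C01_derive (f_j_C01 j) (basis j) x tT').
rewrite [score _ _ _ _ _]mxE (derive_ln _ (C12_C01 rho_C12) tT' r0).
set a := 'D_(basis j) (rho t) x; set b := 'D_(basis j) (fun y => f t y ord0 j) x.
transitivity ((rho t x)^-1 * a * f t x ord0 j + b); first by [].
by field.
Qed.

Lemma hamilton_jacobi_value_fun t x : 0 < t < T -> hamilton_jacobi L F gamma rho value_fun t x.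
Proof.
move=> tT; have tT' := interior_itv tT; rewrite /hamilton_jacobi DpH_eq//.
have dpsi : derive1 (value_fun ^~ x) t = B t x - gamma * derive1 (fun s => ln (rho s x)) t.
  rewrite derive1E.
  have [_ ->] := is_deriveB (is_deriveN (is_derive_cost_to_go t x))
    (is_deriveZ gamma (C12_time x ln_C12 tT)).
  by rewrite opprK clamp_id.
have lap : laplacian (value_fun t) x =
    divg (P t) x - gamma * laplacian (fun y => ln (rho t y)) x.
  rewrite /laplacian.
  have -> : grad (value_fun t) = (fun y => P t y + (- gamma) *: score rho t y).
    by apply/funext => y; rewrite grad_value_fun// scaleNr.
  rewrite divg_addZ ?mulNr// => j.
    exact: (@C01_derivable _ _ x (basis j) (P_C01 j) tT').
  exact: (@C01_derivable _ _ x (basis j) (score_j_C01 j) tT').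
have dv : divg (v t) x = divg (f t) x + gamma * laplacian (fun y => ln (rho t y)) x.
  rewrite divg_addZ// => j.
    exact: (@C01_derivable _ _ x (basis j) (f_j_C01 j) tT').
  exact: (@C01_derivable _ _ x (basis j) (score_j_C01 j) tT').
rewrite dpsi lap dv grad_value_fun// norm2_sqr.
have -> : dotp (P t x - gamma *: score rho t x) (v t x) = dotp (P t x) (v t x)
    - gamma * (dotp (score rho t x) (f t x) + gamma * dotp (score rho t x) (score rho t x)).
  by rewrite dotpC dotpBr dotpZr [dotp _ (P t x)]dotpC [dotp _ (score _ _ _)]dotpC {2}/velocity dotpDr dotpZr.
(* Here c1 = P . v, c2 = div P, c3 = L, c4 = Ftilde, c5 is the Laplacian of ln rho, c6 the squared
   score, and k1 + k2 + k3 = 0 is [continuity_log]. The divergence of v and the Laplacian of psi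
   each contribute - gamma^2 c5, which accounts for the coefficient 2 gamma^2; the squared score
   comes from grad psi . v. *)
have alg (c1 c2 c3 c4 k1 k2 k3 c5 c6 : R) : k1 + k2 + k3 = 0 ->
    c3 + c4 - c1 - gamma * c2 - gamma * k1 + (c1 - gamma * (k2 + gamma * c6))
    - gamma * (k3 + gamma * c5) + gamma * (c2 - gamma * c5) - c3 - c4
    + 2 * gamma ^+ 2 * c5 + gamma ^+ 2 * c6 = 0.
  move=> H; transitivity (- gamma * (k1 + k2 + k3)); last by rewrite H mulr0.
  ring.
rewrite [B t x]/source; exact: (alg _ _ _ _ _ _ _ _ _ (continuity_log x tT)).
Qed.

Lemma value_fun_end x : value_fun T x = - Gtilde G x (rho T x) - gamma * ln (rho T x).
Proof. by rewrite /value_fun cost_to_go_end. Qed.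

End optimal_pair.

End calculus.

Theorem proposition3 (R : realType) (d : nat) (d_gt0 : (0 < d)%N)
  (tend gamma : R) (tend_gt0 : 0 < tend) (gamma_gt0 : 0 < gamma)
  (rho0 : 'rV[R]_d -> R) (rho0_density : prob_density rho0)
  (L : R -> 'rV[R]_d -> 'rV[R]_d -> R)
  (F : R -> 'rV[R]_d -> R -> R)
  (G : 'rV[R]_d -> R -> R)
  (L_regular : regular_running_cost L)
  (F_regular : regular_density_cost F)
  (G_regular : regular_terminal_cost G)
  (L_strongly_convex : strongly_convex_in_v L)
  (f : R -> 'rV[R]_d -> 'rV[R]_d) (rho : R -> 'rV[R]_d -> R)
  (f_rho_solution : mfc_solution L F G gamma tend rho0 f rho) :
  exists psi : R -> 'rV[R]_d -> R,
    C12 tend psi /\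
    (forall t x, 0 <= t <= tend ->
      differentiable (hamiltonian L t x) (momentum gamma rho psi t x) /\
      f t x = DpH_field L gamma rho psi t x - gamma *: score rho t x) /\
    C01 tend (DpH_field L gamma rho psi) /\
    (forall t x, 0 < t < tend -> fokker_planck L gamma rho psi t x) /\
    (forall t x, 0 < t < tend -> hamilton_jacobi L F gamma rho psi t x) /\
    (forall x, rho 0 x = rho0 x) /\
    (forall x, psi tend x
       = - Gtilde G x (rho tend x) - gamma * ln (rho tend x)).
Proof.
have [adm opt] := f_rho_solution.
exists (value_fun tend gamma f rho L F G); split.
  exact: (value_fun_C12 tend_gt0 L_regular F_regular G_regular adm opt).
split.
  move=> t x tT.
  have [dH DE] := DpH_value_fun tend_gt0 L_regular F_regular G_regular adm opt
    L_strongly_convex x tT.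
  by split => //; rewrite DE addrK.
split.
  exact: (DpH_value_fun_C01 tend_gt0 L_regular F_regular G_regular adm opt L_strongly_convex).
split.
  by move=> t x; exact: (fokker_planck_value_fun tend_gt0 L_regular F_regular G_regular adm opt
    L_strongly_convex).
split.
  by move=> t x; exact: (hamilton_jacobi_value_fun tend_gt0 L_regular F_regular G_regular adm opt
    L_strongly_convex).
split; first by have [_ _ [_ ini] _ _] := adm.
by move=> x; exact: value_fun_end.
Qed.
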